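(* Let $R>0$ and let $k\ge1$ be an integer, so that $\mu_k>0$ is an eigenvalue of $\ddot w+\frac{\dot w}{\rho}=-\mu w$, $\dot w(0)=\dot w(R)=0$. Then $\mathcal{S}_k^+$ is a connected set and: (1) $(0,\mu_k/2)\in\overline{\mathcal{S}_k^+}$; (2) $0<\inf\{\lambda\in\mathbb{R}:\exists w\in E\text{ with }(w,\lambda)\in\mathcal{S}_k^+\}$; (3) $\sup\{\lambda\in\mathbb{R}:\exists w\in E\text{ with }(w,\lambda)\in\mathcal{S}_k^+\}<+\infty$; (4) $\mathcal{S}_k^+$ is unbounded and contains a sequence $(w_n,\lambda_n)$ such that $\|w_n\|_E\to\infty$ and $$\lim_{n\to\infty}\lambda_n=\begin{cases}\mu_{k/2}&\text{if }k\text{ is even},\\ \nu_{(k+1)/2}&\text{if }k\text{ is odd}.\end{cases}$$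
   Context: Fix $R>0$. $E$ is the Hilbert space of functions $w:[0,R]\to\mathbb{R}$ with $\int_0^R\rho\dot w^2\,d\rho<+\infty$, with inner product $(v,w)_E=\int_0^R\rho\dot v\dot w\,d\rho+\int_0^R\rho vw\,d\rho$ and norm $\|\cdot\|_E$. Let $\mathcal{W}$ be the set of pairs $(w,\lambda)\in E\times\mathbb{R}$ with $\lambda>0$ and $1+\sqrt\lambda\,w(\rho)>0$ for all $\rho\in[0,R]$. Let $\mathcal{S}$ be the set of $(w,\lambda)\in\mathcal{W}$ solving (in the classical sense) $$\ddot w+\frac{\dot w}{\rho}=-\lambda w-\frac{\lambda w}{1+\sqrt\lambda\,w}\ \text{ on }(0,R),\qquad\dot w(0)=\dot w(R)=0.$$ (This is the equation for radial functions $w(\|x\|)$ on the disc of radius $R$ in $\mathbb{R}^2$ such that $u=\lambda^{-1/2}+w$ is a positive solution of $-\Delta u=\lambda u-u^{-1}$ with Neumann boundary condition.) $\mathcal{S}_k^+$ is the set of $(w,\lambda)\in\mathcal{S}$ such that $w$ has exactly $k$ nodes (zeros) in $(0,R)$ and $w(0)>0$. Closure, connectedness and boundedness are in $E\times\mathbb{R}$. $J_0$ is the Bessel function of the first kind of order $0$. For $k\ge1$, $\mu_k=(y_k/R)^2$ where $y_k$ is the $k$-th nontrivial (positive) zero of $J_0'$; these are the nonzero eigenvalues of $\ddot w+\dot w/\rho=-\mu w$, $\dot w(0)=\dot w(R)=0$. For $k\ge1$, $\nu_k=(z_k/R)^2$ where $z_k$ is the $k$-th positive zero of $J_0$; these are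 the eigenvalues of $\ddot v+\dot v/\rho=-\nu v$, $\dot v(0)=0$, $v(R)=0$. *)

(* Defs.v *)
From HB Require Import structures.
From mathcomp Require Import all_boot all_order all_algebra.
From mathcomp Require Import all_classical all_reals all_analysis.
From mathcomp Require Import measurable_realfun.
From mathcomp Require Import ring lra.

Set Implicit Arguments.
Unset Strict Implicit.
Unset Printing Implicit Defensive.

Import Order.TTheory GRing.Theory Num.Theory.
Import numFieldNormedType.Exports.

Local Open Scope classical_set_scope.
Local Open Scope card_scope.
Local Open Scope ring_scope.

Section WeakDerivative.
Context {R : realType}.
Notation mu := (@lebesgue_measure R).
Implicit Types (r : R) (w v f g h : R -> R).

(* [w] is locally absolutely continuous on ]0, r] with derivative [g] a.e.
   Nothing is asked at 0: in dimension two a function of finite energy may be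
   unbounded there. *)
Definition is_weak_derivative r w g := forall a b, 0 < a -> a <= b -> b <= r ->
  mu.-integrable `[a, b] (EFin \o g) /\
  w b - w a = \int[mu]_(t in `[a, b]) g t.

(* Unique a.e. on [0, r], see is_weak_derivative_uniq; junk value 0 when there is
   no weak derivative. *)
Definition weak_derivative r w : R -> R := xget (cst 0) (is_weak_derivative r w).

Definition wenergy r f : \bar R :=
  (\int[mu]_(x in `[0%R, r]) (x * f x ^+ 2)%:E)%E.

Definition finite_energy r w :=
  exists2 g, is_weak_derivative r w g & (wenergy r g < +oo)%E.

Definition wdot r f g : R := \int[mu]_(x in `[0, r]) (x * f x * g x).

Definition wL2 r f := measurable_fun `[0, r] f /\ (wenergy r f < +oo)%E.

Lemma is_weak_derivative0 r : is_weak_derivative r 0 0.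
Proof.
move=> a b a0 ab br; split; first exact: integrable0.
by rewrite subrr /Rintegral integral0.
Qed.

Lemma is_weak_derivativeD r w v g h c :
  is_weak_derivative r w g -> is_weak_derivative r v h ->
  is_weak_derivative r (c *: w + v) (c *: g + h).
Proof.
move=> wg vh a b a0 ab br.
have [ig eg] := wg a b a0 ab br; have [ih eh] := vh a b a0 ab br.
have icg : mu.-integrable `[a, b] (EFin \o (fun x => c * g x)).
  by apply: eq_integrable (integrableZl _ c ig).
split.
  by apply: eq_integrable (integrableD _ icg ih).
change (c * w b + v b - (c * w a + v a) = \int[mu]_(t in `[a, b]) (c * g t + h t)).
transitivity (c * (w b - w a) + (v b - v a)); first by ring.
by rewrite eg eh -RintegralZl// -RintegralD.
Qed.

Lemma itv_oc_bigcup r : `]0, r]%classic = \bigcup_n `[n.+1%:R^-1, r]%classic.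
Proof.
apply/seteqP; split => [x|x [n _]]/=; rewrite !in_itv/=.
  move=> /andP[x0 xr]; exists (Num.truncn x^-1) => //=.
  rewrite in_itv/= xr andbT invf_ple ?posrE//; exact/ltW/truncnS_gt.
by move=> /andP[nx ->]; rewrite andbT (lt_le_trans _ nx).
Qed.

Lemma measurable_fun_itv0 r f :
  (forall n, measurable_fun `[n.+1%:R^-1, r] f) -> measurable_fun `[0, r] f.
Proof.
move=> mf; apply: (@measurable_funS _ _ _ _ ([set 0] `|` `]0, r])) => //.
- by apply: measurableU.
- move=> x /=; rewrite !in_itv/= le_eqVlt => /andP[/orP[/eqP<-|->] ->];
    by [left|right].
apply/measurable_funU => //; split; first exact: measurable_fun_set1.
by rewrite itv_oc_bigcup; apply/measurable_fun_bigcup.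
Qed.

Lemma weak_derivative_measurable r w g :
  is_weak_derivative r w g -> measurable_fun `[0, r] g.
Proof.
move=> wg; apply: measurable_fun_itv0 => n.
have [nr|rn] := leP n.+1%:R^-1 r.
  have n0 : 0 < n.+1%:R^-1 :> R by [].
  by have [/measurable_int/measurable_EFinP] := wg _ _ n0 nr (lexx r).
by rewrite set_itv_ge ?bnd_simp -?ltNge//; exact: measurable_fun_set0.
Qed.

Lemma weak_derivative_id_measurable r w g :
  is_weak_derivative r w g -> measurable_fun `[0, r] w.
Proof.
move=> wg; apply: measurable_fun_itv0 => n.
have [nr|rn] := leP n.+1%:R^-1 r; last first.
  by rewrite set_itv_ge ?bnd_simp -?ltNge//; exact: measurable_fun_set0.
set a := n.+1%:R^-1; have a0 : 0 < a by rewrite /a.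
have [ig _] := wg _ _ a0 nr (lexx r).
have ci := parameterized_integral_continuous nr ig.
have mi := subspace_continuous_measurable_fun
  (measurable_itv `[a, r]) ci.
apply: (@eq_measurable_fun _ _ _ _ _
  (fun x => w a + parameterized_integral mu a x g)); last first.
  exact: measurable_funD.
move=> x; rewrite inE/= in_itv/= => /andP[ax xr].
have [_ e] := wg _ _ a0 ax xr.
by rewrite /parameterized_integral -e addrC subrK.
Qed.

Lemma weak_derivative0_ae r g : is_weak_derivative r 0 g ->
  {ae mu, forall x, x \in `[0, r] -> g x = 0}.
Proof.
move=> wg.
have H : {ae mu, forall x n, n.+1%:R^-1 < x -> x < r -> g x = 0}.
  apply: ae_foralln => n; set a := n.+1%:R^-1.
  have a0 : 0 < a by rewrite /a.
  have [ar|ra] := leP a r; last first.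
    by apply: aeW => x ax xr; have := lt_trans ra (lt_trans ax xr); rewrite ltxx.
  have [ig _] := wg _ _ a0 ar (lexx r).
  pose f := g \_ `[a, r].
  have intf : mu.-integrable setT (EFin \o f).
    by move: ig; rewrite integrable_mkcond//= (restrict_EFin g).
  have locf : locally_integrable [set: R] f by exact: integrable_locally.
  have intf' y : mu.-integrable [set` Interval (BLeft a) (BRight y)] (EFin \o f).
    by apply: integrableS intf.
  have := FTC1 intf' locf.
  apply: filterS; first exact: (ae_filter_ringOfSetsType mu).
  move=> x H ax xr.
  have ax' : (BLeft a < BRight x)%E by rewrite /= lte_fin.
  have [_] := H ax'; rewrite {2}/f patchE mem_set ?/= ?in_itv/= ?(ltW ax) ?(ltW xr)// => <-.
  rewrite derive1E.
  transitivity ('D_1 (cst (0 : R)) x); last by rewrite derive_cst.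
  apply: near_eq_derive.
  have xar : x \in `]a, r[ by rewrite in_itv/= ax.
  near=> y.
  have : y \in `]a, r[ by near: y; exact: near_in_itvoo.
  rewrite in_itv/= => /andP[ay yr].
  transitivity (\int[mu]_(t in `[a, y]) g t).
    apply: eq_Rintegral => t; rewrite inE/= in_itv/= => /andP[At ty].
    by rewrite /f patchE mem_set//= in_itv/= At (le_trans ty (ltW yr)).
  by have [_ <-] := wg _ _ a0 (ltW ay) (ltW yr); rewrite subrr.
have n1 (c : R) : {ae mu, forall x, x != c}.
  exists [set c]; split => //; first exact: lebesgue_measure_set1.
  by move=> x /= /negP; rewrite negbK => /eqP.
have := n1 r; have := n1 0; move: H.
apply: filterS3; first exact: (ae_filter_ringOfSetsType mu).
move=> x H x0 xr /=; rewrite in_itv/= => /andP[x0' xr'].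
have {}x0 : 0 < x by rewrite lt_neqAle eq_sym x0.
apply: (H (Num.truncn x^-1)); last by rewrite lt_neqAle xr.
rewrite invf_plt ?posrE//; exact: truncnS_gt.
Unshelve. all: by end_near. Qed.

Lemma is_weak_derivative_uniq r w g h :
  is_weak_derivative r w g -> is_weak_derivative r w h ->
  {ae mu, forall x, x \in `[0, r] -> g x = h x}.
Proof.
move=> wg wh.
have := is_weak_derivativeD (-1) wh wg.
rewrite (_ : _ + w = 0); last by rewrite scaleN1r addNr.
move=> /weak_derivative0_ae; apply: filterS; first exact: (ae_filter_ringOfSetsType mu).
move=> x /[apply].
rewrite scaleN1r !fctE addrC => /eqP; rewrite subr_eq0 => /eqP.
by [].
Qed.

Lemma weak_derivativeP r w g : is_weak_derivative r w g ->
  is_weak_derivative r w (weak_derivative r w).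
Proof. by move=> wg; apply: xgetPex; exists g. Qed.

Lemma wenergy_ae r f g : measurable_fun `[0, r] f -> measurable_fun `[0, r] g ->
  {ae mu, forall x, x \in `[0, r] -> f x = g x} -> wenergy r f = wenergy r g.
Proof.
move=> mf mg fg; apply: ge0_ae_eq_integral => //.
- apply/measurable_EFinP; apply: measurable_funM => //.
  exact: (@measurable_funX _ _ _ _ f).
- apply/measurable_EFinP; apply: measurable_funM => //.
  exact: (@measurable_funX _ _ _ _ g).
- by move=> x /=; rewrite in_itv/= lee_fin => /andP[x0 _]; rewrite mulr_ge0 ?sqr_ge0.
- by move=> x /=; rewrite in_itv/= lee_fin => /andP[x0 _]; rewrite mulr_ge0 ?sqr_ge0.
- move: fg; apply: filterS; first exact: (ae_filter_ringOfSetsType mu).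
  by move=> x fg xr; rewrite fg.
Qed.

Lemma wdot_wenergy r f : wdot r f f = fine (wenergy r f).
Proof.
by congr fine; apply: eq_integral => x _; rewrite expr2 mulrA.
Qed.

Lemma wL2_integrable r f : wL2 r f ->
  mu.-integrable `[0, r] (EFin \o (fun x => x * f x ^+ 2)).
Proof.
move=> [mf ef]; apply/integrableP; split.
  apply/measurable_EFinP; apply: measurable_funM => //.
  exact: (@measurable_funX _ _ _ _ f).
apply: le_lt_trans ef; rewrite le_eqVlt; apply/orP; left; apply/eqP.
apply: eq_integral => x; rewrite inE/= in_itv/= => /andP[x0 _].
by rewrite ger0_norm// mulr_ge0 ?sqr_ge0.
Qed.

Lemma wL2_prod_integrable r f g : wL2 r f -> wL2 r g ->
  mu.-integrable `[0, r] (EFin \o (fun x => x * f x * g x)).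
Proof.
move=> lf lg; have [mf _] := lf; have [mg _] := lg.
have : mu.-integrable `[0, r]
    (EFin \o (fun x => x * f x ^+ 2 + x * g x ^+ 2)).
  by apply: eq_integrable (integrableD _ (wL2_integrable lf) (wL2_integrable lg)).
apply: le_integrable => //.
  by apply/measurable_EFinP; do 2 apply: measurable_funM => //.
move=> x /=; rewrite in_itv/= => /andP[x0 _]; rewrite lee_fin.
rewrite [leRHS]ger0_norm; last by rewrite addr_ge0// mulr_ge0 ?sqr_ge0.
rewrite !normrM (ger0_norm x0) -mulrDr -mulrA ler_wpM2l//.
have := sqr_ge0 (`|f x| - `|g x|); rewrite -(real_normK (num_real (f x))).
rewrite -(real_normK (num_real (g x))).
have := normr_ge0 (f x); have := normr_ge0 (g x).
move: `|f x| `|g x| => p q; nra.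
Qed.

Lemma wL2D r f g c : wL2 r f -> wL2 r g -> wL2 r (c *: f + g).
Proof.
move=> lf lg; have [mf _] := lf; have [mg _] := lg.
have m : measurable_fun `[0, r] (c *: f + g).
  by apply: measurable_funD => //; exact: measurable_funM.
split => //.
have ic : mu.-integrable `[0, r] (EFin \o (fun x => 2 * c ^+ 2 * (x * f x ^+ 2))).
  by apply: eq_integrable (integrableZl _ (2 * c ^+ 2) (wL2_integrable lf)).
have id : mu.-integrable `[0, r] (EFin \o (fun x => 2 * (x * g x ^+ 2))).
  by apply: eq_integrable (integrableZl _ 2 (wL2_integrable lg)).
have : mu.-integrable `[0, r] (EFin \o (fun x => x * (c *: f + g) x ^+ 2)).
  have : mu.-integrable `[0, r]
      (EFin \o (fun x => 2 * c ^+ 2 * (x * f x ^+ 2) + 2 * (x * g x ^+ 2))).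
    by apply: eq_integrable (integrableD _ ic id).
  apply: le_integrable => //.
    apply/measurable_EFinP; apply: measurable_funM => //.
    exact: (@measurable_funX _ _ _ _ (c *: f + g)).
  move=> x /=; rewrite in_itv/= => /andP[x0 _]; rewrite lee_fin.
  have h0 u := mulr_ge0 x0 (sqr_ge0 u); have c0 := mulr_ge0 (ler0n R 2) (sqr_ge0 c).
  rewrite (ger0_norm (h0 _)) ger0_norm; last first.
    exact: addr_ge0 (mulr_ge0 c0 (h0 _)) (mulr_ge0 (ler0n R 2) (h0 _)).
  have -> : (c *: f + g) x = c * f x + g x by [].
  have -> : 2 * c ^+ 2 * (x * f x ^+ 2) + 2 * (x * g x ^+ 2) =
     x * (2 * ((c * f x) ^+ 2 + g x ^+ 2)) by ring.
  rewrite ler_wpM2l// -subr_ge0.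
  rewrite [leRHS](_ : _ = (c * f x - g x) ^+ 2) ?sqr_ge0//; ring.
move=> /integrableP[_]; apply: le_lt_trans.
rewrite le_eqVlt; apply/orP; left; apply/eqP.
apply: eq_integral => x; rewrite inE/= in_itv/= => /andP[x0 _].
by rewrite ger0_norm// mulr_ge0 ?sqr_ge0.
Qed.

Lemma wdotC r f g : wdot r f g = wdot r g f.
Proof. by apply: eq_Rintegral => x _; rewrite mulrAC. Qed.

Lemma wdotDl r f g h c : wL2 r f -> wL2 r g -> wL2 r h ->
  wdot r (c *: f + g) h = c * wdot r f h + wdot r g h.
Proof.
move=> lf lg lh.
have ifh := wL2_prod_integrable lf lh; have igh := wL2_prod_integrable lg lh.
have icfh : mu.-integrable `[0, r] (EFin \o (fun x => c * (x * f x * h x))).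
  by apply: eq_integrable (integrableZl _ c ifh).
rewrite /wdot -RintegralZl// -RintegralD//.
apply: eq_Rintegral => x _.
by have -> : (c *: f + g) x = c * f x + g x by []; ring.
Qed.

Lemma wdotZZ r f c : wL2 r f -> wdot r (c *: f) (c *: f) = c ^+ 2 * wdot r f f.
Proof.
move=> lf; rewrite /wdot -RintegralZl//; last exact: wL2_prod_integrable.
apply: eq_Rintegral => x _.
by have -> : (c *: f) x = c * f x by []; ring.
Qed.

Lemma wdot_ge0 r f : 0 <= wdot r f f.
Proof.
apply: Rintegral_ge0 => x /=; rewrite in_itv/= => /andP[x0 _].
by rewrite -mulrA mulr_ge0// -expr2 sqr_ge0.
Qed.

Lemma finite_energy_wL2 r w g :
  is_weak_derivative r w g -> (wenergy r g < +oo)%E -> wL2 r w.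
Proof.
move=> wg eg; have mw := weak_derivative_id_measurable wg.
split=> //.
have lg : wL2 r g by split=> //; exact: weak_derivative_measurable wg.
have iA := wL2_integrable lg.
pose A := \int[mu]_(t in `[0, r]) (t * g t ^+ 2).
pose M := 2 * (r * w r ^+ 2) + 2 * (A + r) ^+ 2.
have bd x : 0 < x -> x <= r -> x * w x ^+ 2 <= M.
  move=> x0 xr; have [ig eq] := wg _ _ x0 xr (lexx r).
  have sx0 : 0 < Num.sqrt x by rewrite sqrtr_gt0.
  pose s := (Num.sqrt x)^-1.
  have s0 : 0 < s by rewrite invr_gt0.
  have xs : x * s ^+ 2 = 1.
    by rewrite /s exprVn sqr_sqrtr ?ltW// divff// gt_eqF.
  pose G := fun t => t * g t ^+ 2 + 1.
  have i1 : mu.-integrable `[0, r] (EFin \o (fun=> 1 : R)).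
    apply: measurable_bounded_integrable => //.
      by rewrite /= lebesgue_measure_itv/=; case: ifP => // _; rewrite -EFinB ltry.
    exact: bounded_cst.
  have iG0 : mu.-integrable `[0, r] (EFin \o G).
    by apply: eq_integrable (integrableD _ iA i1).
  have sub : `[x, r]%classic `<=` `[0, r]%classic.
    by apply: subset_itvr; rewrite bnd_simp; exact: ltW.
  have iG : mu.-integrable `[x, r] (EFin \o G) by exact: integrableS iG0.
  have isG : mu.-integrable `[x, r] (EFin \o (fun t => s * G t)).
    by apply: eq_integrable (integrableZl _ s iG).
  have leG : \int[mu]_(t in `[x, r]) G t <= A + r.
    have -> : A + r = \int[mu]_(t in `[0, r]) G t.
      rewrite RintegralD// Rintegral_cst//=.
      by rewrite lebesgue_measure_itv/= lte_fin (lt_le_trans x0 xr)/= subr0 mul1r.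
    rewrite -lee_fin /Rintegral !fineK; [|exact: integrable_fin_num..].
    apply: ge0_subset_integral => //.
    - by case/integrableP : iG0.
    - move=> t /=; rewrite in_itv/= lee_fin => /andP[t0 _].
      by rewrite addr_ge0// mulr_ge0 ?sqr_ge0.
  have I_le : `|w r - w x| <= s * (A + r).
    rewrite eq (le_trans (le_normr_Rintegral _ ig))//.
    apply: (@le_trans _ _ (\int[mu]_(t in `[x, r]) (s * G t))); last first.
      by rewrite RintegralZl//; exact: (ler_wpM2l (ltW s0) leG).
    apply: le_Rintegral => //; first exact: integrable_norm.
    move=> t /=; rewrite in_itv/= => /andP[xt _].
    have : 1 <= t * s ^+ 2 by rewrite -xs ler_wpM2r ?sqr_ge0.
    rewrite /G -(real_normK (num_real (g t))).
    have := normr_ge0 (g t); move: `|g t| => p p0 ts.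
    rewrite -(ler_pM2l s0).
    have : p ^+ 2 <= t * s ^+ 2 * p ^+ 2 by rewrite ler_peMl ?sqr_ge0.
    have -> : s * (s * (t * p ^+ 2 + 1)) = t * s ^+ 2 * p ^+ 2 + s ^+ 2 by ring.
    have := sqr_ge0 (s - p); nra.
  have I2 : x * (w r - w x) ^+ 2 <= (A + r) ^+ 2.
    rewrite -[leRHS]mul1r -{1}xs -mulrA ler_wpM2l ?(ltW x0)// -exprMn.
    rewrite -(real_normK (num_real (w r - w x))) lerXn2r ?nnegrE//.
    exact: le_trans I_le.
  have : x * w r ^+ 2 <= r * w r ^+ 2 by rewrite ler_wpM2r ?sqr_ge0.
  have : x * w x ^+ 2 <= 2 * (x * w r ^+ 2) + 2 * (x * (w r - w x) ^+ 2).
    have -> : 2 * (x * w r ^+ 2) + 2 * (x * (w r - w x) ^+ 2) =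
      x * w x ^+ 2 + x * (2 * w r - w x) ^+ 2 by ring.
    by rewrite lerDl; exact: (mulr_ge0 (ltW x0) (sqr_ge0 _)).
  rewrite /M; move: I2; lra.
have M0 : r >= 0 -> 0 <= M.
  move=> r0; apply: addr_ge0; apply: mulr_ge0; rewrite ?sqr_ge0//.
  exact: mulr_ge0 (sqr_ge0 _).
apply: (@le_lt_trans _ _ (\int[mu]_(x in `[0%R, r]) (M%:E))%E).
  apply: ge0_le_integral => //.
  - by move=> x /=; rewrite in_itv/= lee_fin => /andP[x0 _]; rewrite mulr_ge0 ?sqr_ge0.
  - apply/measurable_EFinP; apply: measurable_funM => //.
    exact: (@measurable_funX _ _ _ _ w).
  - move=> x /=; rewrite in_itv/= lee_fin => /andP[x0 xr].
    move: x0; rewrite le_eqVlt => /orP[/eqP x0|x0]; last exact: bd.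
    by rewrite -x0 mul0r M0// x0.
rewrite integral_cst//= lebesgue_measure_itv/=.
by case: ifP => _; rewrite ?mule0// -EFinB -EFinM ltry.
Qed.

End WeakDerivative.

(* The space E: functions on [0, r] (values outside [0, r] are irrelevant) of
   finite energy, with the topology of the seminorm of its inner product.  The
   Hilbert space is its separated quotient; two functions equal a.e. on [0, r]
   are at distance 0. *)
Section RadialSpace.
Context {R : realType} (r : R).

Definition finite_energy_pred : {pred R -> R} := mem [set w | finite_energy r w].

Lemma finite_energy_submod_closed : submod_closed finite_energy_pred.
Proof.
split=> [|c v w].
  rewrite inE; exists 0; first exact: is_weak_derivative0.
  rewrite /wenergy integral0_eq// => x _; by rewrite expr0n/= mulr0.
rewrite !inE => -[g vg eg] [h wh eh]; exists (c *: g + h).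
  exact: is_weak_derivativeD.
have lg : wL2 r g by split=> //; exact: weak_derivative_measurable vg.
have lh : wL2 r h by split=> //; exact: weak_derivative_measurable wh.
exact: (wL2D c lg lh).2.
Qed.

HB.instance Definition _ :=
  GRing.isSubmodClosed.Build _ _ finite_energy_pred finite_energy_submod_closed.

Record radialE := RadialE {
  radialE_fun :> R -> R;
  radialE_subproof : radialE_fun \in finite_energy_pred }.

HB.instance Definition _ := [isSub for radialE_fun].
HB.instance Definition _ := [Choice of radialE by <:].
HB.instance Definition _ := [SubChoice_isSubLmodule of radialE by <:].

Definition radialE_dot (v w : radialE) : R :=
  wdot r (weak_derivative r v) (weak_derivative r w) + wdot r v w.

Definition radialE_norm (w : radialE) : R := Num.sqrt (radialE_dot w w).

Lemma radialE_is_weak_derivative (w : radialE) :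
  is_weak_derivative r w (weak_derivative r w).
Proof.
by have := radialE_subproof w; rewrite inE => -[g wg _]; exact: weak_derivativeP wg.
Qed.

Lemma radialE_derivative_wL2 (w : radialE) : wL2 r (weak_derivative r w).
Proof.
have wd := radialE_is_weak_derivative w.
split; first exact: weak_derivative_measurable wd.
have := radialE_subproof w; rewrite inE => -[g wg].
have mg := weak_derivative_measurable wg; have md := weak_derivative_measurable wd.
by rewrite (wenergy_ae mg md (is_weak_derivative_uniq wg wd)).
Qed.

Lemma radialE_wL2 (w : radialE) : wL2 r w.
Proof.
exact: finite_energy_wL2 (radialE_is_weak_derivative w)
  (radialE_derivative_wL2 w).2.
Qed.

Lemma radialE_normE (w : radialE) g : is_weak_derivative r w g ->
  radialE_norm w = Num.sqrt (wdot r g g + wdot r w w).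
Proof.
move=> wg; have wd := radialE_is_weak_derivative w.
rewrite /radialE_norm /radialE_dot !wdot_wenergy.
have mg := weak_derivative_measurable wg; have md := weak_derivative_measurable wd.
by rewrite (wenergy_ae md mg (is_weak_derivative_uniq wd wg)).
Qed.

Let nE c (u v : radialE) : radialE_norm (c *: u + v) =
  Num.sqrt (c ^+ 2 * radialE_dot u u + 2 * c * radialE_dot u v + radialE_dot v v).
Proof.
have lu := radialE_wL2 u; have lv := radialE_wL2 v.
have lu' := radialE_derivative_wL2 u; have lv' := radialE_derivative_wL2 v.
rewrite (@radialE_normE _ (c *: weak_derivative r u + weak_derivative r v)); last first.
  by apply: is_weak_derivativeD; exact: radialE_is_weak_derivative.
congr Num.sqrt; rewrite /radialE_dot.
have E f g : wL2 r f -> wL2 r g -> wdot r (c *: f + g) (c *: f + g) =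
    c ^+ 2 * wdot r f f + 2 * c * wdot r f g + wdot r g g.
  move=> lf lg; have l := wL2D c lf lg.
  rewrite wdotDl// [wdot r f _]wdotC [wdot r g _]wdotC !wdotDl//.
  rewrite [wdot r g f]wdotC; ring.
by rewrite !E//; ring.
Qed.

Let dot_ge0 (u : radialE) : 0 <= radialE_dot u u.
Proof. by rewrite addr_ge0 ?wdot_ge0. Qed.

Let quad_ge0 c (u v : radialE) :
  0 <= c ^+ 2 * radialE_dot u u + 2 * c * radialE_dot u v + radialE_dot v v.
Proof.
have lu := radialE_wL2 u; have lv := radialE_wL2 v.
have lu' := radialE_derivative_wL2 u; have lv' := radialE_derivative_wL2 v.
have E f g : wL2 r f -> wL2 r g ->
    0 <= c ^+ 2 * wdot r f f + 2 * c * wdot r f g + wdot r g g.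
  move=> lf lg; have := wdot_ge0 r (c *: f + g).
  have l := wL2D c lf lg.
  rewrite wdotDl// [wdot r f (_ + _)]wdotC [wdot r g (_ + _)]wdotC !wdotDl//.
  by rewrite [wdot r g f]wdotC; congr (0 <= _); ring.
have := addr_ge0 (E _ _ lu' lv') (E _ _ lu lv).
by rewrite /radialE_dot; congr (0 <= _); ring.
Qed.

Lemma radialE_ler_normD (u v : radialE) :
  radialE_norm (u + v) <= radialE_norm u + radialE_norm v.
Proof.
rewrite -[u]scale1r nE scale1r /radialE_norm.
have := dot_ge0 u; have := dot_ge0 v; have := fun c => quad_ge0 c u v.
move: (radialE_dot u u) (radialE_dot u v) (radialE_dot v v) => a b c q c0 a0.
have sa : Num.sqrt a ^+ 2 = a by rewrite sqr_sqrtr.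
have sc : Num.sqrt c ^+ 2 = c by rewrite sqr_sqrtr.
have pa := sqrtr_ge0 a; have pc := sqrtr_ge0 c.
have bac : b <= Num.sqrt a * Num.sqrt c.
  have b2 : b ^+ 2 <= a * c.
    have [a_eq0|an0] := eqVneq a 0.
      have [->|bn0] := eqVneq b 0; first by rewrite expr0n/= a_eq0 mul0r.
      have := q (- (c + 1) / (2 * b)); rewrite a_eq0 mulr0 add0r.
      rewrite (_ : 2 * (- (c + 1) / (2 * b)) * b = - (c + 1)); last by field.
      by rewrite opprD addrAC addNr add0r lerNr oppr0 ler10.
    have apos : 0 < a by rewrite lt_neqAle eq_sym an0.
    have := q (- b / a).
    rewrite (_ : _ + c = (a * c - b ^+ 2) / a); last by field.
    by rewrite pmulr_lge0 ?invr_gt0// subr_ge0.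
  have [b0|b0] := leP b 0; first by rewrite (le_trans b0)// mulr_ge0.
  by rewrite -ler_sqr ?nnegrE ?mulr_ge0 ?(ltW b0)// exprMn sa sc.
rewrite -ler_sqr ?nnegrE ?sqrtr_ge0 ?addr_ge0 ?sqrtr_ge0//.
rewrite sqr_sqrtr; last by have := q 1; rewrite expr1n.
by rewrite expr1n !mul1r mulr1 sqrrD sa sc; nra.
Qed.

Lemma radialE_normZ c (u : radialE) :
  radialE_norm (c *: u) = `|c| * radialE_norm u.
Proof.
have lu := radialE_wL2 u; have lu' := radialE_derivative_wL2 u.
rewrite (@radialE_normE _ (c *: weak_derivative r u)); last first.
  rewrite -[X in is_weak_derivative _ X]addr0 -[X in is_weak_derivative _ _ X]addr0.
  apply: is_weak_derivativeD; first exact: radialE_is_weak_derivative.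
  exact: is_weak_derivative0.
by rewrite !wdotZZ// -mulrDr sqrtrM ?sqr_ge0// sqrtr_sqr.
Qed.

Lemma radialE_normN (u : radialE) : radialE_norm (- u) = radialE_norm u.
Proof. by rewrite -scaleN1r radialE_normZ normrN1 mul1r. Qed.

Lemma radialE_normMn (u : radialE) n : radialE_norm (u *+ n) = radialE_norm u *+ n.
Proof. by rewrite -scaler_nat radialE_normZ normr_nat mulr_natl. Qed.

HB.instance Definition _ := Num.Zmodule_isSemiNormed.Build R radialE
  radialE_ler_normD radialE_normMn radialE_normN.

Definition radialE_ball (u : radialE) (e : R) : set radialE :=
  [set v | radialE_norm (u - v) < e].

Let rball_center u (e : R) : 0 < e -> radialE_ball u e u.
Proof.
by rewrite /radialE_ball/= subrr; have := radialE_normMn 0 0; rewrite !mulr0n => ->.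
Qed.

Let rball_sym u v (e : R) : radialE_ball u e v -> radialE_ball v e u.
Proof. by rewrite /radialE_ball/= -opprB radialE_normN. Qed.

Let rball_triangle u v w (e1 e2 : R) :
  radialE_ball u e1 v -> radialE_ball v e2 w -> radialE_ball u (e1 + e2) w.
Proof.
rewrite /radialE_ball/= => uv vw; rewrite -(subrKA v).
exact: le_lt_trans (radialE_ler_normD _ _) (ltrD uv vw).
Qed.

HB.instance Definition _ := hasNbhs.Build radialE (nbhs_ (entourage_ radialE_ball)).
HB.instance Definition _ := @Nbhs_isPseudoMetric.Build R radialE
  (entourage_ radialE_ball) erefl radialE_ball
  rball_center rball_sym rball_triangle erefl.

End RadialSpace.
Arguments radialE {R} r.

Section NeumannProblem.
Context {R : realType}.
Implicit Types (r lambda : R) (k : nat).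

(* [w] is twice differentiable on ]0, r[ (the continuity of the second
   derivative follows from the equation), continuously differentiable up to the
   boundary, and its one-sided derivatives at 0 and at [r] vanish. *)
Definition classical_solution r lambda (w : R -> R) :=
  [/\ {in `]0, r[, forall x : R, [/\ derivable w x 1, derivable (derive1 w) x 1 &
        derive1 (derive1 w) x + derive1 w x / x =
        - (lambda * w x) - lambda * w x / (1 + Num.sqrt lambda * w x)]},
      (w h - w 0) / h @[h --> 0^'+] --> 0,
      derive1 w x @[x --> 0^'+] --> 0,
      (w (r + h) - w r) / h @[h --> 0^'-] --> 0 &
      derive1 w x @[x --> r^'-] --> 0].

Definition calW r : set (radialE r * R) :=
  [set p : radialE r * R | 0 < p.2 /\ forall x : R, 0 <= x <= r -> 0 < 1 + Num.sqrt p.2 * p.1 x].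

Definition calS r : set (radialE r * R) :=
  [set p : radialE r * R | @calW r p /\ classical_solution r p.2 p.1].

Definition calS_plus r k : set (radialE r * R) :=
  [set p : radialE r * R | [/\ @calS r p,
    [set x : R | 0 < x < r /\ p.1 x = 0] #= `I_k &
    0 < p.1 0]].

Definition Bessel_J0 (x : R) : R :=
  limn (series (fun m : nat => (-1) ^+ m / m`!%:R ^+ 2 * (x / 2) ^+ (2 * m))).

Definition is_pos_zero (f : R -> R) k (z : R) :=
  [/\ 0 < z, f z = 0 & [set x : R | 0 < x <= z /\ f x = 0] #= `I_k].

(* The k-th positive zero of [f] for k >= 1, with junk value 0 if there is none. *)
Definition pos_zero (f : R -> R) k : R := xget 0 [set z | is_pos_zero f k z].

Definition mu_ r k : R := (pos_zero (derive1 Bessel_J0) k / r) ^+ 2.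

Definition nu_ r k : R := (pos_zero Bessel_J0 k / r) ^+ 2.

End NeumannProblem.
Arguments calW {R} r.
Arguments calS {R} r.
Arguments calS_plus {R} r k.

(* Main.v *)
Require Import Defs.
From HB Require Import structures.
From mathcomp Require Import all_boot all_order all_algebra.
From mathcomp Require Import all_classical all_reals all_analysis.
From mathcomp Require Import measurable_realfun ring lra.

Set Implicit Arguments.
Unset Strict Implicit.
Unset Printing Implicit Defensive.

Import Order.TTheory GRing.Theory Num.Theory.
Import numFieldNormedType.Exports.

Local Open Scope classical_set_scope.
Local Open Scope ring_scope.

(** In the variables [t = sqrt lambda * x] and [y = w / w 0], with the amplitude
    [a = sqrt lambda * w 0], the equation becomes

      [y'' + y' / t + y + y / (1 + a y) = 0],  [y 0 = 1],  [y' 0 = 0],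

    from which [lambda] has disappeared.  For each [a > 0] there is one solution,
    [profile a], defined for all [t >= 0]: its energy decreases and the potential
    is infinite at [1 + a y = 0] ([nl_solution_exists], by the Picard iteration
    [radial_picard]).  It is an oscillator [y'' + y' / t + q y = 0] with [q >= 1],
    so by comparison with [sin] ([sturm]) its zeros and its critical points
    alternate: [0 = T 0 < X 0 < T 1 < X 1 < ...].  A solution with [k] nodes
    satisfies the Neumann condition at [r] exactly when [sqrt lambda * r] is the
    [k]-th critical point [crit a k] ([chain_crit_unique]).  Therefore S_k^+ is the
    curve [branch], parametrised by the amplitude [a > 0]: [branch_mem] and
    [calS_plus_branch], up to the values of the functions outside [0, r].

    The profile depends continuously on [a] ([profile_close]), hence so do its
    critical points, which are transversal crossings ([hitting_time_cvg],
    [crit_continuous]); so the branch is continuous and S_k^+ is connected.  At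
    [a = 0] the equation is linear and solved by [J_0 (sqrt 2 t)]: the branch
    starts at [(0, mu_k / 2)] ([crit0], [mu_E]).

    The bounds on [lambda] are bounds on [crit a k].  The upper one comes from the
    gaps, at most [1 + pi], given by Sturm's theorem; the lower one from
    [y >= 1 - t ^ 2 / 2] up to the first zero ([profile_lower]), which also shows
    that the norm of the solution is at least a multiple of [a]
    ([branch_norm_ge]).

    It remains to let [a] tend to infinity ([large_amplitude]).  Where [y >= 0] the
    singular term is at most [1 / a] and [y] follows Bessel's equation.  Where
    [y < 0] it is between [- 1 / a] and [0], and bounces off the singularity: by a
    virial identity the bounce takes a time of order [1 / a] ([bounce_duration]),
    and it reverses the speed, as its short duration leaves the energy almost
    unchanged ([bounce_speed]).  In the limit [y] is [|J_0|]: its maxima are at the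
    critical points of [J_0], its minima at the zeros of [J_0].  According to the
    parity of [k], [crit a k] tends to the former or to the latter
    ([crit_large_cvg]). *)

(** * Calculus on the line *)

Section Calculus.
Context {R : realType}.
Implicit Types (f g df dg : R -> R) (a b c t x y : R).

(** The rules of differentiation, for functions written as [fun t => _]: in this
    form the tactic [deriv] below recognises the operation to differentiate. *)
Lemma has_deriv_eq f x a b : is_derive x 1 f a -> a = b -> is_derive x 1 f b.
Proof. by move=> + <-. Qed.

Lemma has_deriv_cst c x : is_derive x 1 (fun _ : R => c) 0.
Proof. exact: is_derive_cst. Qed.

Lemma has_deriv_id x : is_derive x 1 (fun t : R => t) 1.
Proof. exact: is_derive_id. Qed.

Lemma has_deriv_add f g x a b : is_derive x 1 f a -> is_derive x 1 g b ->
  is_derive x 1 (fun t => f t + g t) (a + b).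
Proof. by move=> fa gb; exact: is_deriveD. Qed.

Lemma has_deriv_opp f x a : is_derive x 1 f a -> is_derive x 1 (fun t => - f t) (- a).
Proof. by move=> fa; exact: is_deriveN. Qed.

Lemma has_deriv_mul f g x a b : is_derive x 1 f a -> is_derive x 1 g b ->
  is_derive x 1 (fun t => f t * g t) (a * g x + f x * b).
Proof.
move=> fa gb; apply: (has_deriv_eq (is_deriveM fa gb)).
by rewrite addrC ![_ *: _]mulrC [f x * b]mulrC.
Qed.

Lemma has_deriv_pow f x a n : is_derive x 1 f a ->
  is_derive x 1 (fun t => f t ^+ n.+1) (n.+1%:R * f x ^+ n * a).
Proof.
move=> fa; elim: n => [|n IH].
  by apply: has_deriv_eq fa _; rewrite expr0 !mul1r.
under eq_fun do rewrite exprSr.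
apply: (has_deriv_eq (has_deriv_mul IH fa)).
by rewrite exprS -[n.+2%:R]natr1; ring.
Qed.

Lemma has_deriv_inv f x a : f x != 0 -> is_derive x 1 f a ->
  is_derive x 1 (fun t => (f t)^-1) (- (a / f x ^+ 2)).
Proof.
move=> fx0 fa; apply: (has_deriv_eq (is_deriveV fx0 fa)).
by rewrite scaleNr [_ *: _]mulrC.
Qed.

Lemma has_deriv_comp f g x a b : is_derive (g x) 1 f a -> is_derive x 1 g b ->
  is_derive x 1 (fun t => f (g t)) (a * b).
Proof.
move=> fa gb; exact: (@is_derive1_comp R f g x a b fa gb).
Qed.

Lemma has_deriv_continuous f x a : is_derive x 1 f a -> {for x, continuous f}.
Proof. by move=> [df _]; apply: differentiable_continuous; exact/derivable1_diffP. Qed.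

Lemma continuous_within f a b : (forall x, a <= x <= b -> {for x, continuous f}) ->
  {within `[a, b], continuous f}.
Proof.
move=> cf; apply: continuous_in_subspaceT => x; rewrite inE/= in_itv/=; exact: cf.
Qed.

Lemma has_deriv_within f df a b : (forall x, a <= x <= b -> is_derive x 1 f (df x)) ->
  {within `[a, b], continuous f}.
Proof. by move=> h; apply: continuous_within => x /h; exact: has_deriv_continuous. Qed.

Lemma cont_add f g x : {for x, continuous f} -> {for x, continuous g} ->
  {for x, continuous (fun t => f t + g t)}.
Proof. by move=> cf cg; apply: continuousD. Qed.

Lemma cont_opp f x : {for x, continuous f} -> {for x, continuous (fun t => - f t)}.
Proof. by move=> cf; apply: continuousN. Qed.

Lemma cont_mul f g x : {for x, continuous f} -> {for x, continuous g} ->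
  {for x, continuous (fun t => f t * g t)}.
Proof. by move=> cf cg; apply: continuousM. Qed.

Lemma cont_cst c x : {for x, continuous (fun=> c)}.
Proof. exact: cvg_cst. Qed.

Lemma cont_id x : {for x, continuous (fun t => t)}.
Proof. exact: cvg_id. Qed.

Lemma within_add f g (A : set R) : {within A, continuous f} ->
  {within A, continuous g} -> {within A, continuous (fun t => f t + g t)}.
Proof. by move=> cf cg x; apply: continuousD; [exact: cf|exact: cg]. Qed.

Lemma within_mul f g (A : set R) : {within A, continuous f} ->
  {within A, continuous g} -> {within A, continuous (fun t => f t * g t)}.
Proof. by move=> cf cg x; apply: continuousM; [exact: cf|exact: cg]. Qed.

Lemma derive_nondecreasing f df a b : a <= b ->
  (forall x, a < x < b -> is_derive x 1 f (df x)) ->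
  (forall x, a < x < b -> 0 <= df x) ->
  {within `[a, b], continuous f} -> f a <= f b.
Proof.
rewrite le_eqVlt => /predU1P[-> _ _ _|ab hd h0 cf]; first exact: lexx.
have hd' c : c \in `]a, b[ -> is_derive c 1 f (df c) by rewrite in_itv; exact: hd.
have [c] := MVT ab hd' cf.
by rewrite in_itv/= => /h0 c0 e; rewrite -subr_ge0 e mulr_ge0// subr_ge0 ltW.
Qed.

Lemma derive_increasing f df a b : a < b ->
  (forall x, a < x < b -> is_derive x 1 f (df x)) ->
  (forall x, a < x < b -> 0 < df x) ->
  {within `[a, b], continuous f} -> f a < f b.
Proof.
move=> ab hd h0 cf.
have hd' c : c \in `]a, b[ -> is_derive c 1 f (df c) by rewrite in_itv; exact: hd.
have [c] := MVT ab hd' cf.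
by rewrite in_itv/= => /h0 c0 e; rewrite -subr_gt0 e mulr_gt0// subr_gt0.
Qed.

Lemma derive_nonincreasing f df a b : a <= b ->
  (forall x, a < x < b -> is_derive x 1 f (df x)) ->
  (forall x, a < x < b -> df x <= 0) ->
  {within `[a, b], continuous f} -> f b <= f a.
Proof.
move=> ab hd h0 cf; rewrite -lerN2.
apply: (@derive_nondecreasing (fun t => - f t) (fun t => - df t) _ _ ab).
- by move=> x /hd; exact: has_deriv_opp.
- by move=> x /h0; rewrite oppr_ge0.
- by move=> x; exact/continuousN/cf.
Qed.

Lemma ivt_zero f a b : a <= b -> {within `[a, b], continuous f} ->
  0 <= f a -> f b <= 0 -> exists2 x, a <= x <= b & f x = 0.
Proof.
move=> ab cf fa fb.
have [|x] := @IVT R f a b 0 ab cf.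
  by rewrite ge_min le_max fa fb orbT.
by rewrite in_itv/=; exists x.
Qed.

End Calculus.

(** The expected value of the derivative rarely has the shape that the rules
    produce, so it is left as an equation, usually closed by [ring] or [field]. *)
Ltac deriv_step := match goal with
  | |- is_derive _ _ (fun t => t) _ => eapply has_deriv_id
  | |- is_derive _ _ (fun _ => ?c) _ => eapply has_deriv_cst
  | |- is_derive _ _ (fun t => @?f t + @?g t) _ =>
      eapply (@has_deriv_add _ f g)
  | |- is_derive _ _ (fun t => - (@?f t)) _ => eapply (@has_deriv_opp _ f)
  | |- is_derive _ _ (fun t => @?f t * @?g t) _ =>
      eapply (@has_deriv_mul _ f g)
  | |- is_derive _ _ (fun t => @?f t ^+ ?n.+1) _ =>
      eapply (@has_deriv_pow _ f)
  | |- is_derive _ _ (fun t => ?f t) _ => change (fun t => f t) with f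
  | H : is_derive _ _ ?f _ |- is_derive _ _ ?f _ => exact: H
  | H : forall t, is_derive t _ ?f _ |- is_derive _ _ ?f _ => exact: H
  end.
Ltac deriv := eapply has_deriv_eq; [repeat deriv_step |].

Section FirstOrder.
Context {R : realType}.

(** Multiplied by the integrating factor [expR (- C * (t - a))], which is at most
    [1], the function [e] grows at rate at most [D]. *)
Lemma gronwall (e de : R -> R) (a b C D : R) : a <= b -> 0 <= C -> 0 <= D ->
  {within `[a, b], continuous e} ->
  (forall t, a < t < b -> is_derive t 1 e (de t)) ->
  (forall t, a < t < b -> de t <= C * e t + D) ->
  e b <= (e a + D * (b - a)) * expR (C * (b - a)).
Proof.
move=> ab C0 D0 ce hd hle.
pose E t := expR (- C * (t - a)).
have dE (t : R) : is_derive t 1 E (- C * E t).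
  have h : is_derive t 1 (fun s => - C * (s - a)) (- C).
    by deriv; ring.
  by apply: has_deriv_eq (has_deriv_comp (is_derive_expR _) h) _; rewrite mulrC.
pose F t := e t * E t - D * (t - a).
have : F b <= F a.
  apply: (@derive_nonincreasing R F
    (fun t => de t * E t + e t * (- C * E t) - D) _ _ ab).
  - by move=> t /hd h; rewrite /F; deriv; ring.
  - move=> t /[dup] tab /hle h; have E0 : 0 < E t by exact: expR_gt0.
    have E1 : E t <= 1.
      rewrite /E -expR0 ler_expR mulNr oppr_le0 mulr_ge0// subr_ge0.
      by case/andP: tab => /ltW.
    have : (de t - C * e t - D) * E t <= 0 by rewrite pmulr_lle0//; lra.
    by nra.
  - apply: within_add; first exact: within_mul ce (has_deriv_within (fun t _ => dE t)).
    by apply: (@has_deriv_within _ _ (fun=> - D)) => t _; deriv; ring.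
rewrite /F {2}/E !subrr !mulr0 expR0 subr0 mulr1 => h.
have EE : E b * expR (C * (b - a)) = 1 by rewrite /E -expRD mulNr addNr expR0.
have -> : e b = e b * E b * expR (C * (b - a)) by rewrite -mulrA EE mulr1.
by rewrite ler_pM2r ?expR_gt0//; lra.
Qed.

(** The first zero is the infimum of the zero set, which is closed. *)
Lemma first_zero (f : R -> R) (a b : R) : a <= b ->
  (forall t, a <= t <= b -> {for t, continuous f}) -> 0 < f a -> f b <= 0 ->
  exists x, [/\ a < x <= b, f x = 0 & forall t, a <= t < x -> 0 < f t].
Proof.
move=> ab cf fa fb.
pose Z := [set t | a <= t <= b /\ f t <= 0].
have Zb : Z b by split=> //; rewrite ab lexx.
have hi : has_inf Z by split; [exists b|exists a => t [/andP[]]].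
pose x := inf Z.
have ax : a <= x by apply: lb_le_inf; [exists b|move=> t [/andP[]]].
have xb : x <= b by apply: ge_inf => //; exact: hi.2.
have pos t : a <= t < x -> 0 < f t.
  move=> /andP[at_ tx]; rewrite ltNge; apply/negP => ft.
  have : x <= t.
    by apply: ge_inf; [exact: hi.2|split=> //; rewrite at_ (le_trans (ltW tx))].
  by rewrite leNgt tx.
have cx := cf x (introT andP (conj ax xb)).
have fx0 : f x <= 0.
  rewrite leNgt; apply/negP => fx.
  have : \forall t \near x, 0 < f t by exact: (@cvgr_gt _ _ _ _ f _ cx _ fx).
  move=> /nbhs_ballP[e /= e0 he].
  have [z Zz zx] := inf_adherent e0 hi.
  have xz : x <= z by apply: ge_inf; [exact: hi.2|].
  have := he z; rewrite /ball/= distrC ger0_norm ?subr_ge0// ltrBlDl => /(_ zx).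
  by case: Zz => _; rewrite leNgt => /negP.
have xa : a < x.
  rewrite lt_neqAle ax andbT; apply/eqP => e.
  by move: fx0; rewrite -e leNgt fa.
have cfx : {within `[a, x], continuous f}.
  apply: continuous_within => t /andP[h1 h2]; apply: cf.
  by rewrite h1 (le_trans h2).
have [z /andP[az zx] fz] := ivt_zero ax cfx (ltW fa) fx0.
have zxE : z = x.
  apply/eqP; rewrite eq_le zx/= leNgt; apply/negP => zx'.
  by have := pos z; rewrite fz ltxx az zx' => /(_ erefl).
by exists x; split; rewrite ?xa// -zxE.
Qed.

Lemma antiderivative_right (f : R -> R) (a : R) : continuous f ->
  exists F : R -> R, forall x, a < x -> is_derive x 1 F (f x).
Proof.
move=> cf.
exists (fun x => \int[lebesgue_measure]_(t in `[a, x]) f t) => x ax.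
have xu : x < x + 1 by rewrite ltrDl.
have int : lebesgue_measure.-integrable `[a, x + 1] (EFin \o f).
  apply: continuous_compact_integrable; first exact: segment_compact.
  exact: continuous_subspaceT.
have [df dE] := continuous_FTC1_closed xu int ax (cf x).
by rewrite -dE derive1E; exact: derivableP.
Qed.

Lemma derive0_eq (f : R -> R) (a b : R) :
  (forall x, Num.min a b <= x <= Num.max a b -> is_derive x 1 f 0) -> f a = f b.
Proof.
wlog ab : a b / a <= b.
  move=> H; case/orP: (le_total a b) => ab; first exact: H.
  by rewrite minC maxC => h; apply/esym/H.
rewrite min_l// max_r// => h.
have cf := has_deriv_within h.
have h' t : a < t < b -> is_derive t 1 f 0.
  by move=> /andP[/ltW at_ /ltW tb]; apply: h; rewrite at_.
apply/eqP; rewrite eq_le (derive_nonincreasing ab h')//.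
by rewrite (derive_nondecreasing ab h').
Qed.

(** A primitive to the right of [-1], and the reflected one to the left of [1],
    agree on the overlap after normalisation at [0]. *)
Lemma antiderivative (f : R -> R) : continuous f ->
  exists2 F : R -> R, F 0 = 0 & forall x : R, is_derive x 1 F (f x).
Proof.
move=> cf; have [A dA] := antiderivative_right (-1) cf.
have cg : continuous (fun x => f (- x)).
  by move=> x; apply: continuous_comp; [exact: opp_continuous|exact: cf].
have [C dC] := antiderivative_right (-1) cg.
have dB (x : R) : x < 1 -> is_derive x 1 (fun x => - C (- x)) (f x).
  move=> x1; have h : is_derive (- x) 1 C (f x).
    by rewrite -{2}(opprK x); apply: dC; rewrite ltrN2.
  have h' := @has_deriv_comp _ C (fun t => - t) x _ _ h (has_deriv_opp (has_deriv_id x)).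
  by apply: has_deriv_eq (has_deriv_opp h') _; ring.
pose B x := - C (- x).
have AB x : -1 < x < 1 -> A x - A 0 = B x - B 0.
  move=> /andP[x0 x1].
  suff : A x - B x = A 0 - B 0 by lra.
  apply: (@derive0_eq (fun x => A x - B x)) => y /andP[y0 y1].
  have [ym1 y1'] : -1 < y /\ y < 1.
    split; first by rewrite (lt_le_trans _ y0)// lt_min x0; lra.
    by rewrite (le_lt_trans y1)// gt_max x1; lra.
  apply: has_deriv_eq.
    by apply: has_deriv_add (dA _ ym1) _; apply: has_deriv_opp (dB _ y1').
  by rewrite subrr.
exists (fun x => if 0 <= x then A x - A 0 else B x - B 0).
  by rewrite lexx subrr.
move=> x; have [x0|x0] := ltP (-1) x.
  have : is_derive x 1 (fun x => A x - A 0) (f x).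
    by have dAx := dA _ x0; deriv; ring.
  apply: near_eq_is_derive.
  near=> y; case: ifP => // y0; apply: AB.
  have -> /= : -1 < y by near: y; exact: lt_nbhsr.
  by rewrite (@lt_trans _ _ 0)// ltNge y0.
have : is_derive x 1 (fun x => B x - B 0) (f x).
  have dBx : is_derive x 1 B (f x) by apply: dB; lra.
  by deriv; ring.
apply: near_eq_is_derive.
near=> y; case: ifP => // y0.
have y1 : y < 0 by near: y; apply: lt_nbhsl; lra.
by move: y0; rewrite leNgt y1.
Unshelve. all: by end_near. Qed.

Lemma continuousP (f : R -> R) (x : R) : {for x, continuous f} <->
  forall e : R, 0 < e -> exists2 d : R, 0 < d & forall y, `|y - x| < d -> `|f y - f x| < e.
Proof.
split=> [cf e e0|h].
  have /nbhs_ballP[d /= d0 hd] : \forall y \near x, `|f x - f y| < e.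
    by move/cvgrPdist_lt : cf; exact.
  exists d => // y yx; rewrite distrC; apply: hd; rewrite /ball/= distrC; exact: yx.
apply/cvgrPdist_lt => e e0; have [d d0 hd] := h _ e0.
apply/nbhs_ballP; exists d => //= y; rewrite /ball/= distrC => /hd.
by rewrite distrC.
Qed.

End FirstOrder.


(** * Radial Poisson problem and the comparison of its solutions *)

Section RadialSolution.
Context {R : realType}.
Implicit Types (f g y p : R -> R) (a b c t x : R).

Lemma has_deriv_eps f x a : is_derive x 1 f a -> forall e : R, 0 < e ->
  exists2 d : R, 0 < d &
    forall u : R, `|u| < d -> `|f (x + u) - f x - a * u| <= e * `|u|.
Proof.
move=> [df dE] e e0.
have : h^-1 *: (f (h *: 1 + x) - f x) @[h --> 0^'] --> a.
  by have := df; rewrite /derivable => /cvg_ex[l lh]; rewrite -dE /derive (cvg_lim _ lh).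
move=> /cvgrPdist_lt/(_ _ e0)[d /= d0 hd]; exists d => // h hh.
have [->|h0] := eqVneq h 0; first by rewrite addr0 subrr mulr0 subrr normr0 mulr0.
have := hd h; rewrite /= sub0r normrN => /(_ hh h0) /ltW.
rewrite [h *: 1]mulr1 [h + x]addrC [_ *: _]mulrC => H.
have -> : f (x + h) - f x - a * h = - (a - (f (x + h) - f x) / h) * h by field.
by rewrite normrM normrN ler_wpM2r.
Qed.

(** [y] is radial with [- Delta y = g] in the plane, [p] being its radial
    derivative.  The equation is in divergence form, [(s p)' = - s g], and is
    read on the whole line, which makes every derivative two-sided at [0]. *)
Definition radial_solution g y p :=
  [/\ forall t, is_derive t 1 y (p t), continuous p, p 0 = 0 &
      forall t, is_derive t 1 (fun s => s * p s) (- (t * g t))].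

(** [p] is the quotient by [t] of the primitive of [- t g], whose derivative
    vanishes at [0]: it is continuous there. *)
Lemma radial_solution_exists g c : continuous g ->
  exists y p, radial_solution g y p /\ y 0 = c.
Proof.
move=> cg.
have [|G G0 dG] := @antiderivative _ (fun t => - (t * g t)).
  by move=> t; exact: (cont_opp (cont_mul (@cont_id _ t) (cg t))).
pose p t := G t / t.
have cp : continuous p.
  move=> t; have [->|t0] := eqVneq t 0.
    apply/continuousP => e e0; have e2 : 0 < e / 2 by rewrite divr_gt0.
    have dG0 : is_derive (0 : R) 1 G 0 by apply: has_deriv_eq (dG 0) _; rewrite mul0r oppr0.
    have [d d0 hd] := has_deriv_eps dG0 e2; exists d => // s; rewrite subr0 => sd.
    have H : `|G s| <= e / 2 * `|s|.
      have := hd _ sd; have -> // : G (0 + s) - G 0 - 0 * s = G s.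
      by rewrite G0 add0r; ring.
    rewrite /p G0 mul0r subr0.
    have [->|s0] := eqVneq s 0; first by rewrite invr0 mulr0 normr0.
    rewrite normrM normfV ltr_pdivrMr ?normr_gt0//; apply: le_lt_trans H _.
    by rewrite ltr_pM2r ?normr_gt0//; lra.
  apply: cont_mul; first exact: has_deriv_continuous (dG t).
  by apply: continuousV => //; exact: cont_id.
have [Y Y0 dY] := antiderivative cp.
exists (fun t => Y t + c), p; split; last by rewrite Y0 add0r.
split => //; last 2 first.
- by rewrite /p G0 mul0r.
- have -> : (fun s => s * p s) = G.
    apply/funext => s; rewrite /p; have [->|s0] := eqVneq s 0.
      by rewrite mul0r G0.
    by rewrite mulrC divfK.
  exact: dG.
- by move=> t; deriv; ring.
Qed.

Lemma radial_solution_derivative g y p t : radial_solution g y p -> t != 0 ->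
  is_derive t 1 p (- g t - p t / t).
Proof.
move=> [_ _ p0 dp] t0.
have dpt := dp t.
have dV := has_deriv_inv t0 (has_deriv_id t).
have := has_deriv_mul dpt dV.
have -> : (fun s => s * p s * s^-1) = p.
  apply/funext => s; have [->|s0] := eqVneq s 0; first by rewrite mul0r mul0r p0.
  by rewrite mulrC mulKf.
by move/has_deriv_eq; apply; field.
Qed.

Lemma radial_solution_continuous g y p t : radial_solution g y p ->
  {for t, continuous y}.
Proof. by case=> dy _ _ _; exact: has_deriv_continuous (dy t). Qed.

Lemma radial_solution_lincomb (a b : R) g1 y1 p1 g2 y2 p2 :
  radial_solution g1 y1 p1 -> radial_solution g2 y2 p2 ->
  radial_solution (fun t => a * g1 t + b * g2 t)
    (fun t => a * y1 t + b * y2 t) (fun t => a * p1 t + b * p2 t).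
Proof.
move=> [dy1 cp1 p10 dp1] [dy2 cp2 p20 dp2]; split.
- by move=> t; deriv; ring.
- move=> t; exact: (cont_add (cont_mul (@cont_cst _ a t) (cp1 t))
    (cont_mul (@cont_cst _ b t) (cp2 t))).
- by rewrite p10 p20 !mulr0 addr0.
- move=> t; have := dp1 t; have := dp2 t.
  have -> : (fun s => s * (a * p1 s + b * p2 s)) =
    (fun s => a * (s * p1 s) + b * (s * p2 s)) by apply/funext => s; ring.
  set q2 := fun s => s * p2 s; set q1 := fun s => s * p1 s => d2 d1.
  change (is_derive t 1 (fun s => a * q1 s + b * q2 s)
    (- (t * (a * g1 t + b * g2 t)))).
  by deriv; ring.
Qed.

(** Energy comparison.  The damping term [p / t] only helps, so the square of
    the distance in the phase plane obeys a regular Gronwall inequality although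
    the equation is singular at [0].  The derivatives are those on ]a, b[, all
    that is known of a classical solution. *)
Lemma radial_comparison (y1 p1 g1 y2 p2 g2 : R -> R) (a b L eta : R) :
  0 <= a -> a <= b -> 0 <= L -> 0 <= eta ->
  {within `[a, b], continuous y1} -> {within `[a, b], continuous p1} ->
  {within `[a, b], continuous y2} -> {within `[a, b], continuous p2} ->
  (forall t, a < t < b -> is_derive t 1 y1 (p1 t)) ->
  (forall t, a < t < b -> is_derive t 1 p1 (- g1 t - p1 t / t)) ->
  (forall t, a < t < b -> is_derive t 1 y2 (p2 t)) ->
  (forall t, a < t < b -> is_derive t 1 p2 (- g2 t - p2 t / t)) ->
  (forall t, a < t < b -> `|g1 t - g2 t| <= L * `|y1 t - y2 t| + eta) ->
  (y1 b - y2 b) ^+ 2 + (p1 b - p2 b) ^+ 2 <=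
  ((y1 a - y2 a) ^+ 2 + (p1 a - p2 a) ^+ 2 + eta ^+ 2 * (b - a)) *
    expR ((L + 2) * (b - a)).
Proof.
move=> a0 ab L0 eta0 cy1 cp1 cy2 cp2 dy1 dp1 dy2 dp2 hg.
pose e t := (y1 t - y2 t) ^+ 2 + (p1 t - p2 t) ^+ 2.
pose de t := 2 * (y1 t - y2 t) * (p1 t - p2 t) +
  2 * (p1 t - p2 t) * (- (g1 t - g2 t) - (p1 t - p2 t) / t).
have wsub (f g : R -> R) : {within `[a, b], continuous f} ->
    {within `[a, b], continuous g} ->
    {within `[a, b], continuous (fun t => f t - g t)}.
  by move=> cf cg x; apply: continuousB; [exact: cf|exact: cg].
have cy := wsub _ _ cy1 cy2; have cp := wsub _ _ cp1 cp2.
apply: (@gronwall _ e de) => //; first by lra.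
- exact: sqr_ge0.
- exact: (within_add (within_mul cy cy) (within_mul cp cp)).
- move=> t tab; have h1 := dy1 t tab; have h2 := dy2 t tab.
  have h3 := dp1 t tab; have h4 := dp2 t tab.
  by rewrite /e /de; deriv; ring.
- move=> t tab; have := hg t tab; rewrite /de /e.
  have t0 : 0 < t by case/andP: tab => /(le_lt_trans a0).
  move: (y1 t - y2 t) (p1 t - p2 t) (g1 t - g2 t) => u v w wle.
  have z0 : 0 <= v ^+ 2 / t by rewrite divr_ge0 ?sqr_ge0// ltW.
  have v0 := normr_ge0 v.
  have vw : - (v * w) <= L * (`|u| * `|v|) + `|v| * eta.
    apply: (@le_trans _ _ (`|v| * `|w|)); last by nra.
    by rewrite -normrM -normrN ler_norm.
  have uv : u * v <= `|u| * `|v| by rewrite -normrM ler_norm.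
  have LUV : 0 <= L * (`|u| - `|v|) ^+ 2 by rewrite mulr_ge0 ?sqr_ge0.
  have UV := sqr_ge0 (`|u| - `|v|); have Ve := sqr_ge0 (`|v| - eta).
  have -> : 2 * u * v + 2 * v * (- w - v / t) =
    2 * (u * v) + 2 * (- (v * w)) - 2 * (v ^+ 2 / t) by ring.
  move: z0; move: (v ^+ 2 / t) => z z0.
  move: LUV UV Ve uv vw; rewrite -(real_normK (num_real u)) -(real_normK (num_real v)).
  have := sqr_ge0 `|u|; have := sqr_ge0 `|v|.
  move: `|u| `|v| (u * v) (v * w) => U V uv vw.
  by nra.
Qed.

End RadialSolution.

(** * Global existence for a Lipschitz nonlinearity *)

Section Picard.
Context {R : realType}.
Implicit Types (g y p : R -> R) (c t : R).

Lemma radial_solution_opp g y p : radial_solution g y p ->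
  radial_solution (fun t => - g t) (fun t => - y t) (fun t => - p t).
Proof.
move=> s; have := radial_solution_lincomb (-1) 0 s s.
have e (f : R -> R) : (fun t => -1 * f t + 0 * f t) = (fun t => - f t).
  by apply/funext => t; ring.
by rewrite !e.
Qed.

Lemma radial_solution_sub g1 y1 p1 g2 y2 p2 :
  radial_solution g1 y1 p1 -> radial_solution g2 y2 p2 ->
  radial_solution (fun t => g1 t - g2 t) (fun t => y1 t - y2 t)
    (fun t => p1 t - p2 t).
Proof.
move=> s1 s2; have := radial_solution_lincomb 1 (-1) s1 s2.
have e (f1 f2 : R -> R) : (fun t => 1 * f1 t + -1 * f2 t) = (fun t => f1 t - f2 t).
  by apply/funext => t; ring.
by rewrite !e.
Qed.

(** [y] is obtained from [g] by two integrations, each of which costs a factor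
    [1 / c] on an exponential of rate [c]. *)
Lemma radial_weighted_bound g y p (M c : R) : radial_solution g y p ->
  0 < c -> 0 <= M ->
  (forall t, 0 <= t -> `|g t| <= M * expR (c * t)) ->
  forall t, 0 <= t -> `|y t - y 0| <= M * expR (c * t) / c ^+ 2.
Proof.
move=> + c0 M0.
pose E (t : R) := expR (c * t).
have dE (t : R) : is_derive t 1 E (c * E t).
  have h : is_derive t 1 (fun s => c * s) c by deriv; ring.
  by apply: has_deriv_eq (has_deriv_comp (is_derive_expR _) h) _; rewrite mulrC.
have E0 t : 0 < E t by exact: expR_gt0.
suff H f z q : radial_solution f z q ->
    (forall t, 0 <= t -> `|f t| <= M * E t) ->
    forall t, 0 <= t -> z t - z 0 <= M * E t / c ^+ 2.
  move=> s hg t t0; rewrite ler_norml; apply/andP; split; last exact: (H _ _ _ s).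
  have := H _ _ _ (radial_solution_opp s); rewrite lerNl => /(_ _ t t0).
  have -> : - (y t - y 0) = - y t - - y 0 by ring.
  by apply => u u0; rewrite normrN; exact: hg.
move=> [dz cq q0 dq] hf.
have qle t : 0 <= t -> q t <= M * E t / c.
  rewrite le_eqVlt => /predU1P[<-|t0].
    by rewrite q0 divr_ge0 ?mulr_ge0// ltW.
  suff : t * q t - t * (M * E t / c) <= 0 * q 0 - 0 * (M * E 0 / c).
    by rewrite !mul0r subr0 -mulrBr pmulr_rle0// subr_le0.
  have dS (s : R) : is_derive s 1 (fun s => s * q s - s * (M * E s / c))
      (- (s * f s) - (M * E s / c + s * (M * E s))).
    have := dq s; set Q := fun s => s * q s => dQ.
    have ds := dE s.
    change (is_derive s 1 (fun s => Q s - s * (M * E s / c))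
      (- (s * f s) - (M * E s / c + s * (M * E s)))).
    by deriv; field; rewrite gt_eqF.
  apply: (derive_nonincreasing (ltW t0) (fun s _ => dS s)); last first.
    exact: has_deriv_within (fun s _ => dS s).
  move=> s /andP[/ltW s0 _].
  have : - (s * f s) <= s * (M * E s).
    rewrite -mulrN; apply: ler_wpM2l => //; apply: le_trans (hf _ s0).
    by rewrite -normrN ler_norm.
  have : 0 <= M * E s / c by rewrite divr_ge0 ?mulr_ge0// ltW.
  by lra.
move=> t t0.
suff : z t - M * E t / c ^+ 2 <= z 0 - M * E 0 / c ^+ 2.
  have : 0 <= M * E 0 / c ^+ 2 by rewrite divr_ge0 ?sqr_ge0 ?mulr_ge0// ltW.
  by lra.
have dS (s : R) : is_derive s 1 (fun s => z s - M * E s / c ^+ 2) (q s - M * E s / c).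
  have dEs := dE s; have dzs := dz s.
  by deriv; field; rewrite gt_eqF.
apply: (derive_nonincreasing t0 (fun s _ => dS s)); last first.
  exact: has_deriv_within (fun s _ => dS s).
by move=> s /andP[/ltW s0 _]; rewrite subr_le0 qle.
Qed.

Lemma lipschitz_continuous (h : R -> R) (L : R) : 0 < L ->
  (forall u v, `|h u - h v| <= L * `|u - v|) -> continuous h.
Proof.
move=> L0 hL x; apply/continuousP => e e0; exists (e / L); first by rewrite divr_gt0.
by move=> y; rewrite ltr_pdivlMr// mulrC; apply: le_lt_trans (hL _ _).
Qed.

Lemma limit_dist (u : nat -> R) (l b : R) n : u m @[m --> \oo] --> l ->
  (forall m, (n <= m)%N -> `|u m - u n| <= b) -> `|l - u n| <= b.
Proof.
move=> ul h; rewrite leNgt; apply/negP => lb.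
have e0 : 0 < `|l - u n| - b by rewrite subr_gt0.
move/cvgrPdist_lt : ul => ul; have [N _ /= hN] := ul _ e0.
have := hN (maxn N n) (leq_maxl _ _); have := h (maxn N n) (leq_maxr _ _).
have := ler_distD (u (maxn N n)) l (u n).
by lra.
Qed.

Lemma half_pow_small (b e : R) : 0 < e -> exists n, b * 2^-1 ^+ n < e.
Proof.
have h1 : `|2^-1 : R| < 1 by rewrite gtr0_norm ?invr_gt0// invf_lt1//; lra.
move=> e0; have /cvgrPdist_lt hc := cvg_geometric b h1.
have [n _ hn] := hc _ e0; exists n; have := hn n (leqnn n); rewrite /= sub0r normrN.
exact: le_lt_trans (ler_norm _).
Qed.

(** Picard iteration.  In the norm with weight [expR (- c * t)] the solution
    operator has norm at most [1 / c ^+ 2], so a large [c] turns a nonlinearity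
    of any Lipschitz constant into a contraction on the whole half-line.  The
    absolute value extends the right-hand side to the negative half-line. *)
Lemma radial_picard (h : R -> R) (L c0 : R) : 0 < L ->
  (forall u v, `|h u - h v| <= L * `|u - v|) ->
  exists y p, radial_solution (fun t => h (y `|t|)) y p /\ y 0 = c0.
Proof.
move=> L0 hL; have ch := lipschitz_continuous L0 hL.
have cabs (v : R -> R) : continuous v -> continuous (fun t => h (v `|t|)).
  move=> cv t; apply: (@continuous_comp _ _ _ (fun t => v `|t|) h); last exact: ch.
  apply: (@continuous_comp _ _ _ (fun t => `|t|) v); last exact: cv.
  exact: norm_continuous.
have [|Phi HPhi] := @boolp.choice _ _ (fun v Phiv => continuous v ->
    exists p, radial_solution (fun t => h (v `|t|)) Phiv p /\ Phiv 0 = c0).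
  move=> v; have [cv|cv] := pselect (continuous v).
    by have [y yE] := radial_solution_exists c0 (cabs _ cv); exists y.
  by exists v.
pose v n := iter n Phi (fun=> c0).
have cv n : continuous (v n).
  elim: n => [t|n IH t]; first exact: cont_cst.
  by have [p [s _]] := HPhi _ IH; exact: radial_solution_continuous s.
pose c := 2 * L + 1; have c1 : 1 <= c by rewrite /c; lra.
have cL : L / c ^+ 2 <= 2^-1 by rewrite ler_pdivrMr ?exprn_gt0 /c; nra.
have c0' : 0 < c by lra.
pose E t := expR (c * t).
have E0 t : 0 < E t by exact: expR_gt0.
pose B := `|h c0|; have B0 : 0 <= B by exact: normr_ge0.
have dist (f1 f2 y1 y2 : R -> R) p1 p2 (b t : R) : 0 <= b -> 0 <= t ->
    radial_solution (fun t => h (f1 `|t|)) y1 p1 ->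
    radial_solution (fun t => h (f2 `|t|)) y2 p2 -> y1 0 = y2 0 ->
    (forall t, 0 <= t -> `|f1 t - f2 t| <= b * E t) ->
    `|y1 t - y2 t| <= b * 2^-1 * E t.
  move=> b0 t0 s1 s2 y0 hf.
  have s := radial_solution_sub s1 s2.
  have : forall t, 0 <= t -> `|h (f1 `|t|) - h (f2 `|t|)| <= (L * b) * expR (c * t).
    move=> u u0; rewrite (ger0_norm u0); apply: le_trans (hL _ _) _.
    by rewrite -mulrA ler_pM2l//; exact: hf.
  move=> /(radial_weighted_bound s c0' (mulr_ge0 (ltW L0) b0))/(_ _ t0).
  rewrite y0 subrr subr0 => /le_trans; apply.
  rewrite mulrAC (_ : L * b / c ^+ 2 = b * (L / c ^+ 2)); last by ring.
  by rewrite ler_pM2r ?expR_gt0//; exact: ler_wpM2l.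
have step n t : 0 <= t -> `|v n.+1 t - v n t| <= B * 2^-1 ^+ n * E t.
  elim: n t => [|n IH] t t0.
    have [p [s v0]] := HPhi _ (cv 0%N).
    have hb u : 0 <= u -> `|h c0| <= B * expR (c * u).
      move=> u0; rewrite -[leLHS]mulr1; apply: ler_wpM2l => //.
      by rewrite -expR0 ler_expR mulr_ge0// ltW.
    have := radial_weighted_bound s c0' B0 hb t0.
    rewrite v0 /= expr0 mulr1 => /le_trans; apply.
    rewrite ler_pdivrMr ?exprn_gt0// ler_peMr ?mulr_ge0 ?expR_ge0//.
    exact: exprn_ege1.
  have [p1 [s1 y1]] := HPhi _ (cv n.+1); have [p2 [s2 y2]] := HPhi _ (cv n).
  rewrite exprSr mulrA; apply: (dist _ _ _ _ _ _ _ _ _ t0 s1 s2) => //.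
  - by rewrite mulr_ge0// exprn_ge0// invr_ge0.
  - by rewrite y1 y2.
pose A n t := 2 * B * 2^-1 ^+ n * E t.
have half0 n : 0 <= 2^-1 ^+ n :> R by rewrite exprn_ge0// invr_ge0.
have tail n m t : 0 <= t -> (n <= m)%N -> `|v m t - v n t| <= A n t.
  move=> t0 nm; suff : `|v m t - v n t| <= A n t - A m t.
    have : 0 <= A m t by rewrite /A !mulr_ge0// ltW.
    by lra.
  elim: m nm => [|m IH]; first by rewrite leqn0 => /eqP->; rewrite !subrr normr0.
  rewrite leq_eqVlt => /predU1P[<-|]; first by rewrite !subrr normr0.
  rewrite ltnS => /IH; have := step m t t0; have := ler_distD (v m t) (v m.+1 t) (v n t).
  rewrite /A [_ ^+ m.+1]exprS => h1 h2 h3.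
  have -> : 2 * B * (2^-1 * 2^-1 ^+ m) * E t = B * 2^-1 ^+ m * E t by field.
  move: h2 h3; rewrite /A.
  have -> : 2 * B * 2^-1 ^+ m * E t = 2 * (B * 2^-1 ^+ m * E t) by ring.
  by lra.
have small (C e : R) : 0 < e -> exists n, 2 * B * 2^-1 ^+ n * C < e.
  by move=> e0; have [n hn] := half_pow_small (2 * B * C) e0; exists n; rewrite mulrAC.
have cvgv t : 0 <= t -> cvgn (fun n => v n t).
  move=> t0; apply/cauchy_cvgP/cauchy_exP => e e0.
  have [n hn] := small (E t) e e0.
  exists (v n t), n => // m /= nm.
  by rewrite /ball/= distrC; apply: le_lt_trans hn; exact: tail.
pose w t := limn (fun n => v n `|t|).
have wv n t : `|w t - v n `|t| | <= A n `|t|.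
  apply: (@limit_dist (fun n => v n `|t|)) => [|m nm]; first exact: cvgv.
  exact: tail.
have cw : continuous w.
  move=> t; apply/continuousP => e e0; have e3 : 0 < e / 3 by lra.
  have [n hn] := small (E (`|t| + 1)) _ e3.
  have An (s : R) : `|s| <= `|t| + 1 -> A n `|s| < e / 3.
    move=> hs; apply: le_lt_trans hn; apply: ler_wpM2l.
      by rewrite mulr_ge0// mulr_ge0.
    by rewrite ler_expR ler_pM2l.
  have cn : {for t, continuous (fun t => v n `|t|)}.
    apply: (@continuous_comp _ _ _ (fun t => `|t|) (v n)); last exact: cv.
    exact: norm_continuous.
  have [d d0 hd] := (continuousP _ _).1 cn _ e3.
  exists (Num.min d 1); first by rewrite lt_min d0 ltr01.
  move=> s; rewrite lt_min => /andP[sd s1].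
  have st : `|s| <= `|t| + 1.
    by have := ler_dist_dist s t; have := ler_norm (`|s| - `|t|); lra.
  have := hd _ sd; have := wv n s; have := wv n t; have := An _ st.
  have := An t; rewrite lerDl ler01 => /(_ erefl).
  have := ler_distD (v n `|s|) (w s) (w t).
  have := ler_distD (v n `|t|) (v n `|s|) (w t).
  by rewrite [`|v n `|t| - w t|]distrC; lra.
have [y [p [s y0]]] := radial_solution_exists c0 (cabs _ cw).
have s' : radial_solution (fun t => h (w t)) y p.
  have <- // : (fun t => h (w `|t|)) = (fun t => h (w t)).
  by apply/funext => t; rewrite /w normr_id.
have yw t : 0 <= t -> y t = w t.
  move=> t0; apply/eqP; rewrite -subr_eq0 -normr_le0 leNgt; apply/negP => e0.
  have e2 : 0 < `|y t - w t| / 2 by lra.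
  have [n hn] := small (E t) _ e2.
  have [p1 [s1 y1]] := HPhi _ (cv n).
  have b0 : 0 <= 2 * B * 2^-1 ^+ n by rewrite !mulr_ge0.
  have yy : y 0 = Phi (v n) 0 by rewrite y0 y1.
  have hw u : 0 <= u -> `|w u - v n u| <= 2 * B * 2^-1 ^+ n * E u.
    by move=> u0; have := wv n u; rewrite (ger0_norm u0).
  have := dist _ _ _ _ _ _ _ _ b0 t0 s s1 yy hw.
  have := wv n.+1 t; rewrite (ger0_norm t0) /A [_ ^+ n.+1]exprS.
  have -> : 2 * B * (2^-1 * 2^-1 ^+ n) * E t = 2^-1 * (2 * B * 2^-1 ^+ n * E t) by ring.
  have -> : 2 * B * 2^-1 ^+ n * 2^-1 * E t = 2^-1 * (2 * B * 2^-1 ^+ n * E t) by ring.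
  have := ler_distD (v n.+1 t) (y t) (w t).
  rewrite [`|v n.+1 t - w t|]distrC.
  change (Phi (v n) t) with (v n.+1 t).
  by lra.
exists y, p; split=> //.
have <- // : (fun t => h (w t)) = (fun t => h (y `|t|)).
by apply/funext => t; rewrite yw// /w normr_id.
Qed.

End Picard.

(** * Oscillation of [y'' + y' / t + q y = 0] with [q >= 1] *)

Section Oscillation.
Context {R : realType}.
Implicit Types (g q y p : R -> R) (c s t x : R).

(** The nonlinear equation [y'' + y' / t + y + y / (1 + a y) = 0] has this form,
    with [q = 1 + 1 / (1 + a y)]. *)
Definition oscillator y p := exists g q, [/\ radial_solution g y p,
  forall t, 0 <= t -> g t = q t * y t & forall t, 0 <= t -> 1 <= q t].

Lemma oscillator_opp y p : oscillator y p ->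
  oscillator (fun t => - y t) (fun t => - p t).
Proof.
move=> [g [q [s gE q1]]]; exists (fun t => - g t), q; split => //.
  exact: radial_solution_opp.
by move=> t t0; rewrite gE// mulrN.
Qed.

Section Oscillator.
Variables (y p : R -> R).
Hypothesis hyp : oscillator y p.

Lemma oscillator_continuous t : {for t, continuous y}.
Proof. by case: hyp => g [q [s _ _]]; exact: radial_solution_continuous s. Qed.

Lemma oscillator_continuous' t : {for t, continuous p}.
Proof. by case: hyp => g [q [[_ cp _ _] _ _]]; exact: cp. Qed.

Lemma oscillator_deriv t : is_derive t 1 y (p t).
Proof. by case: hyp => g [q [[dy _ _ _] _ _]]; exact: dy. Qed.

Lemma oscillator_deriv0 : p 0 = 0.
Proof. by case: hyp => g [q [[_ _ -> _] _ _]]. Qed.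

Lemma flux_decreasing a b : 0 <= a -> a < b -> (forall t, a < t < b -> 0 < y t) ->
  b * p b < a * p a.
Proof.
move=> a0 ab y0; case: hyp => g [q [[_ _ _ dF] gE q1]].
rewrite -ltrN2.
have dS (t : R) : is_derive t 1 (fun s => - (s * p s)) (t * g t).
  by apply: has_deriv_eq (has_deriv_opp (dF t)) _; rewrite opprK.
apply: (derive_increasing ab (fun t _ => dS t)); last first.
  exact: has_deriv_within (fun t _ => dS t).
move=> t /[dup] /y0 yt /andP[at_ _]; have t0 := le_lt_trans a0 at_.
rewrite gE ?ltW// mulr_gt0// mulr_gt0//.
exact: lt_le_trans (q1 _ (ltW t0)).
Qed.

(** Sturm comparison with [sin (t - s) / sqrt t], which solves the equation with
    [q = 1 - 1 / (4 t ^ 2)]: the Wronskian, weighted by [t], is strictly negative at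
    the left end, strictly positive at the right end, and nonincreasing. *)
Lemma sturm s : 0 < s -> (forall t, s <= t <= s + pi -> 0 < y t) -> False.
Proof.
move=> s0 y0; case: hyp => g [q [sol gE q1]]; have [dy cp _ dF] := sol.
pose S (t : R) := sin (t - s); pose C (t : R) := cos (t - s).
have dsh (t : R) : is_derive t 1 (fun t => t - s) 1 by deriv; ring.
have dS (t : R) : is_derive t 1 S (C t).
  by apply: has_deriv_eq (has_deriv_comp (is_derive_sin _) (dsh t)) _; rewrite mulr1.
have dC (t : R) : is_derive t 1 C (- S t).
  by apply: has_deriv_eq (has_deriv_comp (is_derive_cos _) (dsh t)) _; rewrite mulr1.
(* [W] is the weighted Wronskian, with the square root put in the denominator. *)
pose N t := (t * p t + y t / 2) * S t - t * y t * C t.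
pose W t := N t / Num.sqrt t.
have pi0 := pi_gt0 R.
have ssp : s <= s + pi by lra.
have dW (t : R) : 0 < t -> is_derive t 1 W
    (- (t * (q t - 1) + 1 / (4 * t)) * y t * S t / Num.sqrt t).
  move=> t0; have dFt := dF t; set F := fun s => s * p s in dFt.
  have dyt := dy t; have dSt := dS t; have dCt := dC t.
  have sq0 : Num.sqrt t != 0 by rewrite gt_eqF// sqrtr_gt0.
  have dsq := has_deriv_inv sq0 (is_derive1_sqrt t0).
  set G := fun t => (Num.sqrt t)^-1 in dsq.
  change (is_derive t 1 (fun t => ((F t + y t / 2) * S t - t * y t * C t) * G t)
    (- (t * (q t - 1) + 1 / (4 * t)) * y t * S t / Num.sqrt t)).
  have tE : t = Num.sqrt t ^+ 2 by rewrite sqr_sqrtr// ltW.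
  deriv; rewrite gE ?ltW// /F /G.
  move: (y t) (p t) (q t) (S t) (C t) tE sq0 => Y P q' S' C'.
  by move: (Num.sqrt t) => r -> r0; field.
have W1 : W s < 0.
  rewrite /W /N /S /C subrr sin0 cos0 mulr0 mulr1 sub0r mulNr oppr_lt0.
  by rewrite divr_gt0 ?sqrtr_gt0// mulr_gt0// y0 ?lexx.
have W2 : 0 < W (s + pi).
  rewrite /W /N /S /C addrAC subrr add0r sinpi cospi mulr0 mulrN1 sub0r opprK.
  by rewrite divr_gt0 ?sqrtr_gt0 ?mulr_gt0 ?y0 ?lexx ?ssp//; lra.
have : W (s + pi) <= W s.
  pose D t := - (t * (q t - 1) + 1 / (4 * t)) * y t * S t / Num.sqrt t.
  have dW' (t : R) : s <= t <= s + pi -> is_derive t 1 W (D t).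
    by move=> /andP[st _]; apply: dW; apply: lt_le_trans st.
  have cW := has_deriv_within dW'.
  have dW'' (t : R) : s < t < s + pi -> is_derive t 1 W (D t).
    by move=> /andP[/ltW h1 /ltW h2]; apply: dW'; rewrite h1.
  apply: (derive_nonincreasing ssp dW'' _ cW).
  move=> t /andP[st tp]; have t0 := lt_trans s0 st.
  have qt := q1 _ (ltW t0).
  have Y0 : 0 <= y t by apply/ltW/y0; rewrite !ltW.
  have S0 : 0 <= S t by apply: sin_ge0_pi; apply/andP; split; lra.
  have A0 : 0 <= t * (q t - 1) + 1 / (4 * t).
    by rewrite addr_ge0 ?divr_ge0 ?mulr_ge0//; lra.
  rewrite /D !mulNr oppr_le0 divr_ge0 ?sqrtr_ge0//.
  exact: (mulr_ge0 (mulr_ge0 A0 Y0) S0).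
by lra.
Qed.

End Oscillator.
End Oscillation.

(** * The alternating sequence of zeros and critical points *)

Section HalfWaves.
Context {R : realType}.
Implicit Types (y p : R -> R) (s t x : R).

Lemma no_zero_positive (f : R -> R) (a b : R) : a <= b ->
  (forall t, {for t, continuous f}) -> (forall t, a <= t <= b -> f t != 0) ->
  0 < f a -> forall t, a <= t <= b -> 0 < f t.
Proof.
move=> ab cf f0 fa t /andP[at_ tb]; rewrite ltNge; apply/negP => ft.
have [x /andP[ax xt] fx] :=
  ivt_zero at_ (continuous_within (fun u _ => cf u)) (ltW fa) ft.
by have := f0 x; rewrite ax (le_trans xt tb) fx eqxx => /(_ erefl).
Qed.

Lemma exists_zero y p s : oscillator y p -> 0 < s ->
  exists2 z, s <= z <= s + pi & y z = 0.
Proof.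
move=> osc s0; apply: contrapT => nz.
have ssp : s <= s + pi by have := pi_gt0 R; lra.
have y0 t : s <= t <= s + pi -> y t != 0.
  by move=> st; apply/eqP => yt; apply: nz; exists t.
have [ys|ys] := ltP 0 (y s).
  exact: (sturm osc s0 (no_zero_positive ssp (oscillator_continuous osc) y0 ys)).
have osc' := oscillator_opp osc.
apply: (sturm osc' s0 (no_zero_positive ssp (oscillator_continuous osc') _ _)).
- by move=> t /y0; rewrite oppr_eq0.
- by rewrite oppr_gt0 lt_neqAle ys y0// lexx.
Qed.

(** The bounds on the gaps come from [sturm], used from a point at distance [1], as
    the starting point may be the singular point [0] or a zero: hence [1 + pi]. *)
Definition half_wave y p s x T :=
  [/\ s < x <= s + (1 + pi), x < T <= x + (1 + pi), y x = 0 & p T = 0] /\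
  [/\ forall t, s <= t < x -> 0 < y t, forall t, x < t <= T -> y t < 0 &
      forall t, s < t < T -> p t < 0].

(** As long as [y > 0] the flux [t p] decreases from [0], so [y] decreases until it
    vanishes; as it has to vanish again, [p] cannot remain negative. *)
Lemma half_wave_exists y p s : oscillator y p -> 0 <= s -> 0 < y s -> p s = 0 ->
  exists xT : R * R, half_wave y p s xT.1 xT.2.
Proof.
move=> osc s0 ys ps.
have cy t := @oscillator_continuous _ _ _ osc t.
have cp t := @oscillator_continuous' _ _ _ osc t.
have dy t := @oscillator_deriv _ _ _ osc t.
have [z1 /andP[sz1 z1s] yz1] : exists2 z, s + 1 <= z <= s + 1 + pi & y z = 0.
  by apply: exists_zero osc _; lra.
have yz1' : y z1 <= 0 by rewrite yz1.
have sz1' : s <= z1 by lra.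
have [x [/andP[sx xz1] yx ypos]] := first_zero sz1' (fun t _ => cy t) ys yz1'.
have pneg t : s < t <= x -> p t < 0.
  move=> /andP[st tx]; have t0 : 0 < t by lra.
  have : t * p t < s * p s.
    apply: (flux_decreasing osc s0 st) => u /andP[/ltW su ut].
    by apply: ypos; rewrite su (lt_le_trans ut tx).
  by rewrite ps mulr0 pmulr_rlt0.
have [z2 /andP[xz2 z2x] yz2] : exists2 z, x + 1 <= z <= x + 1 + pi & y z = 0.
  by apply: exists_zero osc _; lra.
have ydec a b : a < b -> (forall t, a < t < b -> p t < 0) -> y b < y a.
  move=> ab pab; rewrite -ltrN2.
  have dS (t : R) : is_derive t 1 (fun s => - y s) (- p t).
    exact: has_deriv_opp (dy t).
  apply: (derive_increasing ab (fun t _ => dS t)); last first.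
    exact: has_deriv_within (fun t _ => dS t).
  by move=> t /pab; rewrite oppr_gt0.
have [b /andP[xb bz2] pb] : exists2 b, x <= b <= z2 & 0 <= p b.
  apply: contrapT => nb; have : y z2 < y x.
    apply: ydec => [|t /andP[xt tz]]; first by lra.
    by rewrite ltNge; apply/negP => pt; apply: nb; exists t => //; rewrite !ltW.
  by rewrite yz2 yx ltxx.
have px : 0 < - p x by rewrite oppr_gt0 pneg// sx lexx.
have pb' : - p b <= 0 by rewrite oppr_le0.
have [T [/andP[xT Tb] pT ppos]] :=
  first_zero xb (fun t _ => cont_opp (cp t)) px pb'.
have {}pneg t : s < t < T -> p t < 0.
  move=> /andP[st tT]; have [tx|xt] := leP t x; first by apply: pneg; rewrite st.
  by rewrite -oppr_gt0 ppos// ltW.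
exists (x, T); split; split => //=.
- by apply/andP; split => //; lra.
- by apply/andP; split => //; lra.
- by apply/eqP; rewrite -oppr_eq0 pT.
- move=> t /andP[xt tT]; rewrite -yx; apply: ydec => // u /andP[xu ut].
  by apply: pneg; rewrite (lt_trans sx xu) (lt_le_trans ut tT).
Qed.

Definition sgk (k : nat) : R := (-1) ^+ k.

(** [T k] is the [k]-th critical point, the centre being [T 0], and [X k] is the
    zero between [T k] and [T k.+1].  The extremum at [T k] has the sign of
    [(-1) ^ k]. *)
Definition wave_chain y p (X T : nat -> R) := T 0%N = 0 /\
  forall k, half_wave (fun t => sgk k * y t) (fun t => sgk k * p t)
    (T k) (X k) (T k.+1).

Lemma oscillator_sgk y p k : oscillator y p ->
  oscillator (fun t => sgk k * y t) (fun t => sgk k * p t).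
Proof.
move=> osc; have e f : (fun t => sgk k * f t : R) =
    if odd k then (fun t => - f t) else f.
  apply/funext => t; rewrite /sgk -signr_odd; case: (odd k).
    by rewrite expr1 mulN1r.
  by rewrite expr0 mul1r.
rewrite !e; case: (odd k) => //; exact: oscillator_opp.
Qed.

Lemma sgkS k (a : R) : sgk k.+1 * a = - (sgk k * a).
Proof. by rewrite /sgk exprS mulN1r mulNr. Qed.

Lemma sgk_eq0 k (a : R) : sgk k * a = 0 -> a = 0.
Proof. by move=> /eqP; rewrite mulf_eq0 /sgk signr_eq0 => /eqP. Qed.

Lemma wave_chain_exists y p : oscillator y p -> y 0 = 1 ->
  exists X T, wave_chain y p X T.
Proof.
move=> osc y0.
have [|nx Hnx] := @boolp.choice _ _ (fun (sk : R * nat) (xT : R * R) =>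
    0 <= sk.1 -> 0 < sgk sk.2 * y sk.1 -> sgk sk.2 * p sk.1 = 0 ->
    half_wave (fun t => sgk sk.2 * y t) (fun t => sgk sk.2 * p t)
      sk.1 xT.1 xT.2).
  move=> [s k] /=; have [[s0 ys ps]|h] := pselect
      [/\ 0 <= s, 0 < sgk k * y s & sgk k * p s = 0].
    have [xT hxT] := half_wave_exists (oscillator_sgk k osc) s0 ys ps.
    by exists xT.
  by exists (0, 0) => s0 ys ps; exfalso; apply: h.
pose T := fix T k := if k is k'.+1 then (nx (T k', k')).2 else 0.
have inv k : [/\ 0 <= T k, 0 < sgk k * y (T k) & sgk k * p (T k) = 0].
  elim: k => [|k [T0 Ty Tp]].
    by rewrite /= /sgk expr0 mul1r mul1r y0 (oscillator_deriv0 osc).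
  have [[/andP[h1 _] /andP[h2 _] _ h3] [_ h4 _]] := Hnx (T k, k) T0 Ty Tp.
  rewrite !sgkS -/(T k.+1); split.
  - by apply/ltW/(le_lt_trans T0)/(lt_trans h1 h2).
  - by rewrite oppr_gt0; apply: h4; rewrite h2 lexx.
  - by rewrite [T k.+1]/= h3 oppr0.
exists (fun k => (nx (T k, k)).1), T; split => // k.
by have [h1 h2 h3] := inv k; exact: (Hnx (T k, k)).
Qed.

Section Chain.
Variables (y p : R -> R) (X T : nat -> R).
Hypotheses (osc : oscillator y p) (y0 : y 0 = 1) (chain : wave_chain y p X T).

Lemma chain_T0 : T 0%N = 0. Proof. by case: chain. Qed.

Lemma chain_TX k : T k < X k.
Proof. by case: chain => _ /(_ k)[[/andP[]]]. Qed.

Lemma chain_XT k : X k < T k.+1.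
Proof. by case: chain => _ /(_ k)[[_ /andP[]]]. Qed.

Lemma chain_ltTS k : T k < T k.+1.
Proof. exact: lt_trans (chain_TX k) (chain_XT k). Qed.

Lemma chain_leT i j : (i <= j)%N -> T i <= T j.
Proof.
move=> /subnK <-; elim: (j - i)%N => [|m IH]; first by rewrite add0n.
by rewrite addSn; exact: le_trans IH (ltW (chain_ltTS _)).
Qed.

Lemma chain_T_ge0 k : 0 <= T k.
Proof. by rewrite -chain_T0 chain_leT. Qed.

Lemma chain_X_gt0 k : 0 < X k.
Proof. exact: le_lt_trans (chain_T_ge0 k) (chain_TX k). Qed.

Lemma chain_ltX i j : (i < j)%N -> X i < X j.
Proof.
move=> ij; apply: lt_trans (chain_XT i) _.
exact: le_lt_trans (chain_leT ij) (chain_TX j).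
Qed.

Lemma chain_ltT i j : (i < j)%N -> T i < T j.
Proof.
move=> ij; exact: lt_le_trans (chain_ltTS i) (chain_leT ij).
Qed.

Lemma chain_yX k : y (X k) = 0.
Proof. by case: chain => _ /(_ k)[[_ _ /sgk_eq0]]. Qed.

Lemma chain_pT k : p (T k) = 0.
Proof.
case: k => [|k]; first by rewrite chain_T0 (oscillator_deriv0 osc).
by case: chain => _ /(_ k)[[_ _ _ /sgk_eq0]].
Qed.

Lemma chain_T_le k : T k <= (k.*2)%:R * (1 + pi).
Proof.
elim: k => [|k IH]; first by rewrite chain_T0 mul0r.
case: chain => _ /(_ k)[[/andP[_ h1] /andP[_ h2] _ _] _].
by rewrite doubleS -addn2 natrD mulrDl; lra.
Qed.

Lemma chain_y_pos k t : T k <= t < X k -> 0 < sgk k * y t.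
Proof. by case: chain => _ /(_ k)[_ [h _ _]] /h. Qed.

Lemma chain_y_neg k t : X k < t <= T k.+1 -> sgk k * y t < 0.
Proof. by case: chain => _ /(_ k)[_ [_ h _]] /h. Qed.

Lemma chain_p_neg k t : T k < t < T k.+1 -> sgk k * p t < 0.
Proof. by case: chain => _ /(_ k)[_ [_ _ h]] /h. Qed.

Lemma chain_zero k t : T k <= t <= T k.+1 -> y t = 0 -> t = X k.
Proof.
move=> /andP[Tt tT] yt; have [tX|Xt|//] := ltgtP t (X k).
  by have := @chain_y_pos k t; rewrite Tt tX yt mulr0 ltxx => /(_ erefl).
by have := @chain_y_neg k t; rewrite tT Xt yt mulr0 ltxx => /(_ erefl).
Qed.

Lemma chain_crit k t : T k < t < T k.+1 -> p t != 0.
Proof. by move=> /chain_p_neg; apply: contraTneq => ->; rewrite mulr0 ltxx. Qed.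

Lemma chain_zeros k : [set t | 0 < t < T k /\ y t = 0] = X @` `I_k.
Proof.
apply/seteqP; split=> t /=; last first.
  move=> [i ik <-]; rewrite chain_X_gt0 chain_yX; split=> //=.
  exact: lt_le_trans (chain_XT i) (chain_leT ik).
elim: k => [|k IH] [/andP[t0 tT] yt].
  by move: tT; rewrite chain_T0 ltNge ltW.
have [tk|kt] := ltP t (T k).
  by have [|i /= ik <-] := IH; [rewrite t0|exists i => //=; exact: ltn_trans ik _].
by exists k => //=; apply/esym/chain_zero => //; rewrite kt ltW.
Qed.

Lemma chain_zeros_le k : [set t | 0 < t <= X k /\ y t = 0] = X @` `I_k.+1.
Proof.
rewrite -chain_zeros; apply/seteqP; split=> t /= [/andP[t0 tX] yt]; split=> //.
  by rewrite t0 (le_lt_trans tX (chain_XT k)).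
rewrite t0 /=; have [tT|Tt] := ltP t (T k).
  exact: ltW (lt_trans tT (chain_TX k)).
by rewrite (@chain_zero k t)// Tt ltW.
Qed.

Lemma chain_crits k : [set t | 0 < t <= T k /\ p t = 0] = (T \o succn) @` `I_k.
Proof.
apply/seteqP; split=> t /=; last first.
  move=> [i ik <-]; rewrite chain_pT; split=> //=; rewrite (chain_leT ik) andbT.
  by rewrite -chain_T0 chain_ltT.
elim: k => [|k IH] [/andP[t0 tT] pt].
  by move: tT; rewrite chain_T0 leNgt t0.
have [tk|kt] := leP t (T k).
  by have [|i /= ik <-] := IH; [rewrite t0|exists i => //=; exact: ltn_trans ik _].
exists k => //=; apply/eqP; rewrite eq_le tT andbT leNgt; apply/negP => tTk.
by have /eqP := @chain_crit k t (introT andP (conj kt tTk)); rewrite pt.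
Qed.

End Chain.
End HalfWaves.

(** * Counting zeros *)

Section Counting.
Local Open Scope card_scope.
Context {R : realType}.
Implicit Types (y p : R -> R) (X T : nat -> R) (s t x : R).

Lemma nested_card_eq (U : Type) (A B : set U) n : A `<=` B ->
  A #= `I_n -> B #= `I_n -> A = B.
Proof.
move=> AB An Bn; apply/seteqP; split=> // z Bz; apply: contrapT => Az.
have : A `|` [set z] #= `I_n.+1.
  apply/eq_cardSP; exists z; first by right.
  by rewrite setUDK// => x [zx Ax]; apply: Az; rewrite -zx.
move=> Azn; have : A `|` [set z] #<= B.
  by apply: subset_card_le => x [/AB//|->].
by rewrite (card_le_eql Azn) (card_le_eqr Bn) card_le_II ltnn.
Qed.

Lemma increasing_card X n : (forall i j, (i < j)%N -> X i < X j) ->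
  X @` `I_n #= `I_n.
Proof.
move=> incX; apply: inj_card_eq => i j _ _ e.
case: (ltngtP i j) => // /incX; by rewrite e ltxx.
Qed.

Lemma pos_zero_chain (f : R -> R) X k : (forall i j, (i < j)%N -> X i < X j) ->
  (forall k, [set t | 0 < t <= X k /\ f t = 0] = X @` `I_k.+1) ->
  pos_zero f k.+1 = X k.
Proof.
move=> incX fX.
have [/andP[X0 _] fX0] : [set t | 0 < t <= X k /\ f t = 0] (X k).
  by rewrite fX; exists k => //=.
have isz : is_pos_zero f k.+1 (X k).
  by split=> //; rewrite fX; exact: increasing_card.
have : is_pos_zero f k.+1 (pos_zero f k.+1).
  by apply: (@xgetPex _ 0 [set z | is_pos_zero f k.+1 z]); exists (X k).
case: isz => _ _ cX; move: (pos_zero _ _) => z [z0 fz cz].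
have [zX|Xz] := leP z (X k).
  have sub : [set x | 0 < x <= z /\ f x = 0] `<=` [set x | 0 < x <= X k /\ f x = 0].
    by move=> x /= [/andP[x0 xz] fx]; rewrite x0 (le_trans xz).
  have := nested_card_eq sub cz cX => e.
  apply/eqP; rewrite eq_le zX/=.
  have : [set x | 0 < x <= z /\ f x = 0] (X k) by rewrite e /= X0 lexx.
  by case=> /andP[].
have sub : [set x | 0 < x <= X k /\ f x = 0] `<=` [set x | 0 < x <= z /\ f x = 0].
  by move=> x /= [/andP[x0 xX] fx]; rewrite x0 (le_trans xX)// ltW.
have := nested_card_eq sub cX cz => e.
have : [set x | 0 < x <= X k /\ f x = 0] z by rewrite e /= z0 lexx.
by case=> /andP[_]; rewrite leNgt Xz.
Qed.

(** Otherwise [y] would keep its sign, and the flux [t p], strictly monotone,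
    could not vanish at both ends. *)
Lemma zero_between_crits y p a b : oscillator y p -> 0 <= a -> a < b ->
  p a = 0 -> p b = 0 -> exists2 z, a < z < b & y z = 0.
Proof.
move=> osc a0 ab pa pb; apply: contrapT => nz.
have y0 t : a < t < b -> y t != 0.
  by move=> tab; apply/eqP => yt; apply: nz; exists t.
pose m := (a + b) / 2.
have mab : a < m < b by rewrite /m; apply/andP; split; lra.
have pos (z q : R -> R) : oscillator z q -> q a = 0 -> q b = 0 ->
    (forall t, a < t < b -> z t != 0) -> 0 < z m -> False.
  move=> osc' qa qb z0 zm.
  have cz := oscillator_continuous osc'.
  have zpos t : a < t < b -> 0 < z t.
    move=> /andP[at_ tb]; case/andP: mab => am mb.
    have [tm|mt] := leP t m; last first.
      apply: (@no_zero_positive _ z m t (ltW mt) cz) => //; last by rewrite lexx ltW.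
      by move=> u /andP[mu ut]; apply: z0; rewrite (lt_le_trans am) ?(le_lt_trans ut).
    rewrite ltNge; apply/negP => zt.
    have [|||u /andP[tu um] zu] := @ivt_zero _ (fun u => - z u) t m tm.
    - exact: (continuous_within (fun u _ => cont_opp (cz u))).
    - by rewrite oppr_ge0.
    - by rewrite oppr_le0 ltW.
    have /eqP := z0 u (introT andP (conj (lt_le_trans at_ tu) (le_lt_trans um mb))).
    by apply; apply/eqP; rewrite -oppr_eq0 zu.
  have := flux_decreasing osc' a0 ab zpos.
  by rewrite qa qb !mulr0 ltxx.
have [ym|ym] := ltP 0 (y m); first exact: (pos y p osc).
apply: (pos _ _ (oscillator_opp osc)).
- by rewrite pa oppr0.
- by rewrite pb oppr0.
- by move=> t /y0; rewrite oppr_eq0.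
- by rewrite oppr_gt0 lt_neqAle ym y0.
Qed.

(** Zeros separate critical points, so that a critical point is determined by the
    number of zeros before it. *)
Lemma chain_crit_unique y p X T S k : oscillator y p -> wave_chain y p X T ->
  0 < S -> p S = 0 -> [set t | 0 < t < S /\ y t = 0] #= `I_k -> S = T k.
Proof.
move=> osc ch S0 pS cS.
have cT : [set t | 0 < t < T k /\ y t = 0] #= `I_k.
  rewrite (chain_zeros ch); apply: increasing_card; exact: (chain_ltX ch).
have pT := chain_pT osc ch k; have T0 := chain_T_ge0 ch k.
have [TS|ST|//] := ltgtP (T k) S.
  have [z /andP[Tz zS] yz] := zero_between_crits osc T0 TS pT pS.
  have sub : [set t | 0 < t < T k /\ y t = 0] `<=` [set t | 0 < t < S /\ y t = 0].
    by move=> t /= [/andP[-> tT] ->]; rewrite (lt_trans tT).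
  have e := nested_card_eq sub cT cS.
  have : [set t | 0 < t < T k /\ y t = 0] z by rewrite e /= (le_lt_trans T0 Tz).
  by case=> /andP[_ /ltW]; rewrite leNgt Tz.
have [z /andP[Sz zT] yz] := zero_between_crits osc (ltW S0) ST pS pT.
have sub : [set t | 0 < t < S /\ y t = 0] `<=` [set t | 0 < t < T k /\ y t = 0].
  by move=> t /= [/andP[-> tT] ->]; rewrite (lt_trans tT).
have e := nested_card_eq sub cS cT.
have : [set t | 0 < t < S /\ y t = 0] z by rewrite e /= (lt_trans S0 Sz).
by case=> /andP[_ /ltW]; rewrite leNgt Sz.
Qed.

End Counting.

(** * Continuity of first hitting times *)

Section Hitting.
Context {R : realType}.
Implicit Types (y p : R -> R) (X T : nat -> R) (s t x : R).

Lemma positive_before (f : R -> R) s : {for s, continuous f} -> 0 < f s ->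
  exists2 d, 0 < d & forall t, s - d <= t <= s -> 0 < f t.
Proof.
move=> cf fs; have [d d0 hd] := (continuousP f s).1 cf _ fs.
exists (d / 2); first by rewrite divr_gt0.
move=> t /andP[h1 h2]; have := hd t; rewrite ler0_norm; last by lra.
by move=> /(_ ltac:(lra)); rewrite ltr_norml => /andP[h _]; lra.
Qed.

(** On [s, x - e] the limit function is bounded below by a positive constant, and
    it is negative somewhere just after [x]; a function close enough to it vanishes
    in between.  Closeness is
    asked only up to the zero of the perturbed function, as the nonlinear problem
    is close to a linear one only as long as its solution is positive. *)
Lemma hitting_time_cvg (I : Type) (F : set_system I) (FF : Filter F)
    (f : R -> R) (s x M : R) (fa : I -> R -> R) (sa xa : I -> R) :
  (forall t, {for t, continuous f}) -> s < x -> x < M ->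
  (forall t, s <= t < x -> 0 < f t) ->
  (forall e, 0 < e -> exists2 t, x < t < x + e & f t < 0) ->
  sa a @[a --> F] --> s ->
  (\forall a \near F, [/\ sa a <= xa a, fa a (xa a) = 0 &
     forall t, sa a <= t < xa a -> 0 < fa a t]) ->
  (forall e, 0 < e -> \forall a \near F,
     forall t, sa a <= t <= xa a -> t <= M -> `|fa a t - f t| < e) ->
  xa a @[a --> F] --> x.
Proof.
move=> cf sx xM fpos fneg sas hxa close; apply/cvgrPdist_lt => e e0.
pose e' := Num.min (e / 2) (x - s).
have e'0 : 0 < e' by rewrite lt_min divr_gt0// subr_gt0.
have e'e : e' <= e / 2 by rewrite ge_min lexx.
have e's : e' <= x - s by rewrite ge_min lexx orbT.
have [t1 /andP[xt1 t1e] ft1] := fneg (Num.min e (M - x)) (ltac:(by rewrite lt_min e0 subr_gt0)).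
have [t1e' t1M] : t1 < x + e /\ t1 < M.
  have h1 : Num.min e (M - x) <= e by rewrite ge_min lexx.
  have h2 : Num.min e (M - x) <= M - x by rewrite ge_min lexx orbT.
  by split; lra.
have [d d0 hd] := positive_before (cf s) (fpos s (ltac:(by rewrite lexx))).
have sd : s - d <= x - e' by lra.
have [c] := EVT_min sd (continuous_within (fun t _ => cf t)).
rewrite in_itv/= => /andP[c1 c2] cmin.
have fc : 0 < f c.
  have [cs|sc] := leP c s; first by apply: hd; rewrite c1.
  by apply: fpos; rewrite ltW//=; lra.
have ft1' : 0 < - f t1 by rewrite oppr_gt0.
have sad : \forall a \near F, `|s - sa a| < Num.min d (x - s).
  by move/cvgrPdist_lt : sas; apply; rewrite lt_min d0 subr_gt0.
have H1 := close _ fc; have H2 := close _ ft1'.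
near=> a.
have [h1 h2 h3] : [/\ sa a <= xa a, fa a (xa a) = 0 &
   forall t, sa a <= t < xa a -> 0 < fa a t] by near: a.
have k1 : forall t, sa a <= t <= xa a -> t <= M -> `|fa a t - f t| < f c by near: a.
have k2 : forall t, sa a <= t <= xa a -> t <= M -> `|fa a t - f t| < - f t1 by near: a.
have : `|s - sa a| < Num.min d (x - s) by near: a.
rewrite lt_min !ltr_norml => /andP[/andP[s1 s2] /andP[s3 s4]].
have up : xa a <= t1.
  rewrite leNgt; apply/negP => t1x.
  have /h3 : sa a <= t1 < xa a by rewrite t1x andbT; lra.
  have := k2 t1; rewrite (ltW t1x) (ltW t1M) andbT => /(_ _ erefl).
  have -> : sa a <= t1 by lra.
  by move=> /(_ erefl); rewrite ltr_norml => /andP[_ ?]; lra.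
have lo : x - e' < xa a.
  rewrite ltNge; apply/negP => xe.
  have := k1 (xa a); rewrite h1 lexx h2 sub0r normrN => /(_ erefl) h.
  have {}h : `|f (xa a)| < f c by apply: h; lra.
  have : f c <= f (xa a) by apply: cmin; rewrite in_itv/= xe andbT; lra.
  by have := ler_norm (f (xa a)); lra.
by apply/andP; split; lra.
Unshelve. all: by end_near. Qed.

(** Zeros are hitting times for [y] and critical points for [p], each of them
    being the starting point for the next one. *)
Lemma chain_cvg (I : Type) (F : set_system I) (FF : Filter F)
    (y p : R -> R) X T (ya pa : I -> R -> R) (Xa Ta : I -> nat -> R) :
  oscillator y p -> wave_chain y p X T ->
  (forall a, oscillator (ya a) (pa a)) ->
  (forall a, wave_chain (ya a) (pa a) (Xa a) (Ta a)) ->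
  (forall M e, 0 < e -> \forall a \near F, forall t, 0 <= t <= M ->
     `|ya a t - y t| < e /\ `|pa a t - p t| < e) ->
  forall k, Ta a k @[a --> F] --> T k.
Proof.
move=> osc ch osca cha close.
have sg1 k : `|sgk k : R| = 1 by rewrite /sgk normrX normrN1 expr1n.
elim=> [|k IH].
  rewrite (chain_T0 ch); under eq_fun do rewrite (chain_T0 (cha _)); exact: cvg_cst.
have XX : Xa a k @[a --> F] --> X k.
  apply: (@hitting_time_cvg _ _ _ (fun t => sgk k * y t) (T k) (X k) (X k + 1)
     (fun a t => sgk k * ya a t) (fun a => Ta a k)) => //.
  - move=> t; exact: (cont_mul (@cont_cst _ (sgk k) t) (@oscillator_continuous _ _ _ osc t)).
  - exact: chain_TX ch k.
  - by rewrite ltrDl.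
  - by move=> t; exact: chain_y_pos ch k t.
  - move=> e e0; pose m := Num.min (X k + e / 2) (T k.+1).
    have h1 : m <= X k + e / 2 by rewrite ge_min lexx.
    have h2 : m <= T k.+1 by rewrite ge_min lexx orbT.
    have h3 : X k < m by rewrite lt_min (chain_XT ch k) andbT; lra.
    exists m; first by rewrite h3; lra.
    by apply: (chain_y_neg ch); rewrite h3.
  - near=> a; split; first exact/ltW/(chain_TX (cha a)).
      by rewrite (chain_yX (cha a)) mulr0.
    exact: (chain_y_pos (cha a)).
  - move=> e e0; have := close (X k + 1) e e0; apply: filterS => a h t /andP[Tt _] tM.
    rewrite -mulrBr normrM sg1 mul1r; apply: (h t _).1.
    by rewrite tM andbT (le_trans _ Tt)// (chain_T_ge0 (cha a)).
apply: (@hitting_time_cvg _ _ _ (fun t => - (sgk k * p t)) (X k) (T k.+1) (T k.+1 + 1)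
   (fun a t => - (sgk k * pa a t)) (fun a => Xa a k)) => //.
- move=> t; apply: (@cont_opp _ (fun t => sgk k * p t)).
  exact: (cont_mul (@cont_cst _ (sgk k) t) (@oscillator_continuous' _ _ _ osc t)).
- exact: chain_XT ch k.
- by rewrite ltrDl.
- move=> t /andP[Xt tT]; rewrite oppr_gt0; apply: (chain_p_neg ch).
  by rewrite tT (lt_le_trans (chain_TX ch k)).
- move=> e e0; pose m := Num.min (T k.+1 + e / 2) ((T k.+1 + T k.+2) / 2).
  have T12 := chain_ltTS ch k.+1.
  have h1 : m <= T k.+1 + e / 2 by rewrite ge_min lexx.
  have h2 : m <= (T k.+1 + T k.+2) / 2 by rewrite ge_min lexx orbT.
  have h3 : T k.+1 < m by rewrite lt_min; apply/andP; split; lra.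
  exists m; first by rewrite h3; lra.
  rewrite -sgkS; apply: (chain_p_neg ch); rewrite h3; lra.
- near=> a; split; first exact/ltW/(chain_XT (cha a)).
    by rewrite (chain_pT (osca a) (cha a)) mulr0 oppr0.
  move=> t /andP[Xt tT]; rewrite oppr_gt0; apply: (chain_p_neg (cha a)).
  by rewrite tT (lt_le_trans (chain_TX (cha a) k)).
- move=> e e0; have := close (T k.+1 + 1) e e0; apply: filterS => a h t /andP[Xt _] tM.
  rewrite opprK addrC -mulrBr normrM sg1 mul1r distrC; apply: (h t _).2.
  by rewrite tM andbT (le_trans _ Xt)// ltW// (chain_X_gt0 (cha a)).
Unshelve. all: by end_near. Qed.

End Hitting.

(** * The rescaled nonlinear equation [y'' + y' / t + y + y / (1 + a y) = 0] *)

Section Nonlinear.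
Context {R : realType}.
Implicit Types (g y p : R -> R) (a b t s v : R).

(** At the level [1 + a y = floor_ a] the potential energy already exceeds the
    initial energy, so that this level is never reached. *)
Definition floor_ a : R := expR (- (2 + a + a ^+ 2)).

Lemma floor_gt0 a : 0 < floor_ a. Proof. exact: expR_gt0. Qed.

Lemma floor_lt1 a : 0 <= a -> floor_ a < 1.
Proof. by move=> a0; rewrite /floor_ expR_lt1 oppr_lt0; have := sqr_ge0 a; lra. Qed.

Lemma floor_le a b : 0 <= a -> a <= b -> floor_ b <= floor_ a.
Proof.
move=> a0 ab; have : a ^+ 2 <= b ^+ 2.
  by rewrite lerXn2r ?nnegrE// (le_trans a0).
by rewrite /floor_ ler_expR; lra.
Qed.

Definition potential a v : R := v ^+ 2 / 2 + v / a - ln (1 + a * v) / a ^+ 2.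

(** For [a = 0] this is the linearised equation [y'' + y' / t + 2 y = 0]. *)
Definition nl_solution a y p := exists g, [/\ radial_solution g y p,
  forall t, 0 <= t -> g t = y t + y t / (1 + a * y t), y 0 = 1 &
  forall t, 0 <= t -> floor_ a < 1 + a * y t].

Lemma potential_deriv a v : a != 0 -> 0 < 1 + a * v ->
  is_derive v 1 (potential a) (v + v / (1 + a * v)).
Proof.
move=> a0 av0.
have d1 : is_derive v 1 (fun v : R => 1 + a * v) a by deriv; ring.
have := @has_deriv_comp _ (@ln R) (fun v => 1 + a * v) v _ _ (is_derive1_ln av0) d1.
set l := fun v => ln (1 + a * v) => d2.
change (is_derive v 1 (fun v => v ^+ 2 / 2 + v / a - l v / a ^+ 2)
  (v + v / (1 + a * v))).
by deriv; field; rewrite a0 gt_eqF.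
Qed.

Lemma energy_deriv a y p t : a != 0 -> 0 < 1 + a * y t -> t != 0 ->
  is_derive t 1 y (p t) ->
  is_derive t 1 p (- (y t + y t / (1 + a * y t)) - p t / t) ->
  is_derive t 1 (fun s => p s ^+ 2 / 2 + potential a (y s)) (- (p t ^+ 2 / t)).
Proof.
move=> a0 ay0 t0 dy dp.
have := @has_deriv_comp _ (potential a) y t _ _ (potential_deriv a0 ay0) dy.
set l := fun s => potential a (y s) => dl.
change (is_derive t 1 (fun s => p s ^+ 2 / 2 + l s) (- (p t ^+ 2 / t))).
by deriv; field; rewrite t0 gt_eqF.
Qed.

(** Cutting the denominator off at [d] makes the nonlinearity globally Lipschitz,
    as [radial_picard] requires. *)
Lemma truncation_lipschitz a d : 0 <= a -> 0 < d -> d < 1 -> forall u v,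
  `|(u + u / Num.max (1 + a * u) d) - (v + v / Num.max (1 + a * v) d)| <=
  (1 + 1 / d ^+ 2) * `|u - v|.
Proof.
move=> a0 d0 d1 u v; wlog uv : u v / u <= v.
  move=> H; case/orP: (le_total u v) => uv; first exact: H.
  by rewrite distrC [`|u - v|]distrC; exact: H.
have id1 : 1 <= 1 / d by rewrite ler_pdivlMr// mul1r ltW.
have id2 : 1 / d ^+ 2 = 1 / d * (1 / d) by field; rewrite gt_eqF.
have dd1 : 1 / d <= 1 / d ^+ 2 by rewrite id2 ler_peMr//; lra.
pose T w := w / Num.max (1 + a * w) d.
have inv w : d <= 1 + a * w -> 0 <= (1 + a * w)^-1 <= 1 / d.
  move=> h; rewrite invr_ge0 mul1r lef_pV2 ?posrE ?h ?andbT//; lra.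
suff /andP[T0 T1] : 0 <= T v - T u <= 1 / d ^+ 2 * (v - u).
  rewrite -/(T u) -/(T v) ler0_norm; last by lra.
  by rewrite [`|u - v|]ler0_norm; lra.
have hi x z : d <= 1 + a * x -> d <= 1 + a * z -> x <= z ->
    0 <= T z - T x <= 1 / d ^+ 2 * (z - x).
  move=> hx hz xz; rewrite /T !max_l//.
  have -> : z / (1 + a * z) - x / (1 + a * x) =
      (1 + a * z)^-1 * (1 + a * x)^-1 * (z - x).
    by field; rewrite !gt_eqF//; lra.
  have /andP[i1 i2] := inv _ hx; have /andP[i3 i4] := inv _ hz.
  rewrite mulr_ge0 ?mulr_ge0 ?subr_ge0//=; apply: ler_wpM2r; first by lra.
  apply: le_trans (ler_pM i3 i1 i4 i2) _.
  by rewrite !mul1r expr2 invfM.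
have lo x z : 1 + a * x <= d -> 1 + a * z <= d -> x <= z ->
    0 <= T z - T x <= 1 / d ^+ 2 * (z - x).
  move=> hx hz xz; rewrite /T !max_r// -mulrBl mulrC.
  have di : 0 <= d^-1 by rewrite invr_ge0 ltW.
  rewrite mulr_ge0 ?subr_ge0//=; apply: ler_wpM2r; first by lra.
  by rewrite -[d^-1]mul1r.
have [hu|hu] := leP d (1 + a * u).
  by apply: hi => //; have := ler_wpM2l a0 uv; lra.
have [hv|hv] := leP d (1 + a * v); last by apply: lo => //; exact: ltW.
have apos : 0 < a.
  by rewrite lt_neqAle a0 andbT eq_sym; apply/eqP => e; move: hu; rewrite e; lra.
pose w := (d - 1) / a; have aw : 1 + a * w = d.
  by rewrite /w mulrC divfK ?gt_eqF//; lra.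
have uw : u <= w by rewrite /w ler_pdivlMr// mulrC; lra.
have wv : w <= v by rewrite /w ler_pdivrMr// mulrC; lra.
have := lo u w (ltW hu); rewrite aw => /(_ (lexx _) uw) /andP[h1 h2].
have := hi w v; rewrite aw => /(_ (lexx _) hv wv) /andP[h3 h4].
by apply/andP; split; lra.
Qed.

(** The energy [p ^ 2 / 2 + potential a y] is nonincreasing and the potential is
    infinite at [y = - 1 / a]: this keeps [1 + a y] away from [0], so that the
    truncated equation and the original one have the same solution. *)
Lemma nl_solution_exists a : 0 <= a -> exists y p, nl_solution a y p.
Proof.
move=> a0; have d0 := floor_gt0 a; have d1 := floor_lt1 a0.
set d := floor_ a in d0 d1.
have Lpos : 0 < 1 + 1 / d ^+ 2.
  by rewrite addr_gt0// divr_gt0// exprn_gt0.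
have [y [p [s y0]]] := radial_picard 1 Lpos (truncation_lipschitz a0 d0 d1).
have fl t : 0 <= t -> d < 1 + a * y t; last first.
  exists y, p; eexists; split; [exact: s| |exact: y0|exact: fl].
  by move=> t t0 /=; rewrite (ger0_norm t0) max_l// ltW// fl.
move=> t0; rewrite ltNge; apply/negP => yt.
have apos : 0 < a.
  by rewrite lt_neqAle a0 andbT eq_sym; apply/eqP => e; move: yt; rewrite e; lra.
have cf u : {for u, continuous (fun u => 1 + a * y u - d)}.
  have [dy _ _ _] := s; have dyu := dy u.
  by apply: (@has_deriv_continuous _ _ _ (a * p u)); deriv; ring.
have f0 : 0 < 1 + a * y 0 - d by rewrite y0; lra.
have ft : 1 + a * y t - d <= 0 by lra.
have [x [/andP[x0 xt] fx fpos]] := first_zero t0 (fun u _ => cf u) f0 ft.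
pose E u := p u ^+ 2 / 2 + potential a (y u).
have : E x <= E 0.
  have dE u : 0 < u < x -> is_derive u 1 E (- (p u ^+ 2 / u)).
    move=> /andP[u0 ux]; have [dy _ _ _] := s.
    have fu : d < 1 + a * y u by have := fpos u; rewrite ux ltW// => /(_ erefl); lra.
    apply: energy_deriv => //; rewrite ?gt_eqF//; first exact: lt_trans fu.
    have := radial_solution_derivative s (lt0r_neq0 u0).
    by rewrite (gtr0_norm u0) max_l// ltW.
  apply: (derive_nonincreasing (ltW x0) dE).
    by move=> u /andP[u0 _]; rewrite oppr_le0 divr_ge0 ?sqr_ge0// ltW.
  apply: continuous_within => u /andP[u0 ux].
  have cy : {for u, continuous y} by exact: radial_solution_continuous s.
  have cp : {for u, continuous p} by case: s => _ cp _ _; exact: cp.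
  have fu : 0 < 1 + a * y u.
    move: ux; rewrite le_eqVlt => /predU1P[->|ux]; first by lra.
    by have := fpos u; rewrite ux u0 => /(_ erefl); lra.
  have cG := has_deriv_continuous (potential_deriv (lt0r_neq0 apos) fu).
  have cGy : {for u, continuous (fun u => potential a (y u))}.
    exact: (@continuous_comp _ _ _ y (potential a) u cy cG).
  exact: (cont_add (cont_mul (cont_mul cp cp) (@cont_cst _ 2^-1 u)) cGy).
apply/negP; rewrite -ltNge /E /potential y0 mulr1.
have [_ _ p0 _] := s; rewrite p0.
have yx : a * y x = d - 1 by lra.
have -> : 1 + a * y x = d by lra.
have yxE : y x = (d - 1) / a by rewrite -yx mulrC mulKf// gt_eqF.
(* The logarithm contributes [(2 + a + a ^ 2) / a ^ 2] to [potential a (y x)], more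
   than the initial energy, at most [1 / 2 + 1 / a], plus the [1 / a ^ 2] that the
   linear term may take away. *)
rewrite yxE /d /floor_ expRK.
have l0 : 0 <= ln (1 + a) / a ^+ 2.
  by rewrite divr_ge0 ?sqr_ge0// ln_ge0//; lra.
have := sqr_ge0 (p x).
have : 0 <= ((d - 1) / a) ^+ 2 by exact: sqr_ge0.
rewrite /d /floor_; set D := expR _ => h1 h2.
have -> : (D - 1) / a / a = (D - 1) / a ^+ 2 by field; rewrite gt_eqF.
have D0 : 0 <= D / a ^+ 2 by rewrite divr_ge0 ?sqr_ge0// expR_ge0.
have -> : (D - 1) / a ^+ 2 = D / a ^+ 2 - 1 / a ^+ 2 by ring.
have -> : - (2 + a + a ^+ 2) / a ^+ 2 = - (2 * (1 / a ^+ 2) + 1 / a + 1).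
  by field; rewrite gt_eqF.
have : 0 < 1 / a ^+ 2 by rewrite divr_gt0// exprn_gt0.
by rewrite expr0n /= mul0r expr1n; lra.
Qed.

End Nonlinear.

Section Family.
Context {R : realType}.
Implicit Types (g y p : R -> R) (a b t s v : R).

Lemma radial_solution_comparison y1 p1 g1 y2 p2 g2 (a b L eta : R) :
  radial_solution g1 y1 p1 -> radial_solution g2 y2 p2 ->
  0 <= a -> a <= b -> 0 <= L -> 0 <= eta ->
  (forall t, a < t < b -> `|g1 t - g2 t| <= L * `|y1 t - y2 t| + eta) ->
  (y1 b - y2 b) ^+ 2 + (p1 b - p2 b) ^+ 2 <=
  ((y1 a - y2 a) ^+ 2 + (p1 a - p2 a) ^+ 2 + eta ^+ 2 * (b - a)) *
    expR ((L + 2) * (b - a)).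
Proof.
move=> s1 s2 a0 ab L0 eta0 hg.
have cy g y p t : radial_solution g y p -> {for t, continuous y}.
  exact: radial_solution_continuous.
have cp g y p t : radial_solution g y p -> {for t, continuous p}.
  by case=> _ cp _ _; exact: cp.
have dy g y p t : radial_solution g y p -> is_derive t 1 y (p t).
  by case=> dy _ _ _; exact: dy.
have dp g y p t : radial_solution g y p -> a < t < b ->
    is_derive t 1 p (- g t - p t / t).
  move=> s /andP[at_ _]; apply: radial_solution_derivative s _.
  by rewrite gt_eqF// (le_lt_trans a0).
apply: (@radial_comparison _ y1 p1 g1 y2 p2 g2) => //.
- by apply: continuous_within => t _; exact: cy s1.
- by apply: continuous_within => t _; exact: cp s1.
- by apply: continuous_within => t _; exact: cy s2.
- by apply: continuous_within => t _; exact: cp s2.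
- by move=> t _; exact: dy s1.
- by move=> t; exact: dp s1.
- by move=> t _; exact: dy s2.
- by move=> t; exact: dp s2.
Qed.

Lemma radial_solution0 : radial_solution (fun=> 0) (fun=> 0) (fun=> 0 : R).
Proof.
split=> // [t|t|t]; first exact: has_deriv_cst.
  exact: cont_cst.
by under eq_fun do rewrite mulr0; rewrite mulr0 oppr0; exact: has_deriv_cst.
Qed.

Definition stiffness a : R := 1 + 1 / floor_ a.

Lemma stiffness_ge0 a : 0 <= stiffness a.
Proof. by rewrite /stiffness addr_ge0// divr_ge0// ltW// floor_gt0. Qed.

Lemma nl_stiffness a y p : 0 <= a -> nl_solution a y p -> forall t, 0 <= t ->
  1 <= 1 + 1 / (1 + a * y t) <= stiffness a.
Proof.
move=> a0 [g [_ _ _ fl]] t /fl ft; have f0 := floor_gt0 a.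
have p0 : 0 < 1 + a * y t by exact: lt_trans ft.
rewrite lerDl divr_ge0 ?(ltW p0)//= lerD2l ler_pM2l// lef_pV2 ?posrE//.
exact: ltW.
Qed.

Lemma nl_oscillator a y p : 0 <= a -> nl_solution a y p -> oscillator y p.
Proof.
move=> a0 nl; have st := nl_stiffness a0 nl; case: nl => [g [s gE _ _]].
exists g, (fun t => 1 + 1 / (1 + a * y t)); split=> // t t0.
  by rewrite gE//; ring.
by have /andP[] := st _ t0.
Qed.

Lemma stiffness_le a b : 0 <= a -> a <= b -> stiffness a <= stiffness b.
Proof.
move=> a0 ab; rewrite /stiffness lerD2l ler_pM2l//.
by rewrite lef_pV2 ?posrE ?floor_gt0//; exact: floor_le.
Qed.

Lemma nl_bound a A M y p t : 0 <= a -> a <= A -> nl_solution a y p ->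
  0 <= t <= M -> y t ^+ 2 + p t ^+ 2 <= expR ((stiffness A + 2) * M).
Proof.
move=> a0 aA nl /andP[t0 tM]; have st := nl_stiffness a0 nl.
case: nl => [g [s gE y0 _]].
have h u : 0 < u < t -> `|g u - 0| <= stiffness A * `|y u - 0| + 0.
  move=> /andP[/ltW u0 _]; rewrite !subr0 addr0 gE//.
  have -> : y u + y u / (1 + a * y u) = (1 + 1 / (1 + a * y u)) * y u by ring.
  have /andP[s1 s2] := st _ u0.
  rewrite normrM ger0_norm; last by lra.
  by apply: ler_wpM2r => //; apply: le_trans s2 (stiffness_le a0 aA).
have [_ _ p0 _] := s.
have := radial_solution_comparison s radial_solution0 (lexx 0) t0
  (stiffness_ge0 A) (lexx 0) h.
rewrite !subr0 y0 p0 expr1n expr0n /= mul0r !addr0 mul1r => /le_trans; apply.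
by rewrite ler_expR ler_wpM2l// addr_ge0 ?stiffness_ge0.
Qed.

Lemma norm_le_sqr (u v c : R) : u ^+ 2 + v ^+ 2 <= c -> 0 <= c -> `|u| <= 1 + c /\ `|v| <= 1 + c.
Proof.
move=> h c0; have hu := sqr_ge0 u; have hv := sqr_ge0 v.
have := sqr_ge0 (`|u| - 1); have := sqr_ge0 (`|v| - 1).
rewrite -(real_normK (num_real u)) -(real_normK (num_real v)) in h hu hv.
by move: `|u| `|v| h hu hv => U V; split; nra.
Qed.

(** Away from the singularity a change of parameter perturbs the nonlinearity by
    a multiple of [a - b].  The floor is uniform in [a <= A], which includes the
    linear case [a = 0]. *)
Lemma nl_close A M : 0 <= M -> exists2 K, 0 <= K &
  forall a b y1 p1 y2 p2 t, 0 <= a <= A -> 0 <= b <= A ->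
    nl_solution a y1 p1 -> nl_solution b y2 p2 -> 0 <= t <= M ->
    (y1 t - y2 t) ^+ 2 + (p1 t - p2 t) ^+ 2 <= K * (a - b) ^+ 2.
Proof.
move=> M0; pose B := 1 + expR ((stiffness A + 2) * M).
have B0 : 0 <= B by rewrite addr_ge0// expR_ge0.
pose d := floor_ A; have d0 : 0 < d := floor_gt0 A.
pose c := B ^+ 2 / d ^+ 2; pose L := 1 + 1 / d ^+ 2.
have c0 : 0 <= c by rewrite divr_ge0 ?sqr_ge0.
have L0 : 0 <= L by rewrite addr_ge0// divr_ge0// sqr_ge0.
exists (c ^+ 2 * M * expR ((L + 2) * M)).
  by rewrite mulr_ge0 ?expR_ge0// mulr_ge0// sqr_ge0.
move=> a b y1 p1 y2 p2 t /andP[a0 aA] /andP[b0 bA] n1 n2 /andP[t0 tM].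
have bd a' y p u : 0 <= a' -> a' <= A -> nl_solution a' y p -> 0 <= u <= M -> `|y u| <= B.
  by move=> h1 h2 h3 h4; apply: (norm_le_sqr (nl_bound h1 h2 h3 h4) (expR_ge0 _)).1.
have bd1 u := bd a y1 p1 u a0 aA n1; have bd2 u := bd b y2 p2 u b0 bA n2.
case: n1 n2 => [g1 [s1 g1E y10 f1]] [g2 [s2 g2E y20 f2]].
have {}f1 u : 0 <= u -> d <= 1 + a * y1 u.
  by move=> u0; exact: le_trans (floor_le a0 aA) (ltW (f1 _ u0)).
have {}f2 u : 0 <= u -> d <= 1 + b * y2 u.
  by move=> u0; exact: le_trans (floor_le b0 bA) (ltW (f2 _ u0)).
have h u : 0 < u < t -> `|g1 u - g2 u| <= L * `|y1 u - y2 u| + c * `|a - b|.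
  move=> /andP[/ltW u0 ut].
  have uM : 0 <= u <= M by rewrite u0/=; lra.
  have := bd1 _ uM; have := bd2 _ uM; have := f1 _ u0; have := f2 _ u0.
  rewrite g1E// g2E//; move: (y1 u) (y2 u) => Y Z q2 q1 ZB YB.
  set m := 1 + a * Y in q1 *; set n := 1 + b * Z in q2 *.
  have m0 : 0 < m by exact: lt_le_trans q1.
  have n0 : 0 < n by exact: lt_le_trans q2.
  have -> : Y + Y / m - (Z + Z / n) = (Y - Z) + ((Y - Z) + (b - a) * (Y * Z)) * (m^-1 * n^-1).
    by rewrite /m /n; field; rewrite !gt_eqF.
  have i1 : 0 <= m^-1 * n^-1 by rewrite mulr_ge0 ?invr_ge0 ?ltW.
  have i2 : m^-1 * n^-1 <= 1 / d ^+ 2.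
    rewrite mul1r expr2 invfM; apply: ler_pM; rewrite ?invr_ge0 ?lef_pV2 ?posrE//; exact: ltW.
  apply: le_trans (ler_normD _ _) _; rewrite normrM (ger0_norm i1).
  have h1 : `|Y - Z + (b - a) * (Y * Z)| <= `|Y - Z| + `|a - b| * B ^+ 2.
    apply: le_trans (ler_normD _ _) _; rewrite lerD2l normrM distrC.
    by apply: ler_wpM2l => //; rewrite normrM expr2 ler_pM.
  have : `|Y - Z + (b - a) * (Y * Z)| * (m^-1 * n^-1) <=
      (`|Y - Z| + `|a - b| * B ^+ 2) * (1 / d ^+ 2) by apply: ler_pM.
  by rewrite /L /c; lra.
have [_ _ p10 _] := s1; have [_ _ p20 _] := s2.
have eta0 : 0 <= c * `|a - b| by rewrite mulr_ge0.
have := radial_solution_comparison s1 s2 (lexx 0) t0 L0 eta0 h.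
rewrite y10 y20 p10 p20 !subrr expr0n /= !add0r !subr0 => /le_trans; apply.
rewrite exprMn real_normK ?num_real//.
rewrite [leRHS](_ : _ = c ^+ 2 * (a - b) ^+ 2 * M * expR ((L + 2) * M)); last by ring.
have k0 : 0 <= c ^+ 2 * (a - b) ^+ 2 by rewrite mulr_ge0 ?sqr_ge0.
apply: ler_pM; [by rewrite mulr_ge0|exact: expR_ge0|exact: ler_wpM2l|].
by rewrite ler_expR ler_wpM2l// addr_ge0.
Qed.

(** The absolute value makes the family even, so that continuity at the end point
    [a = 0] is ordinary continuity. *)
Definition profile a : (R -> R) * (R -> R) :=
  xget (cst 0, cst 0) [set yp | nl_solution `|a| yp.1 yp.2].

Lemma profileP a : nl_solution `|a| (profile a).1 (profile a).2.
Proof.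
have [y [p nl]] := nl_solution_exists (normr_ge0 a).
by apply: (@xgetPex _ _ [set yp | nl_solution `|a| yp.1 yp.2]); exists (y, p).
Qed.

Lemma profile_oscillator a : oscillator (profile a).1 (profile a).2.
Proof. exact: nl_oscillator (normr_ge0 a) (profileP a). Qed.

Lemma profile0 a : (profile a).1 0 = 1.
Proof. by have [g []] := profileP a. Qed.

Definition waves a : (nat -> R) * (nat -> R) :=
  xget (cst 0, cst 0) [set XT | wave_chain (profile a).1 (profile a).2 XT.1 XT.2].

Lemma wavesP a :
  wave_chain (profile a).1 (profile a).2 (waves a).1 (waves a).2.
Proof.
have [X [T XT]] := wave_chain_exists (profile_oscillator a) (profile0 a).
by apply: (@xgetPex _ _ [set XT | wave_chain _ _ XT.1 XT.2]); exists (X, T).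
Qed.

Definition crit a k := (waves a).2 k.

Lemma profile_close a0 M e : 0 < e -> \forall a \near a0, forall t, 0 <= t <= M ->
  `|(profile a).1 t - (profile a0).1 t| < e /\
  `|(profile a).2 t - (profile a0).2 t| < e.
Proof.
move=> e0; have [M0|M0] := ltP M 0.
  by near=> a => t /andP[t0 tM]; lra.
have [K K0 hK] := nl_close (`|a0| + 1) M0.
have K1 : 0 < K + 1 by lra.
pose d := Num.min 1 (e / (K + 1)).
have d0 : 0 < d by rewrite lt_min ltr01 divr_gt0.
exists d => //= a; rewrite /ball/= => ad t tM.
have d1 : d <= 1 by rewrite ge_min lexx.
have de : d * (K + 1) <= e by rewrite -ler_pdivlMr// ge_min lexx orbT.
have ab : `| `|a| - `|a0| | < d.
  by apply: le_lt_trans (ler_dist_dist _ _) _; rewrite distrC.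
have aA : 0 <= `|a| <= `|a0| + 1.
  by rewrite normr_ge0/=; have := ler_norm (`|a| - `|a0|); lra.
have a0A : 0 <= `|a0| <= `|a0| + 1 by rewrite normr_ge0/=; lra.
have := hK _ _ _ _ _ _ _ aA a0A (profileP a) (profileP a0) tM.
have small (u : R) : u ^+ 2 <= K * (`|a| - `|a0|) ^+ 2 -> `|u| < e.
  move=> h; rewrite ltNge; apply/negP => eu.
  have : e ^+ 2 <= u ^+ 2 by rewrite -(real_normK (num_real u)) lerXn2r ?nnegrE// ltW.
  have : (`|a| - `|a0|) ^+ 2 <= d ^+ 2.
    by rewrite -(real_normK (num_real (_ - _))) lerXn2r ?nnegrE// ltW.
  move: h; move: (sqr_ge0 (`|a| - `|a0|)); move: ((`|a| - `|a0|) ^+ 2) => z z0 h z1 z2.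
  have : K * z <= K * d ^+ 2 by exact: ler_wpM2l.
  have : (d * (K + 1)) ^+ 2 <= e ^+ 2.
    by rewrite lerXn2r ?nnegrE// ?mulr_ge0// ltW.
  have d2 : 0 < d ^+ 2 by exact: exprn_gt0.
  have -> : (d * (K + 1)) ^+ 2 = d ^+ 2 * K ^+ 2 + K * d ^+ 2 + K * d ^+ 2 + d ^+ 2 by ring.
  have : 0 <= d ^+ 2 * K ^+ 2 by rewrite mulr_ge0 ?sqr_ge0.
  have : 0 <= K * d ^+ 2 by rewrite mulr_ge0 ?sqr_ge0.
  by lra.
move=> h; have := sqr_ge0 ((profile a).1 t - (profile a0).1 t).
have := sqr_ge0 ((profile a).2 t - (profile a0).2 t) => h1 h2.
by split; apply: small; lra.
Unshelve. all: by end_near. Qed.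

Lemma crit_continuous k : continuous (crit ^~ k).
Proof.
move=> a0; apply: (@chain_cvg _ _ (nbhs a0) _ (profile a0).1 (profile a0).2
  (waves a0).1 (waves a0).2 (fun a => (profile a).1) (fun a => (profile a).2)
  (fun a => (waves a).1) (fun a => (waves a).2)).
- exact: profile_oscillator.
- exact: wavesP.
- exact: profile_oscillator.
- exact: wavesP.
- by move=> M e; exact: profile_close.
Qed.

End Family.

(** * The limit of large amplitudes *)

Section Bounce.
Context {R : realType}.
Implicit Types (g y p : R -> R) (a b t s v : R).

Lemma potential_ge0 a v : 0 < a -> 0 < 1 + a * v -> 0 <= potential a v.
Proof.
move=> a0 av; have h : ln (1 + a * v) <= a * v by apply: le_ln1Dx; lra.
rewrite /potential -addrA addr_ge0 ?divr_ge0 ?sqr_ge0// subr_ge0.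
rewrite ler_pdivrMr ?exprn_gt0// (_ : v / a * a ^+ 2 = a * v)//.
by field; rewrite gt_eqF.
Qed.

(** In [bounce_duration] the virial term [y (y + y / (1 + a y))] has to dominate
    the potential energy. *)
Lemma potential_le a v : 0 < a -> 0 < 1 + a * v -> v <= 0 ->
  potential a v <= v * (v + v / (1 + a * v)).
Proof.
move=> a0 av v0; set th := 1 + a * v in av *.
have h : - ln th <= th^-1 - 1.
  have i0 : 0 < th^-1 by rewrite invr_gt0.
  have := @le_ln1Dx R (th^-1 - 1); rewrite (_ : 1 + _ = th^-1); last by ring.
  by rewrite lnV ?posrE//; apply; lra.
have k : - (ln th / a ^+ 2) <= (th^-1 - 1) / a ^+ 2.
  by rewrite -mulNr ler_pM2r ?invr_gt0 ?exprn_gt0.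
have e : v / a + (th^-1 - 1) / a ^+ 2 = v ^+ 2 / th.
  by rewrite /th in av *; field; rewrite !gt_eqF.
rewrite /potential -/th mulrDr -expr2 mulrA -expr2.
by have := sqr_ge0 v; lra.
Qed.

Lemma potential0 a : potential a 0 = 0.
Proof. by rewrite /potential mulr0 addr0 ln1 expr0n /= !mul0r addr0 subr0. Qed.

Section OneBounce.
Variables (a : R) (y p : R -> R) (x x' : R).
Hypotheses (a0 : 0 < a) (nl : nl_solution a y p).
Hypotheses (x0 : 0 < x) (xx' : x < x') (yx : y x = 0) (yx' : y x' = 0).
Hypothesis yneg : forall t, x < t < x' -> y t < 0.

Let E t := p t ^+ 2 / 2 + potential a (y t).

Let floor_pos t : 0 <= t -> 0 < 1 + a * y t.
Proof. by case: nl => g [_ _ _ fl] /fl; exact: lt_trans (floor_gt0 a). Qed.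

Let dy t : is_derive t 1 y (p t).
Proof. by case: nl => g [[h _ _ _] _ _ _]; exact: h. Qed.

Let dp t : 0 < t -> is_derive t 1 p (- (y t + y t / (1 + a * y t)) - p t / t).
Proof.
case: nl => g [s gE _ _] t0; rewrite -gE ?(ltW t0)//.
by apply: radial_solution_derivative s _; rewrite gt_eqF.
Qed.

Let dE t : 0 < t -> is_derive t 1 E (- (p t ^+ 2 / t)).
Proof.
move=> t0; apply: energy_deriv => //; rewrite ?gt_eqF//; last exact: dp.
by apply: floor_pos; exact: ltW.
Qed.

Let pos t : x <= t -> 0 < t. Proof. exact: lt_le_trans. Qed.

Lemma energy_decreases s t : x <= s -> s <= t -> E t <= E s.
Proof.
move=> xs st; have dE' u : s <= u <= t -> is_derive u 1 E (- (p u ^+ 2 / u)).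
  by move=> /andP[su _]; apply/dE/pos/(le_trans xs).
apply: (@derive_nonincreasing _ E _ _ _ st _ _ (has_deriv_within dE')).
  by move=> u /andP[/ltW su /ltW ut]; apply: dE'; rewrite su.
move=> u /andP[/ltW su _]; rewrite oppr_le0 divr_ge0 ?sqr_ge0// ltW// pos//.
exact: le_trans su.
Qed.

Lemma energy_decreases_slowly s t : x <= s -> s <= t -> s ^+ 2 * E s <= t ^+ 2 * E t.
Proof.
move=> xs st; pose D u := u * (potential a (y u) *+ 2).
have dF u : s <= u <= t -> is_derive u 1 (fun u => u ^+ 2 * E u) (D u).
  move=> /andP[su _]; have u0 := pos (le_trans xs su).
  have dEu := dE u0; set F := E in dEu *.
  have -> : D u = 2 * u * E u + u ^+ 2 * - (p u ^+ 2 / u).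
    by rewrite /D /E; field; rewrite gt_eqF.
  by rewrite -/F; deriv; ring.
apply: (@derive_nondecreasing _ (fun u => u ^+ 2 * E u) D _ _ st _ _
  (has_deriv_within dF)).
  by move=> u /andP[/ltW su /ltW ut]; apply: dF; rewrite su.
move=> u /andP[/ltW su _]; have u0 := pos (le_trans xs su).
by rewrite mulr_ge0 ?mulrn_wge0 ?potential_ge0 ?floor_pos// ltW.
Qed.

(** Between two consecutive zeros [E] decreases but [t ^ 2 E] increases, and at a
    zero the energy is kinetic: when [x'] is close to [x] the solution comes back
    with almost the speed at which it went in. *)
Lemma bounce_speed : x ^+ 2 * p x ^+ 2 <= x' ^+ 2 * p x' ^+ 2 /\ p x' ^+ 2 <= p x ^+ 2.
Proof.
have h1 := energy_decreases (lexx x) (ltW xx').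
have h2 := energy_decreases_slowly (lexx x) (ltW xx').
move: h1 h2; rewrite /E yx yx' potential0 !addr0 !mulrA => h1 h2.
by split; lra.
Qed.

(** Along a bounce [y] is of order [1 / a] while the energy is not small.  By the
    virial identity, [(t p y) / 2 + (3 / 2) t p / a] grows at rate at least [t E],
    although its variation is only of order [1 / a]: the bounce is short. *)
Lemma bounce_duration :
  x ^+ 2 * p x ^+ 2 / (2 * x') * (x' - x) <= 3 / 2 * (x' * p x' - x * p x) / a.
Proof.
pose c := x ^+ 2 * p x ^+ 2 / (2 * x').
pose G t := y t + y t / (1 + a * y t).
pose A t := t * p t * y t / 2 + 3 / 2 * (t * p t) / a - c * t.
pose D t := (- (t * G t) * y t + t * p t * p t) / 2 + 3 / 2 * (- (t * G t)) / a - c.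
have dA t : x <= t <= x' -> is_derive t 1 A (D t).
  move=> /andP[/pos t0 _]; have d1 := dy t; have d2 := dp t0.
  by rewrite /A /D /G; deriv; field; rewrite !gt_eqF// floor_pos// ltW.
have : A x <= A x'.
  apply: (@derive_nondecreasing _ A D _ _ (ltW xx') _ _ (has_deriv_within dA)).
    by move=> u /andP[/ltW su /ltW ut]; apply: dA; rewrite su.
  move=> t txx'; have yt := yneg txx'; case/andP: txx' => /ltW xt tx'.
  have t0 := pos xt; have f0 := floor_pos (ltW t0).
  have pot := potential_le a0 f0 (ltW yt).
  have Gneg : G t <= 0.
    have : y t / (1 + a * y t) <= 0 by rewrite pmulr_lle0 ?invr_gt0// ltW.
    by rewrite /G; lra.
  have yG : y t * G t <= - (G t / a).
    have : 0 <= (- G t) * ((1 + a * y t) / a).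
      by rewrite mulr_ge0 ?oppr_ge0// divr_ge0 ?ltW.
    by rewrite (_ : _ * (_ / _) = - (G t / a) - y t * G t); [lra|field; rewrite gt_eqF].
  have Et : c <= t * E t.
    have h := energy_decreases_slowly (lexx x) xt.
    have x'0 : 0 < x' by exact: lt_trans xx'.
    rewrite /c ler_pdivrMr ?mulr_gt0//.
    have -> : x ^+ 2 * p x ^+ 2 = 2 * (x ^+ 2 * E x).
      by rewrite /E yx potential0; field.
    have E0 : 0 <= E t.
      by rewrite /E addr_ge0 ?divr_ge0 ?sqr_ge0// potential_ge0.
    have : t * E t * t <= t * E t * x' by rewrite ler_wpM2l ?mulr_ge0// ltW.
    by rewrite mulrAC -expr2; lra.
  have : t * (p t ^+ 2 / 2 + y t * G t) <= (- (t * G t) * y t + t * p t * p t) / 2 + 3 / 2 * (- (t * G t)) / a.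
    have := ler_wpM2l (ltW t0) yG; rewrite (_ : t * - (G t / a) = - (t * G t) / a); last by ring.
    by lra.
  have : t * E t <= t * (p t ^+ 2 / 2 + y t * G t).
    by rewrite ler_wpM2l ?(ltW t0)// /E lerD2l.
  by rewrite /D; lra.
rewrite /A yx yx' !mulr0 !mul0r !add0r -/c => h.
have -> : c * (x' - x) = c * x' - c * x by ring.
have -> : 3 / 2 * (x' * p x' - x * p x) / a = 3 / 2 * (x' * p x') / a - 3 / 2 * (x * p x) / a.
  by ring.
by lra.
Qed.

End OneBounce.
End Bounce.

Section LargeAmplitude.
Context {R : realType}.
Implicit Types (g y p : R -> R) (a b t s v : R).

Definition bessel_solution y p := exists g, [/\ radial_solution g y p,
  forall t, 0 <= t -> g t = y t & y 0 = 1].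

Lemma bessel_solution_exists : exists y p, bessel_solution y p.
Proof.
have [|y [p [s y0]]] := @radial_picard R id 1 1 ltr01; first by move=> u v; rewrite mul1r.
by exists y, p; eexists; split; [exact: s|move=> t t0 /=; rewrite ger0_norm|].
Qed.

Lemma bessel_oscillator y p : bessel_solution y p -> oscillator y p.
Proof.
move=> [g [s gE _]]; exists g, (fun=> 1); split=> // t t0.
by rewrite gE// mul1r.
Qed.

Variables (yJ pJ : R -> R) (XJ TJ : nat -> R).
Hypotheses (bes : bessel_solution yJ pJ) (chJ : wave_chain yJ pJ XJ TJ).
Notation ya a := (profile a).1.
Notation pa a := (profile a).2.
Notation X a := (waves a).1.
Notation T a := (waves a).2.

Let oscJ := bessel_oscillator bes.

(** As long as [y >= 0] the singular term [y / (1 + a y)] is at most [1 / a], and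
    [y] satisfies Bessel's equation up to this error. *)
Lemma profile_near_bessel (c s : R) (sa xa : R -> R) :
  sa a @[a --> +oo] --> s ->
  (\forall a \near +oo, 0 <= sa a /\
    forall t, sa a <= t <= xa a -> 0 <= ya a t) ->
  ya a (sa a) @[a --> +oo] --> c * yJ s ->
  pa a (sa a) @[a --> +oo] --> c * pJ s ->
  forall M e, 0 < e -> \forall a \near +oo, forall t, sa a <= t <= xa a ->
    t <= M -> `|ya a t - c * yJ t| < e /\ `|pa a t - c * pJ t| < e.
Proof.
move=> sas hpos hy hp M e e0.
have [M0|M0] := ltP M 0.
  near=> a => t /andP[sat _] tM.
  have : 0 <= sa a /\ forall t, sa a <= t <= xa a -> 0 <= ya a t by near: a.
  by move=> [h _]; lra.
pose eta := e ^+ 2 / (4 * expR (3 * M)).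
have eta0 : 0 < eta by rewrite divr_gt0 ?exprn_gt0// mulr_gt0// expR_gt0.
have cyJ : (c * yJ (sa a)) @[a --> +oo] --> c * yJ s.
  apply: cvgM; first exact: cvg_cst.
  by apply: (@cvg_comp _ _ _ sa yJ) sas _; exact: (@oscillator_continuous _ _ _ oscJ s).
have cpJ : (c * pJ (sa a)) @[a --> +oo] --> c * pJ s.
  apply: cvgM; first exact: cvg_cst.
  by apply: (@cvg_comp _ _ _ sa pJ) sas _; exact: (@oscillator_continuous' _ _ _ oscJ s).
have eta2 : 0 < Num.min 1 (eta / 2) by rewrite lt_min ltr01 divr_gt0.
have /cvgrPdist_lt hy0 : (ya a (sa a) - c * yJ (sa a)) @[a --> +oo] --> c * yJ s - c * yJ s.
  exact: cvgB.
have /cvgrPdist_lt hp0 : (pa a (sa a) - c * pJ (sa a)) @[a --> +oo] --> c * pJ s - c * pJ s.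
  exact: cvgB.
have {}hy0 := hy0 _ eta2; have {}hp0 := hp0 _ eta2.
have sq (u : R) : `|u| < Num.min 1 (eta / 2) -> u ^+ 2 <= eta / 2.
  rewrite lt_min => /andP[u1 u2]; rewrite -(real_normK (num_real u)) expr2.
  by have := normr_ge0 u; nra.
near=> a.
have a1 : 1 + M / eta < a by near: a; apply: nbhs_pinfty_gt; rewrite num_real.
have aM : 0 <= M / eta by rewrite divr_ge0// ltW.
have apos : 0 < a by lra.
have [sa0 yapos] : 0 <= sa a /\ forall t, sa a <= t <= xa a -> 0 <= ya a t by near: a.
have h1 : `|c * yJ s - c * yJ s - (ya a (sa a) - c * yJ (sa a))| < Num.min 1 (eta / 2).
  by near: a.
have h2 : `|c * pJ s - c * pJ s - (pa a (sa a) - c * pJ (sa a))| < Num.min 1 (eta / 2).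
  by near: a.
move: h1 h2; rewrite !subrr !sub0r !normrN => /sq h1 /sq h2 t /andP[sat tx] tM.
have [gJ [sJ gJE _]] := bes; have [g [sg gE _ fl]] := profileP a.
have s2 := radial_solution_lincomb c 0 sJ radial_solution0.
have e2 (f : R -> R) : (fun t => c * f t + 0 * 0) = (fun t => c * f t).
  by apply/funext => u; rewrite mul0r addr0.
rewrite !e2 in s2.
have i0 : 0 <= a^-1 by rewrite invr_ge0 ltW.
have h : forall u, sa a < u < t -> `|g u - c * gJ u| <= 1 * `|ya a u - c * yJ u| + a^-1.
  move=> u /andP[/ltW su /ltW ut]; have u0 := le_trans sa0 su.
  rewrite gE// gJE// mul1r (gtr0_norm apos) addrAC.
  apply: le_trans (ler_normD _ _) _; rewrite lerD2l.
  have yu : 0 <= ya a u by apply: yapos; rewrite su (le_trans ut).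
  have ayu : 0 <= a * ya a u by rewrite mulr_ge0// ltW.
  rewrite ger0_norm; last by rewrite divr_ge0//; lra.
  rewrite ler_pdivrMr; last by lra.
  by rewrite mulrDr mulrA mulVf ?gt_eqF// mul1r mulr1 lerDr.
have := radial_solution_comparison sg s2 sa0 sat ler01 i0 h.
move=> cmp.
have tail : (a^-1) ^+ 2 * (t - sa a) <= eta.
  have ts : t - sa a <= M by lra.
  have Ma : M <= eta * a by rewrite -ler_pdivrMl//; lra.
  have ia : a^-1 <= 1 by rewrite invf_le1//; lra.
  have : a^-1 ^+ 2 * (t - sa a) <= a^-1 * (eta * a).
    rewrite expr2 -mulrA; apply: ler_wpM2l => //.
    apply: le_trans Ma; apply: le_trans ts; rewrite ler_piMl//; lra.
  by rewrite mulrCA mulVf ?gt_eqF// mulr1.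
have fin : (ya a t - c * yJ t) ^+ 2 + (pa a t - c * pJ t) ^+ 2 < e ^+ 2.
  apply: le_lt_trans cmp _.
  apply: (@le_lt_trans _ _ (2 * eta * expR (3 * M))).
    apply: ler_pM; rewrite ?expR_ge0//.
    - apply: addr_ge0; first by rewrite addr_ge0 ?sqr_ge0.
      by rewrite mulr_ge0 ?sqr_ge0 ?subr_ge0.
    - by move: h1 h2 tail; lra.
    - by rewrite ler_expR; lra.
  rewrite /eta; have := expR_gt0 (3 * M); move: (expR _) => E E0.
  rewrite (_ : 2 * _ * _ = e ^+ 2 / 2); last by field; rewrite gt_eqF.
  by have : 0 < e ^+ 2 by [exact: exprn_gt0]; lra.
have small (u w : R) : u ^+ 2 + w ^+ 2 < e ^+ 2 -> `|u| < e.
  move=> uw; rewrite ltNge; apply/negP => eu.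
  have : e ^+ 2 <= u ^+ 2 by rewrite -(real_normK (num_real u)) lerXn2r ?nnegrE// ltW.
  by have := sqr_ge0 w; lra.
by split; [exact: small fin|move: fin; rewrite addrC; exact: small].
Unshelve. all: by end_near. Qed.

End LargeAmplitude.

Section Limit.
Context {R : realType}.
Implicit Types (y p : R -> R) (a t : R).
Variables (yJ pJ : R -> R) (XJ TJ : nat -> R).
Hypotheses (bes : bessel_solution yJ pJ) (chJ : wave_chain yJ pJ XJ TJ).
Notation ya a := (profile a).1.
Notation pa a := (profile a).2.
Notation X a := (waves a).1.
Notation T a := (waves a).2.

Let oscJ := bessel_oscillator bes.

Lemma inv_pinfty0 : a^-1 @[a --> +oo] --> (0 : R).
Proof.
apply/cvgrPdist_lt => e e0; near=> a.
have ae : e^-1 < a by near: a; apply: nbhs_pinfty_gt; rewrite num_real.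
have i0 : 0 < e^-1 by rewrite invr_gt0.
have a0 : 0 < a by lra.
by rewrite sub0r normrN gtr0_norm ?invr_gt0// invf_plt ?posrE.
Unshelve. all: by end_near. Qed.

(** In the limit a bounce is an elastic reflection: it takes no time by
    [bounce_duration], and reverses the speed by [bounce_speed]. *)
Lemma bounce_cvg k (x0 m0 : R) : ~~ odd k -> 0 < x0 -> 0 < m0 ->
  X a k @[a --> +oo] --> x0 -> pa a (X a k) @[a --> +oo] --> - m0 ->
  X a k.+1 @[a --> +oo] --> x0 /\ pa a (X a k.+1) @[a --> +oo] --> m0.
Proof.
move=> ek x00 m00 hX hp.
(* [C] bounds [X a k.+1] by the gaps of [half_wave]; [K] is what [bounce_duration]
   gives when [x], [x'] and the speeds are replaced by their bounds. *)
pose C := 2 * x0 + 2 * (1 + pi); have C0 : 0 < C by have := pi_gt0 R; rewrite /C; lra.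
pose K := 6 * C * m0 * (2 * C * 16 / (x0 ^+ 2 * m0 ^+ 2)).
have X1 : \forall a \near +oo, x0 / 2 < X a k by apply: (cvgr_gt x0 hX); lra.
have X2 : \forall a \near +oo, X a k < 2 * x0 by apply: (cvgr_lt x0 hX); lra.
have P1 : \forall a \near +oo, pa a (X a k) < - (m0 / 2) by apply: (cvgr_lt (- m0) hp); lra.
have P2 : \forall a \near +oo, - (2 * m0) < pa a (X a k) by apply: (cvgr_gt (- m0) hp); lra.
have key : \forall a \near +oo, X a k <= X a k.+1 <= X a k + K * a^-1 /\
    - pa a (X a k) * (X a k / X a k.+1) <= pa a (X a k.+1) <= - pa a (X a k).
  near=> a.
  have a0 : 0 < a by near: a; apply: nbhs_pinfty_gt; rewrite num_real.
  have h1 : x0 / 2 < X a k by near: a.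
  have h2 : X a k < 2 * x0 by near: a.
  have h3 : pa a (X a k) < - (m0 / 2) by near: a.
  have h4 : - (2 * m0) < pa a (X a k) by near: a.
  have nl := profileP a; rewrite (gtr0_norm a0) in nl.
  have ch := wavesP a.
  have sk : sgk k = 1 :> R by rewrite /sgk -signr_odd (negbTE ek) expr0.
  have sk1 (u : R) : sgk k.+1 * u = - u by rewrite sgkS sk mul1r.
  have xT := chain_XT ch k; have Tx' := chain_TX ch k.+1.
  have xx' : X a k < X a k.+1 by exact: lt_trans Tx'.
  have p'0 : 0 < pa a (X a k.+1).
    by rewrite -oppr_lt0 -sk1; apply: (chain_p_neg ch); rewrite Tx' (chain_XT ch).
  have x'C : X a k.+1 <= C.
    case: (ch) => _ hw; have [[_ /andP[_ u1] _ _] _] := hw k.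
    have [[/andP[_ u2] _ _ _] _] := hw k.+1.
    by rewrite /C; lra.
  have yneg t : X a k < t < X a k.+1 -> ya a t < 0.
    move=> /andP[xt tx']; have [tT|Tt] := leP t (T a k.+1).
      by have := @chain_y_neg _ _ _ _ _ ch k t; rewrite xt tT sk mul1r; apply.
    by rewrite -oppr_gt0 -sk1; apply: (chain_y_pos ch); rewrite ltW.
  have xpos : 0 < X a k by lra.
  have yx := chain_yX ch k; have yx' := chain_yX ch k.+1.
  have [sp1 sp2] := bounce_speed a0 nl xpos xx' yx yx'.
  have dur := bounce_duration a0 nl xpos xx' yx yx' yneg.
  move: (X a k) (X a k.+1) (pa a (X a k)) (pa a (X a k.+1)) xpos h1 h2 h3 h4 xx' p'0 x'C sp1 sp2 dur.
  move=> x x' p p' xpos h1 h2 h3 h4 xx' p'0 x'C sp1 sp2 dur {yneg xT Tx' yx yx' nl ch sk1}.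
  have x'0 : 0 < x' by lra.
  have pp : p' <= - p.
    by rewrite -ler_sqr ?nnegrE ?sqrrN//; lra.
  split; apply/andP; split => //; first by exact: ltW.
    have c0 : 0 < x0 ^+ 2 * m0 ^+ 2 by rewrite mulr_gt0// exprn_gt0.
    have lo : (x0 ^+ 2 * m0 ^+ 2) / (2 * C * 16) <= x ^+ 2 * p ^+ 2 / (2 * x').
      have e1 : x0 ^+ 2 / 4 <= x ^+ 2.
        by rewrite (_ : _ / 4 = (x0 / 2) ^+ 2); [rewrite lerXn2r ?nnegrE; lra|field].
      have e2 : m0 ^+ 2 / 4 <= p ^+ 2.
        by rewrite -(sqrrN p) (_ : _ / 4 = (m0 / 2) ^+ 2); [rewrite lerXn2r ?nnegrE; lra|field].
      have e3 : (2 * C)^-1 <= (2 * x')^-1 by rewrite lef_pV2 ?posrE; lra.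
      have -> : x0 ^+ 2 * m0 ^+ 2 / (2 * C * 16) = x0 ^+ 2 / 4 * (m0 ^+ 2 / 4) * (2 * C)^-1.
        by field; rewrite gt_eqF.
      apply: ler_pM e3; rewrite ?invr_ge0; [|lra|].
        by rewrite mulr_ge0// divr_ge0// sqr_ge0.
      by apply: ler_pM e2 => //; rewrite divr_ge0// sqr_ge0.
    have up : 3 / 2 * (x' * p' - x * p) / a <= 6 * C * m0 / a.
      rewrite ler_pM2r ?invr_gt0//.
      have : x' * p' <= C * (2 * m0) by apply: ler_pM; lra.
      have : x * - p <= C * (2 * m0) by apply: ler_pM; lra.
      by lra.
    have lo' : (x0 ^+ 2 * m0 ^+ 2) / (2 * C * 16) * (x' - x) <= 6 * C * m0 / a.
      apply: le_trans up; apply: le_trans dur; apply: ler_wpM2r => //; lra.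
    rewrite -lerBlDl /K.
    have -> : x' - x = (x0 ^+ 2 * m0 ^+ 2) / (2 * C * 16) * (x' - x) *
        (2 * C * 16 / (x0 ^+ 2 * m0 ^+ 2)).
      by field; rewrite !gt_eqF.
    rewrite [leRHS]mulrAC; apply: ler_wpM2r => //.
    by rewrite divr_ge0 ?(ltW c0)//; lra.
  have np0 : 0 <= - p by lra.
  have q0 : 0 <= - p * (x / x').
    by apply: mulr_ge0 np0 _; apply: divr_ge0; exact: ltW.
  rewrite -ler_sqr ?nnegrE ?(ltW p'0)//.
  have -> : (- p * (x / x')) ^+ 2 = x ^+ 2 * p ^+ 2 / x' ^+ 2 by field; rewrite gt_eqF.
  by rewrite ler_pdivrMr ?exprn_gt0// mulrC; lra.
have cX : X a k.+1 @[a --> +oo] --> x0.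
  apply: (@squeeze_cvgr _ _ _ _ (fun a => X a k) (fun a => X a k + K * a^-1)) => //.
    by apply: filterS key => a [].
  rewrite -[l in _ --> l]addr0 -(mulr0 K); apply: cvgD => //.
  by apply: cvgM; [exact: cvg_cst|exact: inv_pinfty0].
split=> //.
have hp' : - pa a (X a k) @[a --> +oo] --> m0 by rewrite -[m0]opprK; exact: cvgN.
apply: (@squeeze_cvgr _ _ _ _ (fun a => - pa a (X a k) * (X a k / X a k.+1))
  (fun a => - pa a (X a k))) => //.
  by apply: filterS key => a [].
rewrite -[m0]mulr1 -(divff (lt0r_neq0 x00)); apply: cvgM => //.
by apply: cvgM => //; apply: cvgV => //; rewrite gt_eqF.
Unshelve. all: by end_near. Qed.

Lemma cvg_diff0 (f g : R -> R) (l : R) : g a @[a --> +oo] --> l ->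
  (forall e : R, 0 < e -> \forall a \near +oo, `|f a - g a| < e) ->
  f a @[a --> +oo] --> l.
Proof.
move=> /cvgrPdist_lt gl h; apply/cvgrPdist_lt => e e0.
have e2 : 0 < e / 2 by rewrite divr_gt0.
have g2 := gl _ e2; have h2 := h _ e2.
near=> a; have h1 : `|l - g a| < e / 2 by near: a.
have h3 : `|f a - g a| < e / 2 by near: a.
apply: le_lt_trans (ler_distD (g a) _ _) _.
by rewrite [`|g a - _|]distrC; lra.
Unshelve. all: by end_near. Qed.

(** At large amplitude the graph of the solution follows [|J_0|]: each zero of
    [J_0] splits into two zeros with a minimum in between, where the solution
    bounces off the singularity. *)
Lemma large_amplitude j :
  [/\ T a j.*2 @[a --> +oo] --> TJ j,
      ya a (T a j.*2) @[a --> +oo] --> sgk j * yJ (TJ j),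
      X a j.*2 @[a --> +oo] --> XJ j & X a j.*2.+1 @[a --> +oo] --> XJ j].
Proof.
have sg2 i : sgk i.*2 = 1 :> R by rewrite /sgk -signr_odd odd_double expr0.
have oscY a := profile_oscillator a; have chY a := wavesP a.
have cJ t := @oscillator_continuous _ _ _ oscJ t.
have cJ' t := @oscillator_continuous' _ _ _ oscJ t.
have csJ i t : {for t, continuous (fun t => sgk i * yJ t)}.
  exact: (cont_mul (@cont_cst _ (sgk i) t) (cJ t)).
have csJ' i t : {for t, continuous (fun t => sgk i * pJ t)}.
  exact: (cont_mul (@cont_cst _ (sgk i) t) (cJ' t)).
have near_lt (f : R -> R) (l : R) : f a @[a --> +oo] --> l -> \forall a \near +oo, f a <= l + 1.
  by move=> fl; near do apply: ltW; apply: (cvgr_lt l fl); lra.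
suff step i : T a i.*2 @[a --> +oo] --> TJ i ->
    ya a (T a i.*2) @[a --> +oo] --> sgk i * yJ (TJ i) ->
    [/\ X a i.*2 @[a --> +oo] --> XJ i, X a i.*2.+1 @[a --> +oo] --> XJ i,
      T a i.+1.*2 @[a --> +oo] --> TJ i.+1 &
      ya a (T a i.+1.*2) @[a --> +oo] --> sgk i.+1 * yJ (TJ i.+1)].
  have TY i : T a i.*2 @[a --> +oo] --> TJ i /\
      ya a (T a i.*2) @[a --> +oo] --> sgk i * yJ (TJ i).
    elim: i => [|i [h1 h2]]; last by have [] := step i h1 h2.
    rewrite (chain_T0 chJ); split.
      under eq_fun do rewrite double0 (chain_T0 (chY _)); exact: cvg_cst.
    case: bes => g [_ _ ->]; rewrite /sgk expr0 mulr1.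
    under eq_fun do rewrite double0 (chain_T0 (chY _)) profile0; exact: cvg_cst.
  by have [h1 h2] := TY j; have [h3 h4 _ _] := step j h1 h2.
move=> hT hy.
have hp : pa a (T a i.*2) @[a --> +oo] --> sgk i * pJ (TJ i).
  rewrite (chain_pT oscJ chJ) mulr0.
  under eq_fun do rewrite (chain_pT (oscY _) (chY _)); exact: cvg_cst.
have pos1 : \forall a \near +oo, 0 <= T a i.*2 /\
    forall t, T a i.*2 <= t <= X a i.*2 -> 0 <= ya a t.
  near=> a; split; first exact: chain_T_ge0 (chY a) _.
  move=> t /andP[Tt]; rewrite le_eqVlt => /predU1P[->|tX].
    by rewrite (chain_yX (chY a)).
  have := @chain_y_pos _ _ _ _ _ (chY a) i.*2 t; rewrite Tt tX sg2 mul1r => /(_ erefl).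
  exact: ltW.
(* From the maximum down to the zero, where [y >= 0]. *)
have close1 := profile_near_bessel bes hT pos1 hy hp.
have hX : X a i.*2 @[a --> +oo] --> XJ i.
  apply: (@hitting_time_cvg _ _ _ _ (fun t => sgk i * yJ t) (TJ i) (XJ i) (XJ i + 1)
    (fun a => ya a) (fun a => T a i.*2)) => //.
  - exact: chain_TX chJ i.
  - by rewrite ltrDl.
  - by move=> t; exact: chain_y_pos chJ i t.
  - move=> e e0; pose m := Num.min (XJ i + e / 2) (TJ i.+1).
    have h1 : m <= XJ i + e / 2 by rewrite ge_min lexx.
    have h2 : m <= TJ i.+1 by rewrite ge_min lexx orbT.
    have h3 : XJ i < m by rewrite lt_min (chain_XT chJ i) andbT; lra.
    exists m; first by rewrite h3; lra.
    by apply: (chain_y_neg chJ); rewrite h3.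
  - near=> a; split; first exact/ltW/(chain_TX (chY a)).
      by rewrite (chain_yX (chY a)).
    by move=> t; have := @chain_y_pos _ _ _ _ _ (chY a) i.*2 t; rewrite sg2 mul1r.
  - move=> e e0; apply: filterS (close1 (XJ i + 1) e e0) => a h t h1 h2.
    exact: (h t h1 h2).1.
pose m0 := - (sgk i * pJ (XJ i)).
have m00 : 0 < m0.
  rewrite oppr_gt0; apply: (chain_p_neg chJ).
  by rewrite (chain_TX chJ) (chain_XT chJ).
have hpX : pa a (X a i.*2) @[a --> +oo] --> - m0.
  rewrite /m0 opprK; apply: (@cvg_diff0 _ (fun a => sgk i * pJ (X a i.*2))).
    exact: (@cvg_comp _ _ _ (fun a => X a i.*2) (fun t => sgk i * pJ t) _ _ _ hX (csJ' i (XJ i))).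
  move=> e e0; have c1 := close1 (XJ i + 1) e e0; have c2 := near_lt _ _ hX.
  near=> a; have h1 : X a i.*2 <= XJ i + 1 by near: a.
  have h2 : forall t, T a i.*2 <= t <= X a i.*2 -> t <= XJ i + 1 ->
    `|ya a t - sgk i * yJ t| < e /\ `|pa a t - sgk i * pJ t| < e by near: a.
  by apply: (h2 _ _ h1).2; rewrite lexx andbT ltW// (chain_TX (chY a)).
have XJ0 := chain_X_gt0 chJ i.
have even2 : ~~ odd i.*2 by rewrite odd_double.
have [hX' hpX'] := bounce_cvg even2 XJ0 m00 hX hpX.
have m0E : m0 = sgk i.+1 * pJ (XJ i) by rewrite sgkS.
rewrite m0E in hpX'.
have hyX' : ya a (X a i.*2.+1) @[a --> +oo] --> sgk i.+1 * yJ (XJ i).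
  rewrite (chain_yX chJ) mulr0.
  under eq_fun do rewrite (chain_yX (chY _)); exact: cvg_cst.
(* After the bounce the speed is reversed, hence the sign [sgk i.+1]. *)
have sg21 (u : R) : sgk i.*2.+1 * u = - u by rewrite sgkS sg2 mul1r.
have pos2 : \forall a \near +oo, 0 <= X a i.*2.+1 /\
    forall t, X a i.*2.+1 <= t <= T a i.+1.*2 -> 0 <= ya a t.
  near=> a; split; first exact/ltW/(chain_X_gt0 (chY a)).
  move=> t /andP[]; rewrite le_eqVlt => /predU1P[<-|Xt] tT.
    by rewrite (chain_yX (chY a)).
  rewrite -oppr_le0 -sg21 ltW//; apply: (chain_y_neg (chY a)); by rewrite Xt.
have close2 := profile_near_bessel bes hX' pos2 hyX' hpX'.
have T12 := chain_ltTS chJ i.+1.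
have hT' : T a i.+1.*2 @[a --> +oo] --> TJ i.+1.
  apply: (@hitting_time_cvg _ _ _ _ (fun t => sgk i.+1 * pJ t) (XJ i) (TJ i.+1) (TJ i.+1 + 1)
    (fun a => pa a) (fun a => X a i.*2.+1)) => //.
  - exact: chain_XT chJ i.
  - by rewrite ltrDl.
  - move=> t /andP[Xt tT]; rewrite sgkS oppr_gt0; apply: (chain_p_neg chJ).
    by rewrite tT andbT (lt_le_trans (chain_TX chJ i)).
  - move=> e e0; pose m := Num.min (TJ i.+1 + e / 2) ((TJ i.+1 + TJ i.+2) / 2).
    have h1 : m <= TJ i.+1 + e / 2 by rewrite ge_min lexx.
    have h2 : m <= (TJ i.+1 + TJ i.+2) / 2 by rewrite ge_min lexx orbT.
    have h3 : TJ i.+1 < m by rewrite lt_min; apply/andP; split; lra.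
    exists m; first by rewrite h3; lra.
    by apply: (chain_p_neg chJ); rewrite h3; lra.
  - near=> a; split; first exact/ltW/(chain_XT (chY a)).
      by rewrite (chain_pT (oscY a) (chY a)).
    move=> t /andP[Xt tT]; rewrite -oppr_lt0 -sg21; apply: (chain_p_neg (chY a)).
    by rewrite tT andbT (lt_le_trans (chain_TX (chY a) _)).
  - move=> e e0; apply: filterS (close2 (TJ i.+1 + 1) e e0) => a h t h1 h2.
    exact: (h t h1 h2).2.
split=> //.
apply: (@cvg_diff0 _ (fun a => sgk i.+1 * yJ (T a i.+1.*2))).
  exact: (@cvg_comp _ _ _ (fun a => T a i.+1.*2) (fun t => sgk i.+1 * yJ t) _ _ _ hT' (csJ i.+1 (TJ i.+1))).
move=> e e0; have c1 := close2 (TJ i.+1 + 1) e e0; have c2 := near_lt _ _ hT'.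
near=> a; have h1 : T a i.+1.*2 <= TJ i.+1 + 1 by near: a.
have h2 : forall t, X a i.*2.+1 <= t <= T a i.+1.*2 -> t <= TJ i.+1 + 1 ->
  `|ya a t - sgk i.+1 * yJ t| < e /\ `|pa a t - sgk i.+1 * pJ t| < e by near: a.
by apply: (h2 _ _ h1).1; rewrite lexx andbT ltW// (chain_XT (chY a)).
Unshelve. all: by end_near. Qed.

(** For odd [k] the critical point is the minimum of a bounce, caught between two
    zeros that merge. *)
Lemma crit_large_cvg k : crit a k @[a --> +oo] -->
  (if odd k then XJ k./2 else TJ k./2).
Proof.
have [h1 _ h2 h3] := large_amplitude k./2.
move: h1 h2 h3 (odd_double_half k); move: k./2 => j h1 h2 h3.
case: (odd k) => <-; last by rewrite add0n.
rewrite add1n.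
apply: (squeeze_cvgr _ h2 h3); near=> a; have chY := wavesP a.
by rewrite !ltW// ?(chain_XT chY) ?(chain_TX chY).
Unshelve. all: by end_near. Qed.

End Limit.

(** * Bessel's function *)

Section Bessel.
Context {R : realType}.
Implicit Types (g y p : R -> R) (a b t s v : R).

Lemma radial_solution_scale c g y p : radial_solution g y p ->
  radial_solution (fun t => c ^+ 2 * g (c * t)) (fun t => y (c * t))
    (fun t => c * p (c * t)).
Proof.
move=> [dy cp p0 dF].
have dc (t : R) : is_derive t 1 (fun t => c * t) c by deriv; ring.
split.
- move=> t; have := @has_deriv_comp _ y (fun t => c * t) t _ _ (dy (c * t)) (dc t).
  by rewrite mulrC.
- move=> t; have h := has_deriv_continuous (dc t).
  apply: (cont_mul (@cont_cst _ c t) _).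
  exact: (@continuous_comp _ _ _ (fun t => c * t) p t h (cp (c * t))).
- by rewrite mulr0 p0 mulr0.
- move=> t; have := @has_deriv_comp _ _ (fun t => c * t) t _ _ (dF (c * t)) (dc t).
  have -> : (fun t => c * t * p (c * t)) = (fun s => s * (c * p (c * s))).
    by apply/funext => s; ring.
  by move/has_deriv_eq; apply; ring.
Qed.

Lemma radial_solution_uniq c y1 p1 g1 y2 p2 g2 : 0 <= c ->
  radial_solution g1 y1 p1 -> radial_solution g2 y2 p2 ->
  (forall t, 0 <= t -> g1 t = c * y1 t) -> (forall t, 0 <= t -> g2 t = c * y2 t) ->
  y1 0 = y2 0 -> forall t, 0 <= t -> y1 t = y2 t /\ p1 t = p2 t.
Proof.
move=> c0 s1 s2 h1 h2 y0 t t0.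
have h u : 0 < u < t -> `|g1 u - g2 u| <= c * `|y1 u - y2 u| + 0.
  move=> /andP[/ltW u0 _]; rewrite addr0 h1// h2// -mulrBr normrM.
  by rewrite (ger0_norm c0).
have := radial_solution_comparison s1 s2 (lexx 0) t0 c0 (lexx 0) h.
have [_ _ p10 _] := s1; have [_ _ p20 _] := s2.
rewrite y0 p10 p20 !subrr expr0n /= !(add0r, mul0r) => e.
have e1 := sqr_ge0 (y1 t - y2 t); have e2 := sqr_ge0 (p1 t - p2 t).
by split; apply/eqP; rewrite -subr_eq0 -sqrf_eq0 eq_le ?e1 ?e2 andbT; lra.
Qed.

Definition bessel_term (m : nat) t : R :=
  (-1) ^+ m / m`!%:R ^+ 2 * (t / 2) ^+ (2 * m).

(** It follows that a partial sum of the series solves Bessel's equation with the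
    previous partial sum as source. *)
Lemma bessel_term_radial m : radial_solution (bessel_term m) (bessel_term m.+1)
  (fun t => - ((-1) ^+ m / (m`!%:R ^+ 2 * m.+1%:R)) * (t / 2) ^+ (2 * m).+1).
Proof.
have f0 : m`!%:R != 0 :> R by rewrite pnatr_eq0 -lt0n fact_gt0.
have m0 : m.+1%:R != 0 :> R by rewrite pnatr_eq0.
have e2 : (2 * m.+1 = (2 * m).+2)%N by rewrite mulnS.
have eS (x : R) n : x ^+ n.+1 = x * x ^+ n by rewrite exprS.
have n2 : (2 * m).+2%:R = 2 * m.+1%:R :> R by rewrite -e2 natrM.
split.
- move=> t; rewrite /bessel_term e2 factS natrM.
  deriv; rewrite n2 ![(-1) ^+ m.+1]exprS.
  move: f0 m0; move: (m`!%:R : R) (m.+1%:R : R) ((-1) ^+ m) (_ ^+ (2 * m).+1).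
  by move=> F N c z F0 N0; field; rewrite F0 N0.
- move=> t; have dt := has_deriv_mul (has_deriv_id t) (has_deriv_cst 2^-1 t).
  exact: (has_deriv_continuous (has_deriv_mul (has_deriv_cst _ t)
    (has_deriv_pow (2 * m) dt))).
- by rewrite mul0r expr0n mulr0.
- move=> t; rewrite /bessel_term.
  have -> : (fun s => s * (- ((-1) ^+ m / (m`!%:R ^+ 2 * m.+1%:R)) * (s / 2) ^+ (2 * m).+1)) =
     (fun s => - (2 * (-1) ^+ m / (m`!%:R ^+ 2 * m.+1%:R)) * (s / 2) ^+ (2 * m).+2).
    apply/funext => s; rewrite [(s / 2) ^+ (2 * m).+2]exprS.
    move: f0 m0; move: (m`!%:R : R) (m.+1%:R : R) ((-1) ^+ m) (_ ^+ (2 * m).+1).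
    by move=> F N c z F0 N0; field; rewrite F0 N0.
  deriv; rewrite [(t / 2) ^+ (2 * m).+1]exprS n2.
  move: f0 m0; move: (m`!%:R : R) (m.+1%:R : R) ((-1) ^+ m) (_ ^+ (2 * m)).
  by move=> F N c z F0 N0; field; rewrite F0 N0.
Qed.

Lemma bessel_partial_radial n : exists p,
  radial_solution (fun t => series (bessel_term ^~ t) n)
    (fun t => series (bessel_term ^~ t) n.+1) p.
Proof.
elim: n => [|n [p IH]].
  exists (fun=> 0); split.
  - move=> t; rewrite (_ : (fun t => _) = (fun=> 1)); first exact: has_deriv_cst.
    apply/funext => u; rewrite /series /= big_nat1 /bessel_term.
    by rewrite expr0 fact0 muln0 expr0 mulr1 expr1n divr1.
  - by move=> t; exact: cont_cst.
  - by [].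
  - move=> t; rewrite /series /= big_geq// mulr0 oppr0.
    under eq_fun do rewrite mulr0; exact: has_deriv_cst.
have := radial_solution_lincomb 1 1 IH (bessel_term_radial n).
set q := fun t => 1 * p t + _ => h; exists q; move: h.
have e (f1 f2 : R -> R) : (fun t => 1 * f1 t + 1 * f2 t) = (fun t => f1 t + f2 t).
  by apply/funext => t; rewrite !mul1r.
rewrite !e.
have eS m : (fun t => series (bessel_term ^~ t) m + bessel_term m t) =
    (fun t => series (bessel_term ^~ t) m.+1).
  by apply/funext => t; rewrite /series /= big_nat_recr.
by rewrite !eS.
Qed.

Lemma bessel_term_bound m t M : 0 <= t <= M ->
  `|bessel_term m t| <= exp_coeff ((M / 2) ^+ 2) m.
Proof.
move=> /andP[t0 tM]; rewrite /bessel_term /exp_coeff /= !normrM normfV normrX normrN1 expr1n mul1r.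
have f1 : 1 <= m`!%:R :> R by rewrite ler1n fact_gt0.
have t2 : 0 <= t / 2 by rewrite divr_ge0.
rewrite -exprM (ger0_norm (exprn_ge0 _ t2)) mulrC.
rewrite ger0_norm ?invr_ge0 ?sqr_ge0//; apply: ler_pM.
- exact: exprn_ge0.
- by rewrite invr_ge0 sqr_ge0.
- rewrite lerXn2r ?nnegrE//; lra.
- rewrite lef_pV2 ?posrE ?exprn_gt0//; try lra.
  by rewrite expr2 ler_peMl//; lra.
Qed.

(** Two successive partial sums differ by a term of an exponential series, so the
    partial sums are solutions up to an error that tends to [0], and
    [radial_solution_comparison] applies. *)
Lemma Bessel_J0E y p t : bessel_solution y p -> 0 <= t -> Bessel_J0 t = y t.
Proof.
move=> [g [s gE y0]] t0; apply: cvg_lim => //.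
rewrite -(cvg_shiftS (series _)).
pose K := t * expR ((1 + 2) * t).
have K0 : 0 <= K by rewrite mulr_ge0// expR_ge0.
pose c n := exp_coeff ((t / 2) ^+ 2) n.
have c0 n : 0 <= c n by apply: exp_coeff_ge0; exact: sqr_ge0.
have bd n : (series (bessel_term ^~ t) n.+1 - y t) ^+ 2 <= c n ^+ 2 * K.
  have [q sq] := bessel_partial_radial n.
  have h u : 0 < u < t -> `|series (bessel_term ^~ u) n - g u| <=
      1 * `|series (bessel_term ^~ u) n.+1 - y u| + c n.
    move=> /andP[/ltW u0 /ltW ut]; rewrite gE// mul1r.
    have -> : series (bessel_term ^~ u) n - y u =
      series (bessel_term ^~ u) n.+1 - y u - bessel_term n u.
      by rewrite [in RHS]/series /= big_nat_recr//= /series /=; ring.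
    apply: le_trans (ler_normB _ _) _; rewrite lerD2l.
    by apply: bessel_term_bound; rewrite u0.
  have := radial_solution_comparison sq s (lexx 0) t0 ler01 (c0 n) h.
  have [_ _ -> _] := sq; have [_ _ -> _] := s.
  have -> : series (bessel_term ^~ 0) n.+1 = 1.
    rewrite /series /= big_nat_recl//= big1_seq ?addr0.
      by rewrite /bessel_term muln0 !expr0 fact0 mulr1 expr1n divr1.
    by move=> m _; rewrite /bessel_term mul0r mulnS expr0n mulr0.
  rewrite y0 !subrr expr0n /= !add0r subr0 /K mulrA => cmp.
  by have := sqr_ge0 (q t - p t); lra.
have c_cvg : c n @[n --> \oo] --> 0.
  by apply: cvg_series_cvg_0; exact: is_cvg_series_exp_coeff.
apply/cvgrPdist_lt => e e0.
have eK : 0 < e / (K + 1) by rewrite divr_gt0//; lra.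
move/cvgrPdist_lt : c_cvg => /(_ _ eK); apply: filterS => n /=.
rewrite sub0r normrN ger0_norm// ltr_pdivlMr; last by lra.
move=> cn; rewrite distrC ltNge; apply/negP => le_e.
have := bd n; have := c0 n; move: (c n) cn => d cn d0.
set u := _ - y t in le_e *; rewrite -(real_normK (num_real u)) => h1.
have : e ^+ 2 <= `|u| ^+ 2 by rewrite lerXn2r ?nnegrE// ltW.
have : (d * (K + 1)) ^+ 2 < e ^+ 2.
  by rewrite ltrXn2r ?nnegrE ?mulr_ge0 ?(ltW e0)//; lra.
have -> : (d * (K + 1)) ^+ 2 = d ^+ 2 * K + (d ^+ 2 * K ^+ 2 + d ^+ 2 * K + d ^+ 2) by ring.
have : 0 <= d ^+ 2 * K ^+ 2 + d ^+ 2 * K + d ^+ 2.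
  by rewrite !addr_ge0 ?mulr_ge0 ?sqr_ge0.
by lra.
Qed.

Lemma Bessel_J0'E y p t : bessel_solution y p -> 0 < t ->
  derive1 Bessel_J0 t = p t.
Proof.
move=> bes t0; rewrite derive1E.
have [g [[dy _ _ _] _ _]] := bes.
have [_ <-] := dy t; apply: near_eq_derive; near=> u.
by apply/(Bessel_J0E bes)/ltW; near: u; exact: lt_nbhsr.
Unshelve. all: by end_near. Qed.

Section Eigenvalues.
Variables (yJ pJ : R -> R) (XJ TJ : nat -> R).
Hypotheses (bes : bessel_solution yJ pJ) (chJ : wave_chain yJ pJ XJ TJ).

(** [XJ] starts with the first zero, whereas [TJ 0] is the trivial critical point. *)
Lemma nu_E r k : nu_ r k.+1 = (XJ k / r) ^+ 2.
Proof.
rewrite /nu_ (@pos_zero_chain _ _ XJ)//; first exact: chain_ltX chJ.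
move=> i; rewrite -(chain_zeros_le chJ); apply/seteqP.
by split=> t /= [/andP[t0 tX]]; rewrite (Bessel_J0E bes (ltW t0)) t0 tX.
Qed.

Lemma mu_E r k : mu_ r k.+1 = (TJ k.+1 / r) ^+ 2.
Proof.
rewrite /mu_ (@pos_zero_chain _ _ (TJ \o succn))//.
  by move=> i j ij; exact: (chain_ltT chJ).
move=> i; rewrite -(chain_crits (bessel_oscillator bes) chJ); apply/seteqP.
by split=> t /= [/andP[t0 tX]]; rewrite (Bessel_J0'E bes t0) t0 tX.
Qed.

(** The linear equation at [a = 0] is solved by [J_0 (sqrt 2 t)]: this factor is
    the reason why the branch starts at half an eigenvalue. *)
Lemma crit0 k : (0 < k)%N -> crit 0 k = TJ k / Num.sqrt 2.
Proof.
move=> k0; have [g [s gE y0 _]] := profileP (0 : R).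
have [gJ [sJ gJE yJ0]] := bes.
have q0 : 0 < Num.sqrt 2 :> R by rewrite sqrtr_gt0.
have q2 : Num.sqrt 2 ^+ 2 = 2 :> R by rewrite sqr_sqrtr.
have sc := radial_solution_scale (Num.sqrt 2) sJ.
have hs t : 0 <= t -> g t = 2 * (profile 0).1 t.
  by move=> t0; rewrite gE// normr0 mul0r addr0 divr1; ring.
have hJ t : 0 <= t -> Num.sqrt 2 ^+ 2 * gJ (Num.sqrt 2 * t) = 2 * yJ (Num.sqrt 2 * t).
  by move=> t0; rewrite gJE ?mulr_ge0 ?sqrtr_ge0// q2.
have e0 : (profile 0).1 0 = yJ (Num.sqrt 2 * 0) by rewrite mulr0 yJ0.
have eq := radial_solution_uniq (ler0n _ 2) s sc hs hJ e0.
have T0 : 0 < TJ k by rewrite -(chain_T0 chJ) (chain_ltT chJ).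
have S0 : 0 < TJ k / Num.sqrt 2 by rewrite divr_gt0.
have ST : Num.sqrt 2 * (TJ k / Num.sqrt 2) = TJ k by field; rewrite gt_eqF.
apply/esym; apply: (chain_crit_unique (profile_oscillator 0) (wavesP 0) S0).
  by rewrite (eq _ (ltW S0)).2 ST (chain_pT (bessel_oscillator bes) chJ) mulr0.
have -> : [set t | 0 < t < TJ k / Num.sqrt 2 /\ (profile 0).1 t = 0] =
    (fun i => XJ i / Num.sqrt 2) @` `I_k.
  transitivity ((fun x => x / Num.sqrt 2) @` (XJ @` `I_k)); last by rewrite image_comp.
  rewrite -(chain_zeros chJ); apply/seteqP; split=> t /=.
    move=> [/andP[t0 tT] yt]; exists (Num.sqrt 2 * t); last by field; rewrite gt_eqF.
    by rewrite mulr_gt0//= -(eq _ (ltW t0)).1 -ltr_pdivlMl// mulrC.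
  move=> [u [/andP[u0 uT] yu] <-]; have t0 : 0 < u / Num.sqrt 2 by rewrite divr_gt0.
  rewrite t0 ltr_pM2r ?invr_gt0// uT (eq _ (ltW t0)).1; split=> //.
  by rewrite mulrC divfK ?gt_eqF.
by apply: increasing_card => i j ij; rewrite ltr_pM2r ?invr_gt0// (chain_ltX chJ).
Qed.

End Eigenvalues.
End Bessel.

(** * The energy space *)

Section EnergySpace.
Context {R : realType} (r : R) (r0 : 0 < r).
Notation mu := (@lebesgue_measure R).
Implicit Types (w g h : R -> R) (u v : radialE r).

Lemma C1_weak_derivative w g : (forall t : R, is_derive t 1 w (g t)) ->
  continuous g -> is_weak_derivative r w g.
Proof.
move=> dw cg a b a0 ab br.
have cgab : {within `[a, b], continuous g} by exact: continuous_subspaceT.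
split.
  by apply: continuous_compact_integrable => //; exact: segment_compact.
move: ab; rewrite le_eqVlt => /predU1P[<-|ab].
  by rewrite subrr set_itv1 Rintegral_set1.
have cw t : {for t, continuous w} by exact: has_deriv_continuous (dw t).
have := @continuous_FTC2 _ g w a b ab cgab.
rewrite /Rintegral => -> //.
  split.
  - by move=> t _; case: (dw t).
  - exact: cvg_at_right_filter (cw a).
  - exact: cvg_at_left_filter (cw b).
by move=> t _; rewrite derive1E; case: (dw t).
Qed.

Lemma bound_ge0 g B : (forall t, 0 <= t <= r -> `|g t| <= B) -> 0 <= B.
Proof.
by move=> gB; apply: le_trans (normr_ge0 (g 0)) (gB 0 _); rewrite lexx ltW.
Qed.

Lemma wL2_bounded g B : measurable_fun `[0, r] g ->
  (forall t, 0 <= t <= r -> `|g t| <= B) -> wL2 r g.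
Proof.
move=> mg gB; split=> //.
have B0 := bound_ge0 gB.
apply: (@le_lt_trans _ _ (\int[mu]_(x in `[0%R, r]) ((r * B ^+ 2)%:E))%E).
  apply: ge0_le_integral => //.
  - by move=> x /=; rewrite in_itv/= lee_fin => /andP[x0 _]; rewrite mulr_ge0 ?sqr_ge0.
  - apply/measurable_EFinP; apply: measurable_funM => //.
    exact: (@measurable_funX _ _ _ _ g).
  - move=> x /=; rewrite in_itv/= lee_fin => /andP[x0 xr].
    apply: ler_pM => //; first exact: sqr_ge0.
    rewrite -(real_normK (num_real (g x))) lerXn2r ?nnegrE//.
    by apply: gB; rewrite x0.
rewrite integral_cst//= lebesgue_measure_itv/=.
by case: ifP => _; rewrite ?mule0// -EFinB -EFinM ltry.
Qed.

Lemma wdot_bounded g B : measurable_fun `[0, r] g ->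
  (forall t, 0 <= t <= r -> `|g t| <= B) -> wdot r g g <= (r * B) ^+ 2.
Proof.
move=> mg gB; have lg := wL2_bounded mg gB.
have mr : mu `[0, r]%classic = r%:E.
  by rewrite lebesgue_measure_itv/= lte_fin r0 -EFinB subr0.
have -> : (r * B) ^+ 2 = \int[mu]_(t in `[0, r]) (r * B ^+ 2).
  by rewrite Rintegral_cst//= lebesgue_measure_itv/= lte_fin r0 /= subr0; ring.
apply: le_Rintegral => //.
- exact: wL2_prod_integrable.
- apply: measurable_bounded_integrable => //; first by rewrite [X in (X < _)%E]mr ltry.
  exact: bounded_cst.
- move=> x /=; rewrite in_itv/= => /andP[x0 xr].
  rewrite -mulrA; apply: ler_pM => //; first by rewrite -expr2 sqr_ge0.
  rewrite -expr2 -(real_normK (num_real (g x))) lerXn2r ?nnegrE//.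
    exact: bound_ge0 gB.
  by apply: gB; rewrite x0.
Qed.

Lemma radialE_norm_le u g B : is_weak_derivative r u g ->
  (forall t, 0 <= t <= r -> `|u t| <= B) ->
  (forall t, 0 <= t <= r -> `|g t| <= B) -> radialE_norm u <= 2 * (r * B).
Proof.
move=> ug uB gB; rewrite (radialE_normE ug).
have h1 := wdot_bounded (weak_derivative_measurable ug) gB.
have h2 := wdot_bounded (weak_derivative_id_measurable ug) uB.
have B0 := bound_ge0 uB.
have rB : 0 <= r * B by rewrite mulr_ge0// ltW.
have -> : 2 * (r * B) = Num.sqrt ((2 * (r * B)) ^+ 2).
  by rewrite sqrtr_sqr ger0_norm// mulr_ge0.
rewrite ler_sqrt ?sqr_ge0//; have := sqr_ge0 (r * B).
by rewrite [(2 * _) ^+ 2]exprMn; lra.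
Qed.

Lemma radialE_dist_le u v g h B : is_weak_derivative r u g ->
  is_weak_derivative r v h ->
  (forall t, 0 <= t <= r -> `|u t - v t| <= B) ->
  (forall t, 0 <= t <= r -> `|g t - h t| <= B) ->
  radialE_norm (u - v) <= 2 * (r * B).
Proof.
move=> ug vh uvB ghB.
have E (f1 f2 : R -> R) t : (-1 *: f1 + f2) t = f2 t - f1 t.
  by change (-1 * f1 t + f2 t = f2 t - f1 t); ring.
have uvE : (u - v : radialE r) = -1 *: (v : R -> R) + u :> (R -> R).
  by apply/funext => t; rewrite E.
apply: (@radialE_norm_le (u - v) (-1 *: h + g)).
- by rewrite uvE; exact: is_weak_derivativeD.
- by move=> t tr; rewrite uvE E uvB.
- by move=> t tr; rewrite E ghB.
Qed.

(** Only the values on [0, r] enter the norm. *)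
Lemma radialE_dist0 u v : (forall t, 0 <= t <= r -> u t = v t) ->
  radialE_norm (u - v) = 0.
Proof.
move=> uv; have ud := radialE_is_weak_derivative u.
have vd : is_weak_derivative r v (weak_derivative r u).
  move=> a b a0 ab br; have [i e] := ud a b a0 ab br; split=> //.
  by rewrite -e !uv// ltW//= ?(le_trans ab) ?(lt_le_trans a0).
apply/eqP; rewrite eq_le sqrtr_ge0 andbT.
rewrite -[leRHS](mulr0 2) -[X in _ * X](mulr0 r).
by apply: radialE_dist_le ud vd _ _ => t tr; rewrite ?uv// subrr normr0.
Qed.

(** The weight is at least [c / 2] on the upper half of [0, c]. *)
Lemma radialE_norm_ge u (c m : R) : 0 < c -> c <= r -> 0 <= m ->
  (forall t, 0 <= t <= c -> m <= u t) -> c / 2 * m <= radialE_norm u.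
Proof.
move=> c0 cr m0 um.
have lu := radialE_wL2 u; have iu := wL2_prod_integrable lu lu.
have c2 : 0 < c / 2 by rewrite divr_gt0.
have c2c : c / 2 < c by lra.
have mc : mu `[c / 2, c]%classic = (c / 2)%:E.
  by rewrite lebesgue_measure_itv/= lte_fin c2c -EFinB; congr EFin; lra.
have sub : `[c / 2, c]%classic `<=` `[0, r]%classic.
  by move=> t /=; rewrite !in_itv/= => /andP[h1 h2]; apply/andP; split; lra.
have key : (c / 2 * m) ^+ 2 <= wdot r u u.
  have -> : (c / 2 * m) ^+ 2 = \int[mu]_(t in `[c / 2, c]) (c / 2 * m ^+ 2).
    rewrite Rintegral_cst// [fine _](_ : _ = c / 2); first by ring.
    exact: (congr1 fine mc).
  apply: (@le_trans _ _ (\int[mu]_(t in `[c / 2, c]) (t * u t * u t))).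
    apply: le_Rintegral => //.
    - apply: measurable_bounded_integrable => //; first by rewrite [X in (X < _)%E]mc ltry.
      exact: bounded_cst.
    - exact: integrableS iu.
    - move=> t /=; rewrite in_itv/= => /andP[h1 h2].
      have -> : t * u t * u t = t * u t ^+ 2 by ring.
      apply: ler_pM => //; [exact: ltW|exact: sqr_ge0|].
      have mt : m <= u t by apply: um; rewrite h2 andbT; lra.
      by rewrite lerXn2r ?nnegrE// (le_trans m0).
  rewrite -lee_fin /wdot /Rintegral !fineK; [|exact: integrable_fin_num|].
    apply: ge0_subset_integral => //.
    - by case/integrableP : iu.
    - move=> t /=; rewrite in_itv/= lee_fin => /andP[t0 _].
      by rewrite -mulrA -expr2 mulr_ge0 ?sqr_ge0.
  by apply: integrable_fin_num => //; exact: integrableS iu.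
rewrite /radialE_norm /radialE_dot -[leLHS]ger0_norm; last first.
  by rewrite mulr_ge0// ltW.
rewrite -sqrtr_sqr ler_sqrt; last by rewrite addr_ge0 ?wdot_ge0.
by apply: le_trans key _; rewrite lerDr wdot_ge0.
Qed.

Lemma C1_finite_energy w g : (forall t : R, is_derive t 1 w (g t)) ->
  continuous g -> w \in finite_energy_pred r.
Proof.
move=> dw cg; have wg := C1_weak_derivative dw cg.
rewrite inE; exists g => //.
have [|B _ hB] := @EVT_max _ (fun t => `|g t|) 0 r (ltW r0).
  apply: continuous_within => t _.
  apply: (@continuous_comp _ _ _ g (fun x => `|x|)); first exact: cg.
  exact: norm_continuous.
have [] // := @wL2_bounded g `|g B| (weak_derivative_measurable wg).
Qed.

End EnergySpace.

(** * The branch of solutions *)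

Section Branch.
Context {R : realType} (r : R) (hr : 0 < r) (k : nat) (hk : (0 < k)%N).
Implicit Types (a t : R).
Notation ya a := (profile a).1.
Notation pa a := (profile a).2.

(** By compactness of [0, M], the joint continuity of [f (c a * t)] in [(a, t)] is
    uniform in [t]. *)
Lemma dilation_close (f : R -> R) (c : R -> R) a0 M : continuous f ->
  {for a0, continuous c} -> forall e, 0 < e ->
  \forall a \near a0, forall t, 0 <= t <= M -> `|f (c a * t) - f (c a0 * t)| < e.
Proof.
move=> cf cc e e0.
have cpt : compact `[0, M]%classic by exact: segment_compact.
have /compact_near_coveringP cov := cpt.
have := @cov R (nbhs a0) (fun a t => `|f (c a * t) - f (c a0 * t)| < e) _.
have H : forall x : R, `[0, M]%classic x -> \forall x' \near x & a \near a0,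
    `|f (c a * x') - f (c a0 * x')| < e.
  move=> x _; have e2 : 0 < e / 2 by rewrite divr_gt0.
  have [d d0 hd] := (continuousP f (c a0 * x)).1 (cf _) _ e2.
  pose d1 := d / (2 * (`|x| + 1)); pose d2 := d / (2 * (`|c a0| + 1)).
  have x1 : 0 < `|x| + 1 by have := normr_ge0 x; lra.
  have c1 : 0 < `|c a0| + 1 by have := normr_ge0 (c a0); lra.
  have d10 : 0 < d1 by rewrite divr_gt0// mulr_gt0.
  have d20 : 0 < d2 by rewrite divr_gt0// mulr_gt0.
  have near1 : \forall x' \near x, `|x' - x| < d2.
    by exists d2 => // x' /=; rewrite distrC.
  have near1' : \forall x' \near x, `|x' - x| < 1.
    by exists 1; [exact: ltr01|move=> x' /=; rewrite distrC].
  have near2 : \forall a \near a0, `|c a - c a0| < d1.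
    have [d' d'0 hd'] := (continuousP c a0).1 cc _ d10.
    by exists d' => // a /= h; apply: hd'; rewrite distrC.
  near=> x' a.
  have h1 : `|x' - x| < d2 by near: x'.
  have h1' : `|x' - x| < 1 by near: x'.
  have h2 : `|c a - c a0| < d1 by near: a.
  have k1 : `|c a0 * x' - c a0 * x| < d / 2.
    rewrite -mulrBr normrM; apply: (@le_lt_trans _ _ ((`|c a0| + 1) * `|x' - x|)).
      by rewrite ler_wpM2r//; lra.
    rewrite -ltr_pdivlMl//; apply: (lt_le_trans h1); rewrite /d2.
    by rewrite le_eqVlt; apply/orP; left; apply/eqP; field; rewrite gt_eqF.
  have k2 : `|c a * x' - c a0 * x'| < d / 2.
    have xx : `|x'| <= `|x| + 1 by have := ler_distD x x' 0; rewrite !subr0; lra.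
    rewrite -mulrBl normrM; apply: (@le_lt_trans _ _ (`|c a - c a0| * (`|x| + 1))).
      by rewrite ler_wpM2l.
    rewrite -ltr_pdivlMr//; apply: (lt_le_trans h2); rewrite /d1.
    by rewrite le_eqVlt; apply/orP; left; apply/eqP; field; rewrite gt_eqF.
  have j1 : `|f (c a0 * x') - f (c a0 * x)| < e / 2 by apply: hd; lra.
  have j2 : `|f (c a * x') - f (c a0 * x)| < e / 2.
    by apply: hd; have := ler_distD (c a0 * x') (c a * x') (c a0 * x); lra.
  have := ler_distD (f (c a0 * x)) (f (c a * x')) (f (c a0 * x')).
  by rewrite [`|f (c a0 * x) - _|]distrC; lra.
move=> /(_ _ H); apply: filterS => a ha t t0M; apply: ha.
by rewrite /= in_itv.
Unshelve. all: by end_near. Qed.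

Lemma dilation_deriv a c (x : R) : c != 0 ->
  is_derive x 1 (fun x => a / c * ya a (c * x)) (a * pa a (c * x)).
Proof.
move=> c0; have dc : is_derive x 1 (fun x => c * x) c by deriv; ring.
have dy := oscillator_deriv (profile_oscillator a) (c * x).
have := @has_deriv_comp _ (ya a) (fun x => c * x) x _ _ dy dc.
set f := fun x => ya a (c * x) => df.
change (is_derive x 1 (fun x => a / c * f x) (a * pa a (c * x))).
by deriv; field.
Qed.

(** The value of [sqrt lambda] that brings the [k]-th critical point of the profile
    to the boundary of the disc. *)
Definition wavenumber a : R := crit a k / r.
Notation kap := wavenumber.

(** Undoing the change of variables [sqrt lambda * w x = a * y (sqrt lambda * x)]. *)
Definition branch_fun a (x : R) : R := a / kap a * ya a (kap a * x).
Definition branch_deriv a (x : R) : R := a * pa a (kap a * x).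

Lemma crit_gt0 a : 0 < crit a k.
Proof. by have ch := wavesP a; rewrite /crit -(chain_T0 ch) (chain_ltT ch). Qed.

Lemma wavenumber_gt0 a : 0 < kap a.
Proof. by rewrite divr_gt0// crit_gt0. Qed.

Lemma wavenumber_continuous : continuous kap.
Proof.
move=> a; exact: (cont_mul (@crit_continuous _ k a) (@cont_cst _ r^-1 a)).
Qed.

Lemma branch_fun_deriv a t : is_derive t 1 (branch_fun a) (branch_deriv a t).
Proof. exact: dilation_deriv (lt0r_neq0 (wavenumber_gt0 a)). Qed.

Lemma branch_deriv_continuous a : continuous (branch_deriv a).
Proof.
move=> t; have dc : is_derive t 1 (fun x => kap a * x) (kap a) by deriv; ring.
have cp := @oscillator_continuous' _ _ _ (profile_oscillator a) (kap a * t).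
apply: (cont_mul (@cont_cst _ a t)).
exact: (@continuous_comp _ _ _ (fun x => kap a * x) (pa a) t (has_deriv_continuous dc) cp).
Qed.

Definition branch_elt a : radialE r :=
  RadialE (C1_finite_energy hr (branch_fun_deriv a) (@branch_deriv_continuous a)).

Definition branch a : radialE r * R := (branch_elt a, kap a ^+ 2).

Lemma branch_weak_derivative a :
  is_weak_derivative r (branch_elt a) (branch_deriv a).
Proof. exact: C1_weak_derivative (branch_fun_deriv a) (@branch_deriv_continuous a). Qed.

Lemma profile_dilation_close a0 e : 0 < e -> \forall a \near a0, forall t, 0 <= t <= r ->
  `|ya a (kap a * t) - ya a0 (kap a0 * t)| < e /\
  `|pa a (kap a * t) - pa a0 (kap a0 * t)| < e.
Proof.
move=> e0; have e2 : 0 < e / 2 by rewrite divr_gt0.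
have osc := profile_oscillator a0.
have h1 := dilation_close r (oscillator_continuous osc) (@wavenumber_continuous a0) e2.
have h2 := dilation_close r (oscillator_continuous' osc) (@wavenumber_continuous a0) e2.
have h3 := profile_close a0 ((kap a0 + 1) * r) e2.
have h4 : \forall a \near a0, kap a < kap a0 + 1.
  by apply: (cvgr_lt (kap a0) (@wavenumber_continuous a0)); lra.
near=> a => t t0r; have /andP[t0 tr] := t0r.
have k1 : kap a < kap a0 + 1 by near: a.
have j1 : forall t, 0 <= t <= r -> `|ya a0 (kap a * t) - ya a0 (kap a0 * t)| < e / 2 by near: a.
have j2 : forall t, 0 <= t <= r -> `|pa a0 (kap a * t) - pa a0 (kap a0 * t)| < e / 2 by near: a.
have j3 : forall t, 0 <= t <= (kap a0 + 1) * r ->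
  `|ya a t - ya a0 t| < e / 2 /\ `|pa a t - pa a0 t| < e / 2 by near: a.
have K := wavenumber_gt0 a.
have kt : 0 <= kap a * t <= (kap a0 + 1) * r.
  by rewrite mulr_ge0 ?(ltW K)//= ler_pM ?(ltW K)// ltW.
have [i1 i2] := j3 _ kt; have i3 := j1 _ t0r; have i4 := j2 _ t0r.
split.
  by have := ler_distD (ya a0 (kap a * t)) (ya a (kap a * t)) (ya a0 (kap a0 * t)); lra.
by have := ler_distD (pa a0 (kap a * t)) (pa a (kap a * t)) (pa a0 (kap a0 * t)); lra.
Unshelve. all: by end_near. Qed.

(** A product of convergent factors, the second one uniformly on [0, r]. *)
Lemma scaled_close (c : R -> R) (f : R -> R -> R) a0 : {for a0, continuous c} ->
  continuous (f a0) ->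
  (forall e, 0 < e -> \forall a \near a0, forall t, 0 <= t <= r -> `|f a t - f a0 t| < e) ->
  forall e, 0 < e -> \forall a \near a0, forall t, 0 <= t <= r ->
    `|c a * f a t - c a0 * f a0 t| < e.
Proof.
move=> cc cf hf e e0.
have [|B _ hB] := @EVT_max _ (fun t => `|f a0 t|) 0 r (ltW hr).
  apply: continuous_within => t _.
  apply: (@continuous_comp _ _ _ (f a0) (fun x => `|x|)); first exact: cf.
  exact: norm_continuous.
set b := `|f a0 B| in hB; have b0 : 0 <= b by exact: normr_ge0.
pose e1 := Num.min 1 (e / (2 * (`|c a0| + 1))); pose e2 := e / (2 * (b + 1)).
have c0 := normr_ge0 (c a0).
have c1 : 0 < 2 * (`|c a0| + 1) by lra.
have b1 : 0 < 2 * (b + 1) by lra.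
have e10 : 0 < e1 by rewrite lt_min ltr01 divr_gt0.
have e20 : 0 < Num.min 1 e2 by rewrite lt_min ltr01 divr_gt0.
have h1 := hf _ e10.
have h2 : \forall a \near a0, `|c a - c a0| < Num.min 1 e2.
  have [d d0 hd] := (continuousP c a0).1 cc _ e20.
  by exists d => // a /= h; apply: hd; rewrite distrC.
near=> a => t t0r.
have j1 : forall t, 0 <= t <= r -> `|f a t - f a0 t| < e1 by near: a.
have : `|c a - c a0| < Num.min 1 e2 by near: a.
rewrite lt_min => /andP[j2 j3].
have j4 := j1 _ t0r.
have fb : `|f a0 t| <= b by apply: hB; rewrite in_itv.
have e1e : e1 <= e / (2 * (`|c a0| + 1)) by rewrite ge_min lexx orbT.
have ca : `|c a| <= `|c a0| + 1.
  by have := ler_distD (c a0) (c a) 0; rewrite !subr0; lra.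
have -> : c a * f a t - c a0 * f a0 t = c a * (f a t - f a0 t) + (c a - c a0) * f a0 t by ring.
apply: le_lt_trans (ler_normD _ _) _; rewrite !normrM.
have m1 : `|c a| * `|f a t - f a0 t| <= e / 2.
  apply: (@le_trans _ _ ((`|c a0| + 1) * e1)); first by apply: ler_pM => //; exact: ltW.
  by move: e1e; rewrite ler_pdivlMr//; lra.
have m2 : `|c a - c a0| * `|f a0 t| <= `|c a - c a0| * (b + 1).
  by apply: ler_wpM2l => //; lra.
have m3 : `|c a - c a0| * (2 * (b + 1)) < e by rewrite -ltr_pdivlMr.
by lra.
Unshelve. all: by end_near. Qed.

Lemma branch_elt_continuous : continuous branch_elt.
Proof.
move=> a0; apply/cvg_ballP => e e0.
pose e1 := e / (4 * r); have e10 : 0 < e1 by rewrite divr_gt0// mulr_gt0.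
have osc := profile_oscillator a0.
have K0 := wavenumber_gt0 a0.
have dil (f : R -> R) : continuous f -> continuous (fun t => f (kap a0 * t)).
  move=> cf t; have dc : is_derive t 1 (fun x => kap a0 * x) (kap a0) by deriv; ring.
  exact: (@continuous_comp _ _ _ (fun x => kap a0 * x) f t (has_deriv_continuous dc) (cf _)).
have cV : {for a0, continuous (fun a => (kap a)^-1)}.
  by apply: continuousV; [rewrite gt_eqF|exact: wavenumber_continuous].
have h1 := @scaled_close (fun a => a / kap a) (fun a t => ya a (kap a * t)) a0
  (cont_mul (@cont_id _ a0) cV) (dil _ (oscillator_continuous osc)).
have h2 := @scaled_close (fun a => a) (fun a t => pa a (kap a * t)) a0
  (@cont_id _ a0) (dil _ (oscillator_continuous' osc)).
have u1 (d : R) : 0 < d -> \forall a \near a0, forall t, 0 <= t <= r ->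
    `|ya a (kap a * t) - ya a0 (kap a0 * t)| < d.
  by move=> d0; apply: filterS (profile_dilation_close a0 d0) => a h t /h[].
have u2 (d : R) : 0 < d -> \forall a \near a0, forall t, 0 <= t <= r ->
    `|pa a (kap a * t) - pa a0 (kap a0 * t)| < d.
  by move=> d0; apply: filterS (profile_dilation_close a0 d0) => a h t /h[].
have {}h1 := h1 u1 _ e10; have {}h2 := h2 u2 _ e10.
near=> a.
have j1 : forall t, 0 <= t <= r ->
  `|a / kap a * ya a (kap a * t) - a0 / kap a0 * ya a0 (kap a0 * t)| < e1 by near: a.
have j2 : forall t, 0 <= t <= r ->
  `|a * pa a (kap a * t) - a0 * pa a0 (kap a0 * t)| < e1 by near: a.
change (radialE_norm (branch_elt a0 - branch_elt a) < e).
apply: (@le_lt_trans _ _ (2 * (r * e1))); last first.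
  by rewrite /e1 (_ : 2 * _ = e / 2); [lra|field; rewrite gt_eqF].
apply: (radialE_dist_le hr (branch_weak_derivative a0) (branch_weak_derivative a)).
- by move=> t tr; rewrite distrC; apply/ltW/j1.
- by move=> t tr; rewrite distrC; apply/ltW/j2.
Unshelve. all: by end_near. Qed.

Lemma branch_continuous : continuous branch.
Proof.
move=> a; apply: (@cvg_pair _ _ _ _ (nbhs (branch_elt a)) (nbhs (kap a ^+ 2))).
  exact: branch_elt_continuous.
have cK := @wavenumber_continuous a.
exact: (cont_mul cK cK).
Qed.

End Branch.

Section Solutions.
Local Open Scope card_scope.
Context {R : realType} (r : R) (hr : 0 < r) (k : nat) (hk : (0 < k)%N).
Implicit Types (a c t x : R).
Notation ya a := (profile a).1.
Notation pa a := (profile a).2.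
Notation kap := (wavenumber r k).

Lemma derive1_branch_fun a : derive1 (branch_fun r k a) = branch_deriv r k a.
Proof.
apply/funext => t; rewrite derive1E.
by have [_ ->] := branch_fun_deriv hr hk a t.
Qed.

Lemma dilation_ode a c x (w := fun x => a / c * ya a (c * x)) :
  0 < a -> 0 < c -> 0 < x ->
  is_derive x 1 (fun x => a * pa a (c * x))
    (- (c ^+ 2 * w x + c ^+ 2 * w x / (1 + c * w x)) - a * pa a (c * x) / x).
Proof.
move=> a0 c0 x0; have t0 : 0 < c * x by rewrite mulr_gt0.
have [g [s gE _ fl]] := profileP a; rewrite (gtr0_norm a0) in gE fl.
have dc : is_derive x 1 (fun x => c * x) c by deriv; ring.
have dp := radial_solution_derivative s (lt0r_neq0 t0).
have := @has_deriv_comp _ (pa a) (fun x => c * x) x _ _ dp dc.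
set f := fun x => pa a (c * x) => df.
change (is_derive x 1 (fun x => a * f x)
    (- (c ^+ 2 * w x + c ^+ 2 * w x / (1 + c * w x)) - a * pa a (c * x) / x)).
have f0 : 0 < 1 + a * ya a (c * x).
  exact: lt_trans (floor_gt0 _) (fl _ (ltW t0)).
deriv; rewrite gE ?(ltW t0)// /w.
have -> : c * (a / c * ya a (c * x)) = a * ya a (c * x).
  by field; rewrite gt_eqF.
by field; rewrite !gt_eqF.
Qed.

Lemma dilation_floor a c x : 0 < a -> 0 < c -> 0 <= x ->
  floor_ a < 1 + c * (a / c * ya a (c * x)).
Proof.
move=> a0 c0 x0; have [g [_ _ _ fl]] := profileP a; rewrite (gtr0_norm a0) in fl.
have -> : c * (a / c * ya a (c * x)) = a * ya a (c * x).
  by field; rewrite gt_eqF.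
by apply: fl; rewrite mulr_ge0// ltW.
Qed.

Lemma difference_quotient_cvg (w : R -> R) x (l : R) : is_derive x 1 w l ->
  (w (x + h) - w x) / h @[h --> 0^'] --> l.
Proof.
move=> dw; apply/cvgrPdist_lt => e e0.
have e2 : 0 < e / 2 by rewrite divr_gt0.
have [d d0 hd] := has_deriv_eps dw e2; near=> h.
have hh : `|h| < d by near: h; exact: dnbhs0_lt.
have h0 : h != 0 by near: h; exact: nbhs_dnbhs_neq.
have := hd _ hh.
have -> : l - (w (x + h) - w x) / h = - (w (x + h) - w x - l * h) / h by field.
rewrite normrM normrN normfV => H.
rewrite ltr_pdivrMr ?normr_gt0//; apply: le_lt_trans H _.
by rewrite ltr_pM2r ?normr_gt0//; lra.
Unshelve. all: by end_near. Qed.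

Lemma cvg_dnbhs_right (f : R -> R) (l : R) : f h @[h --> 0^'] --> l ->
  f h @[h --> 0^'+] --> l.
Proof.
apply: cvg_trans; apply: cvg_app => A [e e0 Ae].
by exists e => // x xe x0; apply: Ae => //; exact: lt0r_neq0.
Qed.

Lemma cvg_dnbhs_left (f : R -> R) (l : R) : f h @[h --> 0^'] --> l ->
  f h @[h --> 0^'-] --> l.
Proof.
apply: cvg_trans; apply: cvg_app => A [e e0 Ae].
by exists e => // x xe x0; apply: Ae => //; exact: ltr0_neq0.
Qed.

Lemma branch_mem a : 0 < a -> calS_plus r k (branch hr hk a).
Proof.
move=> a0; have K := wavenumber_gt0 hr hk a.
have sq : Num.sqrt (kap a ^+ 2) = kap a by rewrite sqrtr_sqr gtr0_norm.
have Kr : kap a * r = crit a k by rewrite /wavenumber divfK ?gt_eqF.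
have ch := wavesP a; have osc := profile_oscillator a.
have d0 : branch_deriv r k a 0 = 0.
  by rewrite /branch_deriv mulr0 (oscillator_deriv0 osc) mulr0.
have dr : branch_deriv r k a r = 0.
  by rewrite /branch_deriv Kr (chain_pT osc ch) mulr0.
have dw x := branch_fun_deriv hr hk a x.
have cg x := @branch_deriv_continuous _ r k a x.
split; last 2 first.
- rewrite /=; have -> : [set x | 0 < x < r /\ branch_fun r k a x = 0] =
    (fun i => (waves a).1 i / kap a) @` `I_k.
    transitivity ((fun t => t / kap a) @` ((waves a).1 @` `I_k)); last by rewrite image_comp.
    rewrite -(chain_zeros ch); apply/seteqP; split=> x /=.
      move=> [/andP[x0 xr] wx]; exists (kap a * x); last by field; rewrite gt_eqF.
      split; first by rewrite mulr_gt0//= -/(crit a k) -Kr ltr_pM2l.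
      move/eqP: wx; rewrite /branch_fun mulf_eq0 => /orP[|/eqP//].
      by rewrite mulf_eq0 invr_eq0 !gt_eqF.
    move=> [t [/andP[t0 tT] yt] <-]; rewrite divr_gt0//=.
    rewrite ltr_pdivrMr// mulrC Kr tT; split=> //.
    have -> : branch_fun r k a (t / kap a) = a / kap a * ya a t.
      by rewrite /branch_fun mulrCA divff ?gt_eqF// mulr1.
    by rewrite yt mulr0.
  by apply: increasing_card => i j ij; rewrite ltr_pM2r ?invr_gt0// (chain_ltX ch).
- by rewrite /= /branch_fun mulr0 profile0 mulr1 divr_gt0.
split.
  split=> /=; first by rewrite exprn_gt0.
  move=> x /andP[x0 _]; rewrite sq.
  exact: lt_trans (floor_gt0 a) (dilation_floor a0 K x0).
split=> /=.
- move=> x; rewrite in_itv/= => /andP[x0 xr].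
  rewrite derive1_branch_fun sq derive1E.
  have [d1 _] := dw x; have [d2 ->] := dilation_ode a0 K x0.
  by split=> //; rewrite subrK opprD.
- have := difference_quotient_cvg (dw 0); rewrite d0.
  by under eq_fun do rewrite add0r; exact: cvg_dnbhs_right.
- by rewrite derive1_branch_fun -[l in _ --> l]d0; apply: cvg_at_right_filter; exact: cg.
- by have := difference_quotient_cvg (dw r); rewrite dr; exact: cvg_dnbhs_left.
- by rewrite derive1_branch_fun -[l in _ --> l]dr; apply: cvg_at_left_filter; exact: cg.
Qed.

(** The derivative of a classical solution has a limit at [0], but no meaningful
    value there: it is extended by this limit. *)
Lemma patched_continuous (f : R -> R) (l : R) : f x @[x --> 0^'+] --> l ->
  {for 0, continuous (fun x => if x <= 0 then l else f x)}.
Proof.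
move=> /cvgrPdist_lt fl; apply/continuousP => e e0.
have [d /= d0 hd] := fl _ e0; exists d => // x; rewrite subr0 lexx => xd.
have [x0|x0] := leP x 0; first by rewrite subrr normr0.
by rewrite distrC; apply: hd => //=; rewrite sub0r normrN.
Qed.

Lemma quotient_cvg_right (w : R -> R) : (w h - w 0) / h @[h --> 0^'+] --> 0 ->
  w h @[h --> 0^'+] --> w 0.
Proof.
move=> /cvgrPdist_lt hq; apply/cvgrPdist_lt => e e0; have h1 := hq _ ltr01.
near=> h; have h0 : 0 < h by near: h; exact: nbhs_right_gt.
have he : h < e by near: h; exact: nbhs_right_lt.
have : `|0 - (w h - w 0) / h| < 1 by near: h.
rewrite sub0r normrN normrM normfV (gtr0_norm h0) ltr_pdivrMr// mul1r distrC.
by move=> H; exact: lt_trans he.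
Unshelve. all: by end_near. Qed.

(** Uniqueness for the initial value problem: a positive value at the centre
    determines the solution, and the Neumann condition together with the number
    of nodes determines the eigenvalue. *)
Lemma calS_plus_branch (u : radialE r) (L : R) : calS_plus r k (u, L) ->
  exists a, [/\ 0 < a, L = kap a ^+ 2 &
    forall x, 0 <= x <= r -> u x = branch_fun r k a x].
Proof.
move=> [[[/= L0 upos] [hode hq0 hd0 hqr hdr]] hcard u0].
move: (radialE_fun u) upos hode hq0 hd0 hqr hdr hcard u0 => w wpos hode hq0 hd0 hqr hdr hcard w0.
pose c := Num.sqrt L; have c0 : 0 < c by rewrite sqrtr_gt0.
have cL : c ^+ 2 = L by rewrite sqr_sqrtr// ltW.
pose a := c * w 0; have a0 : 0 < a by rewrite mulr_gt0.
pose W x := a / c * ya a (c * x); pose Q x := a * pa a (c * x).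
(* [v] and [q] extend [w] and its derivative continuously to the left of [0]. *)
pose v x := if x <= 0 then w 0 else w x.
pose q x := if x <= 0 then 0 else derive1 w x.
have cn : c != 0 by rewrite gt_eqF.
have dW x : is_derive x 1 W (Q x) by exact: dilation_deriv.
have cW x : {for x, continuous W} by exact: has_deriv_continuous (dW x).
have cQ x : {for x, continuous Q}.
  have dc : is_derive x 1 (fun x => c * x) c by deriv; ring.
  apply: (cont_mul (@cont_cst _ a x)).
  apply: (@continuous_comp _ _ _ (fun x => c * x) (pa a) x (has_deriv_continuous dc)).
  exact: (@oscillator_continuous' _ _ _ (profile_oscillator a)).
have vE x : 0 < x -> v x = w x by move=> x0; rewrite /v leNgt x0.
have qE x : 0 < x -> q x = derive1 w x by move=> x0; rewrite /q leNgt x0.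
have dv x : 0 < x < r -> is_derive x 1 v (q x).
  move=> /andP[x0 xr]; have [|d1 _ _] := hode x; first by rewrite in_itv/= x0.
  apply: (@near_eq_is_derive _ _ _ w); last by rewrite qE// derive1E; exact: derivableP.
  by near=> y; rewrite vE//; near: y; exact: lt_nbhsr.
have dq x : 0 < x < r -> is_derive x 1 q (- (L * v x + L * v x / (1 + c * v x)) - q x / x).
  move=> /andP[x0 xr]; have [|_ d2 ode] := hode x; first by rewrite in_itv/= x0.
  apply: (@near_eq_is_derive _ _ _ (derive1 w)).
    by near=> y; rewrite qE//; near: y; exact: lt_nbhsr.
  have := derivableP d2; rewrite -derive1E; move/has_deriv_eq; apply.
  by rewrite vE// qE// opprD -ode addrK.
have cv x : 0 <= x < r -> {for x, continuous v}.
  move=> /andP[]; rewrite le_eqVlt => /predU1P[<- _|x0 xr].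
    exact: patched_continuous (quotient_cvg_right hq0).
  by apply: (@has_deriv_continuous _ _ _ (q x)); apply: dv; rewrite x0.
have cq x : 0 <= x < r -> {for x, continuous q}.
  move=> /andP[]; rewrite le_eqVlt => /predU1P[<- _|x0 xr].
    exact: patched_continuous hd0.
  by apply: has_deriv_continuous (dq x _); rewrite x0.
(* The comparison is made on [0, x] with [x < r], where [1 + c v] has a positive
   minimum [d] and the nonlinearity is Lipschitz. *)
have same x : 0 < x < r -> w x = W x /\ derive1 w x = Q x.
  move=> /andP[x0 xr].
  have cvx : {within `[0, x], continuous v}.
    by apply: continuous_within => t /andP[t0 tx]; apply: cv; rewrite t0 (le_lt_trans tx).
  have cqx : {within `[0, x], continuous q}.
    by apply: continuous_within => t /andP[t0 tx]; apply: cq; rewrite t0 (le_lt_trans tx).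
  have [m] := EVT_min (ltW x0) cvx; rewrite in_itv/= => /andP[m0 mx] mmin.
  have vpos t : 0 <= t <= x -> 0 < 1 + c * v t.
    move=> /andP[]; rewrite le_eqVlt => /predU1P[<- _|t0 tx].
      by rewrite /v lexx; apply: wpos; rewrite lexx ltW.
    by rewrite vE//; apply: wpos; rewrite (ltW t0) (le_trans tx (ltW xr)).
  pose d := 1 + c * v m; have d0 : 0 < d by apply: vpos; rewrite m0.
  pose f := floor_ a; have f0 : 0 < f := floor_gt0 a.
  have K0 : 0 <= L * (1 + 1 / (d * f)).
    by rewrite mulr_ge0 ?(ltW L0)// addr_ge0// divr_ge0// mulr_ge0// ltW.
  have lip t : 0 < t < x -> `|(L * v t + L * v t / (1 + c * v t)) -
      (c ^+ 2 * W t + c ^+ 2 * W t / (1 + c * W t))| <=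
      L * (1 + 1 / (d * f)) * `|v t - W t| + 0.
    move=> /andP[t0 tx]; have tx' : 0 <= t <= x by rewrite !ltW.
    have hW : f <= 1 + c * W t by apply/ltW/dilation_floor => //; exact: ltW.
    have hv : d <= 1 + c * v t.
      by rewrite /d lerD2l ler_pM2l//; apply: mmin; rewrite in_itv.
    rewrite cL addr0; move: (v t) (W t) hv hW => V Z hv hW.
    have p1 : 0 < 1 + c * V by exact: lt_le_trans hv.
    have p2 : 0 < 1 + c * Z by exact: lt_le_trans hW.
    have -> : L * V + L * V / (1 + c * V) - (L * Z + L * Z / (1 + c * Z)) =
      L * (1 + 1 / ((1 + c * V) * (1 + c * Z))) * (V - Z).
      by field; rewrite !gt_eqF.
    have i0 : 0 <= 1 / ((1 + c * V) * (1 + c * Z)).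
      by rewrite divr_ge0// mulr_ge0// ltW.
    rewrite normrM ger0_norm; last by rewrite mulr_ge0 ?(ltW L0)// addr_ge0.
    rewrite ler_wpM2r// ler_pM2l// lerD2l ler_pM2l// lef_pV2 ?posrE ?mulr_gt0//.
    by apply: ler_pM => //; exact: ltW.
  have dv' t : 0 < t < x -> is_derive t 1 v (q t).
    by move=> /andP[t0 tx]; apply: dv; rewrite t0 (lt_trans tx).
  have dq' t : 0 < t < x -> is_derive t 1 q (- (L * v t + L * v t / (1 + c * v t)) - q t / t).
    by move=> /andP[t0 tx]; apply: dq; rewrite t0 (lt_trans tx).
  have dQ' t : 0 < t < x -> is_derive t 1 Q
      (- (c ^+ 2 * W t + c ^+ 2 * W t / (1 + c * W t)) - Q t / t).
    by move=> /andP[t0 tx]; exact: dilation_ode.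
  have := radial_comparison (lexx 0) (ltW x0) K0 (lexx 0)
    cvx cqx (continuous_within (fun t _ => cW t)) (continuous_within (fun t _ => cQ t))
    dv' dq' (fun t _ => dW t) dQ' lip.
  have -> : v 0 = W 0.
    by rewrite /v lexx /W mulr0 profile0 mulr1 /a mulrC mulKf.
  have -> : q 0 = Q 0.
    by rewrite /q lexx /Q mulr0 (oscillator_deriv0 (profile_oscillator a)) mulr0.
  rewrite !subrr expr0n /= !(mul0r, addr0) => h.
  have e1 := sqr_ge0 (v x - W x); have e2 := sqr_ge0 (q x - Q x).
  rewrite -vE// -qE//.
  by split; apply/eqP; rewrite -subr_eq0 -sqrf_eq0 eq_le ?e1 ?e2 andbT; lra.
(* At the boundary the one-sided difference quotient gives the continuity of [w]. *)
have wr : w r = W r.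
  apply/eqP; rewrite -subr_eq0 -normr_le0 leNgt; apply/negP => e0.
  have e2 : 0 < `|w r - W r| / 2 by rewrite divr_gt0.
  have [d d0 hd] := (continuousP W r).1 (cW r) _ e2.
  move/cvgrPdist_lt : hqr => /(_ _ ltr01) hqr.
  near (0 : R)^'- => h.
  have h0 : h < 0 by near: h; exact: nbhs_left_lt.
  have hm : - Num.min (Num.min d r) (`|w r - W r| / 2) < h.
    by near: h; apply: nbhs_left_gt; rewrite oppr_lt0 !lt_min d0 hr.
  have : `|0 - (w (r + h) - w r) / h| < 1 by near: h.
  rewrite sub0r normrN normrM normfV ltr_pdivrMr ?normr_gt0 ?lt_eqF// mul1r => H.
  have nh : `|h| = - h by rewrite ltr0_norm.
  have : - h < Num.min (Num.min d r) (`|w r - W r| / 2) by rewrite ltrNl.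
  rewrite !lt_min => /andP[/andP[k1 k2] k3].
  have rh : 0 < r + h < r by apply/andP; split; lra.
  have := hd (r + h); rewrite addrAC subrr add0r nh => /(_ k1).
  have [<- _] := same _ rh => H2.
  have := ler_distD (w (r + h)) (w r) (W r).
  by rewrite [`|w r - w (r + h)|]distrC; lra.
have hQ : derive1 w x @[x --> r^'-] --> Q r.
  apply: (@cvg_trans _ (Q x @[x --> r^'-])); last exact: cvg_at_left_filter (cQ r).
  apply: near_eq_cvg; near=> x.
  have [_ ->] // : w x = W x /\ derive1 w x = Q x.
  apply: same; apply/andP; split; last by near: x; exact: nbhs_left_lt.
  by near: x; exact: nbhs_left_gt.
have Qr : Q r = 0.
  by rewrite -(@cvg_lim _ (@Rhausdorff R) _ _ _ _ _ hQ); apply: cvg_lim.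
have S0 : 0 < c * r by rewrite mulr_gt0.
have pS : pa a (c * r) = 0.
  by move/eqP: Qr; rewrite /Q mulf_eq0 gt_eqF//= => /eqP.
have cS : [set t | 0 < t < c * r /\ ya a t = 0] #= `I_k.
  have -> : [set t | 0 < t < c * r /\ ya a t = 0] =
      (fun x => c * x) @` [set x | 0 < x < r /\ w x = 0].
    apply/seteqP; split=> t /=.
      move=> [/andP[t0 tr] yt]; exists (t / c); last by field.
      have xr : 0 < t / c < r by rewrite divr_gt0//= ltr_pdivrMr// mulrC.
      split=> //; have [-> _] := same _ xr.
      by rewrite /W (_ : c * (t / c) = t) ?yt ?mulr0//; field.
    move=> [x [xr wx] <-]; have [e _] := same _ xr.
    case/andP: xr => x0 xr; rewrite mulr_gt0// ltr_pM2l// xr; split=> //.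
    move: wx; rewrite e /W => /eqP; rewrite mulf_eq0 => /orP[|/eqP//].
    by rewrite mulf_eq0 invr_eq0 !gt_eqF.
  rewrite (card_eql (inj_card_eq _))// => x y _ _ /eqP.
  by rewrite (inj_eq (mulfI cn)) => /eqP.
have cr := chain_crit_unique (profile_oscillator a) (wavesP a) S0 pS cS.
have ck : c = kap a by rewrite /wavenumber /crit -cr mulfK// gt_eqF.
exists a; split=> //; first by rewrite -ck cL.
move=> x /andP[]; rewrite le_eqVlt => /predU1P[<- _|x0].
  by rewrite /branch_fun mulr0 profile0 mulr1 -ck /a mulrC mulKf.
rewrite le_eqVlt => /predU1P[->|xr]; first by rewrite wr /W ck.
by have [->] := same x (introT andP (conj x0 xr)); rewrite /W ck.
Unshelve. all: by end_near. Qed.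

End Solutions.

(** * Bounds along the branch *)

(** Elements of [calS_plus r k] that agree on [0, r] are at distance [0], so this
    set is only squeezed between the range of [branch] and its closure. *)
Lemma connected_between (U : topologicalType) (A B : set U) : connected A ->
  A `<=` B -> B `<=` closure A -> connected B.
Proof.
move=> cA AB BA D [x Dx] [V oV DV] [C cC DC].
have AV : A `&` V = A.
  apply: cA.
  - have Vx : V x by move: Dx; rewrite DV => -[].
    have Bx : B x by move: Dx; rewrite DV => -[].
    by have [y [Ay Vy]] := BA _ Bx V (open_nbhs_nbhs (conj oV Vx)); exists y.
  - by exists V.
  - exists C => //; apply/seteqP; split=> y [Ay Vy]; split=> //.
      have : D y by rewrite DV; split=> //; exact: AB.
      by rewrite DC => -[].
    have : D y by rewrite DC; split=> //; exact: AB.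
    by rewrite DV => -[].
have AC : A `<=` C.
  move=> y Ay; have : D y by rewrite DV; split; [exact: AB|move: Ay; rewrite -{1}AV => -[]].
  by rewrite DC => -[].
rewrite DC; apply/setIidPl => y By.
by rewrite ((closure_id C).1 cC); exact: closureS AC _ (BA _ By).
Qed.

Section Bounds.
Context {R : realType}.
Implicit Types (a t : R).
Notation ya a := (profile a).1.
Notation pa a := (profile a).2.

(** While [0 <= y <= 1] the source term is at most [2], so that [p >= - t]. *)
Lemma profile_lower a t : 0 <= t <= (waves a).1 0%N -> 1 - t ^+ 2 / 2 <= ya a t.
Proof.
move=> /andP[t0 tX]; have osc := profile_oscillator a; have ch := wavesP a.
have [g [s gE y0 fl]] := profileP a; have [dy cp p0 dF] := s.
have X0T := chain_XT ch 0.
have s0 (x : R) : sgk 0 * x = x by rewrite /sgk expr0 mul1r.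
have ypos u : 0 <= u -> u < t -> 0 <= ya a u <= 1.
  move=> u0 ut; apply/andP; split.
    rewrite -[leRHS]s0; apply/ltW/(chain_y_pos ch).
    by rewrite (chain_T0 ch) u0 (lt_le_trans ut).
  rewrite -y0; apply: (@derive_nonincreasing R (ya a) (pa a) _ _ u0).
  - move=> v /andP[v0 vu]; rewrite -[leLHS]s0; apply/ltW/(chain_p_neg ch).
    by rewrite (chain_T0 ch) v0; lra.
  - by apply: has_deriv_within => v _; exact: dy.
have gle u : 0 <= u -> u < t -> g u <= 2.
  move=> u0 ut; have /andP[yu0 yu1] := ypos _ u0 ut; rewrite gE//.
  have ay : 0 <= `|a| * ya a u by rewrite mulr_ge0.
  have : ya a u / (1 + `|a| * ya a u) <= ya a u.
    rewrite ler_pdivrMr; last by lra.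
    by rewrite mulrDr mulr1 lerDl mulr_ge0.
  by lra.
have ple u : 0 < u -> u < t -> - u <= pa a u.
  move=> u0 ut; suff : 0 * pa a 0 + 0 ^+ 2 <= u * pa a u + u ^+ 2.
    rewrite mul0r expr0n addr0 expr2 -mulrDr pmulr_rge0//; lra.
  have dS (v : R) : is_derive v 1 (fun v => v * pa a v + v ^+ 2) (v * (2 - g v)).
    have := dF v; set F := fun s => s * pa a s => dFv.
    change (is_derive v 1 (fun v => F v + v ^+ 2) (v * (2 - g v))).
    by deriv; ring.
  apply: (derive_nondecreasing (ltW u0) (fun v _ => dS v)); last first.
    exact: has_deriv_within (fun v _ => dS v).
  move=> v /andP[v0 vu]; rewrite mulr_ge0 ?(ltW v0)// subr_ge0.
  by apply: gle; [exact: ltW|exact: lt_trans ut].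
suff : ya a 0 + 0 ^+ 2 / 2 <= ya a t + t ^+ 2 / 2.
  by rewrite y0 expr0n /= mul0r; lra.
have dS (v : R) : is_derive v 1 (fun v => ya a v + v ^+ 2 / 2) (pa a v + v).
  by have dyv := dy v; deriv; field.
apply: (derive_nondecreasing t0 (fun v _ => dS v)); last first.
  exact: has_deriv_within (fun v _ => dS v).
by move=> v /andP[v0 vt]; have := ple _ v0 vt; lra.
Qed.

Lemma first_wave_lower a : 2 <= (waves a).1 0%N ^+ 2.
Proof.
have ch := wavesP a; have X0 := chain_X_gt0 ch 0.
have := @profile_lower a ((waves a).1 0%N); rewrite lexx (ltW X0) => /(_ erefl).
by rewrite (chain_yX ch); lra.
Qed.

Lemma crit_lower a k : (0 < k)%N -> 2 <= crit a k ^+ 2.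
Proof.
move=> k0; have ch := wavesP a; have X0 := chain_X_gt0 ch 0.
apply: le_trans (first_wave_lower a) _.
have h : (waves a).1 0%N <= crit a k.
  by apply: le_trans (ltW (chain_XT ch 0)) _; exact: (chain_leT ch).
by rewrite lerXn2r ?nnegrE ?(ltW X0)// (le_trans (ltW X0)).
Qed.

End Bounds.

Section Norms.
Context {R : realType} (r : R) (hr : 0 < r) (k : nat) (hk : (0 < k)%N).
Implicit Types (a t : R).
Notation kap := (wavenumber r k).

Definition wavenumber_max : R := (k.*2)%:R * (1 + pi) / r.

Lemma wavenumber_le a : kap a <= wavenumber_max.
Proof. by rewrite ler_pM2r ?invr_gt0// (chain_T_le (wavesP a)). Qed.

Lemma wavenumber_max_gt0 : 0 < wavenumber_max.
Proof. exact: lt_le_trans (wavenumber_gt0 hr hk 0) (wavenumber_le 0). Qed.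

(** By [profile_lower] the profile stays above [1 / 2] up to [t = 1], that is on
    the fixed interval [0, 1 / wavenumber_max]. *)
Lemma branch_norm_ge a : 0 < a ->
  a / (4 * wavenumber_max ^+ 2) <= radialE_norm (branch_elt hr hk a).
Proof.
move=> a0; have C0 := wavenumber_max_gt0; have K := wavenumber_gt0 hr hk a.
have KC := wavenumber_le a.
have Cr : wavenumber_max^-1 <= r.
  rewrite -div1r ler_pdivrMr// mulrC /wavenumber_max divfK ?gt_eqF//.
  have k1 : 1 <= (k.*2)%:R :> R by rewrite ler1n double_gt0.
  by have := pi_gt0 R; nra.
have C1 : 0 < wavenumber_max^-1 by rewrite invr_gt0.
have m0 : 0 <= a / (2 * wavenumber_max).
  exact: divr_ge0 (ltW a0) (mulr_ge0 (ler0n _ 2) (ltW C0)).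
have := @radialE_norm_ge _ r (branch_elt hr hk a) _ _ C1 Cr m0.
have -> : wavenumber_max^-1 / 2 * (a / (2 * wavenumber_max)) =
  a / (4 * wavenumber_max ^+ 2) by field; rewrite gt_eqF.
apply => t /andP[t0 tC] /=; rewrite /branch_fun.
have kt1 : kap a * t <= 1.
  apply: (@le_trans _ _ (wavenumber_max * t)); first by rewrite ler_wpM2r.
  by rewrite -ler_pdivlMl// mulr1.
have kt0 : 0 <= kap a * t by rewrite mulr_ge0// ltW.
have X1 : 1 <= (waves a).1 0%N.
  have := first_wave_lower a; have := chain_X_gt0 (wavesP a) 0 => h1 h2.
  by rewrite leNgt; apply/negP => h; nra.
have := @profile_lower _ a (kap a * t); rewrite kt0 (le_trans kt1)// => /(_ erefl) yl.
have y2 : 1 / 2 <= (profile a).1 (kap a * t).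
  apply: le_trans yl; have : (kap a * t) ^+ 2 <= 1 by rewrite exprn_ile1.
  by lra.
have -> : a / (2 * wavenumber_max) = a / wavenumber_max * (1 / 2) by field; rewrite gt_eqF.
apply: ler_pM => //; first by exact: divr_ge0 (ltW a0) (ltW C0).
by rewrite ler_pM2l// lef_pV2 ?posrE.
Qed.

End Norms.

Unset Implicit Arguments.

Theorem theorem4p3 (R : realType) (r : R) (hr : 0 < r) (k : nat) (hk : (1 <= k)%N) :
  let S : set (radialE r * R) := calS_plus r k in
  let Lambda : set R := [set lambda | exists w : radialE r, S (w, lambda)] in
  [/\ connected S,
      closure S ((0 : radialE r), mu_ r k / 2),
      (0 < ereal_inf (EFin @` Lambda))%E,
      (ereal_sup (EFin @` Lambda) < +oo)%E &
      ~ (exists M : R, forall p, S p -> `|p.1| <= M /\ `|p.2| <= M) /\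
      (exists u : nat -> radialE r * R,
        [/\ forall n, S (u n),
            `|(u n).1| @[n --> \oo] --> +oo &
            (u n).2 @[n --> \oo] -->
              (if odd k then nu_ r k.+1./2 else mu_ r k./2)])].
Proof.
move=> S Lambda.
have [yJ [pJ bes]] := @bessel_solution_exists R.
have [XJ [TJ chJ]] : exists X T, wave_chain yJ pJ X T.
  apply: wave_chain_exists (bessel_oscillator bes) _.
  by case: bes => g [].
have C0 := wavenumber_max_gt0 hr hk.
have in_branch p : S p -> exists a, [/\ 0 < a, p.2 = (branch hr hk a).2 &
    forall x, 0 <= x <= r -> p.1 x = (branch hr hk a).1 x].
  by case: p => u L; exact: calS_plus_branch.
have cb := @branch_continuous _ r hr k hk.
split.
- apply: (@connected_between _ (branch hr hk @` [set a | 0 < a])).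
  + apply: connected_continuous_connected; last exact: continuous_subspaceT.
    apply/connected_intervalP => x y /= x0 _ z /andP[xz _]; exact: lt_le_trans xz.
  + by move=> _ [a a0 <-]; exact: branch_mem.
  + move=> p /in_branch[a [a0 p2 p1]] N Np; exists (branch hr hk a).
    split; first by exists a.
    have [e /= e0 he] := (nbhs_ballP p N).1 Np; apply: he; split.
      change (radialE_norm (p.1 - (branch hr hk a).1) < e).
      by rewrite radialE_dist0.
    by rewrite p2; exact: ballxx.
- have b0 : branch hr hk 0 = ((0 : radialE r), mu_ r k / 2).
    congr (_, _).
      apply/val_inj/funext => x /=.
      by change (branch_fun r k 0 x = 0); rewrite /branch_fun !mul0r.
    change (wavenumber r k 0 ^+ 2 = mu_ r k / 2).
    rewrite -(prednK hk) (mu_E bes chJ) /wavenumber (crit0 bes chJ)//.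
    by rewrite !exprMn !exprVn sqr_sqrtr// mulrAC.
  rewrite -b0 => N Nb.
  have /nbhs_ballP[e /= e0 he] := cb _ _ Nb.
  exists (branch hr hk (e / 2)); split; first by apply: branch_mem; rewrite divr_gt0.
  apply: he; rewrite /ball/= sub0r normrN gtr0_norm ?divr_gt0//; lra.
- apply: (@lt_le_trans _ _ (2 / r ^+ 2)%:E).
    by rewrite lte_fin divr_gt0// exprn_gt0.
  apply: le_ereal_inf_tmp => _ [L [w /in_branch[a [a0 /= -> _]]] <-].
  by rewrite lee_fin /wavenumber exprMn exprVn ler_pM2r ?invr_gt0 ?exprn_gt0// crit_lower.
- apply: (@le_lt_trans _ _ (wavenumber_max r k ^+ 2)%:E); last exact: ltry.
  apply: ge_ereal_sup => _ [L [w /in_branch[a [a0 /= -> _]]] <-].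
  rewrite lee_fin lerXn2r ?nnegrE ?(ltW C0) ?(ltW (wavenumber_gt0 hr hk a))//.
  exact: wavenumber_le.
- pose u n := branch hr hk n.+1%:R.
  have Su n : S (u n) by apply: branch_mem.
  have nat_large (A : R) : \forall n \near \oo, A <= n.+1%:R.
    by apply: filterS (nbhs_infty_ger A) => n /le_trans; apply; rewrite ler_nat.
  have un : `|(u n).1| @[n --> \oo] --> +oo.
    apply/cvgryPge => A; apply: filterS (nat_large (A * (4 * wavenumber_max r k ^+ 2))) => n An.
    apply: le_trans (branch_norm_ge hr hk (ltr0Sn _ n)).
    by rewrite ler_pdivlMr// mulr_gt0// exprn_gt0.
  split.
    move=> [M hM]; move/cvgryPge : un => /(_ (M + 1)) [N _ hN].
    have := hN N (leqnn N); have [h _] := hM _ (Su N) => /=; lra.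
  exists u; split=> //=.
  have nat_pinfty : (n.+1%:R : R) @[n --> \oo] --> +oo.
    by apply/cvgryPge => A; exact: nat_large.
  have lim := @crit_large_cvg _ _ _ _ _ bes chJ k.
  have lim_n : crit (n.+1%:R : R) k @[n --> \oo] -->
      (if odd k then XJ k./2 else TJ k./2).
    exact: (@cvg_comp _ _ _ (fun n => n.+1%:R : R) (crit ^~ k) _ _ _ nat_pinfty lim).
  have -> : (if odd k then nu_ r k.+1./2 else mu_ r k./2) =
      ((if odd k then XJ k./2 else TJ k./2) / r) * ((if odd k then XJ k./2 else TJ k./2) / r).
    have kE := odd_double_half k.
    case ok: (odd k) kE => /=.
      by rewrite add1n => <-; rewrite /= !doubleK uphalf_double (nu_E bes chJ) expr2.
    rewrite add0n; case: (k./2) => [|j] kE; first by have := hk; rewrite -kE.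
    by rewrite (mu_E bes chJ) expr2.
  by apply: cvgM; apply: cvgM => //; exact: cvg_cst.
Qed.
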